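(* Suppose $N\ge 2$, $1<p<N$ and $0<\beta<p$. Then the space $\mathcal{D}^{1,2}_{0,*}(\mathbb{R}^N)$ compactly embeds into $L^2_{\beta,*}(\mathbb{R}^N)$.
   Context: Set $p^*_\beta=\frac{p(N-\beta)}{N-p}$ and $$U(x)=C_{N,p,\beta}\left(1+|x|^{\frac{p-\beta}{p-1}}\right)^{-\frac{N-p}{p-\beta}},\qquad C_{N,p,\beta}=\left[(N-\beta)\left(\tfrac{N-p}{p-1}\right)^{p-1}\right]^{\frac{N-p}{p(p-\beta)}}.$$ $L^2_{\beta,*}(\mathbb{R}^N)$ is the space of measurable functions $\varphi:\mathbb{R}^N\to\mathbb{R}$ with finite norm $\|\varphi\|_{L^2_{\beta,*}(\mathbb{R}^N)}=\left(\int_{\mathbb{R}^N}|x|^{-\beta}U^{p^*_\beta-2}\varphi^2\,dx\right)^{1/2}$. $C^1_{c,0}(\mathbb{R}^N)$ is the space of compactly supported functions of class $C^1$ that are zero in a neighborhood of the origin, and $\mathcal{D}^{1,2}_{0,*}(\mathbb{R}^N)$ is the completion of $C^1_{c,0}(\mathbb{R}^N)$ with respect to the norm $\|u\|_{\mathcal{D}^{1,2}_{0,*}(\mathbb{R}^N)}=\left(\int_{\mathbb{R}^N}|\nabla U|^{p-2}|\nabla u|^2\,dx\right)^{1/2}$. *)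

(* Defs.v *)
From HB Require Import structures.
From mathcomp Require Import all_boot all_order all_algebra generic_quotient.
From mathcomp Require Import all_classical all_reals all_analysis measurable_realfun.

Set Implicit Arguments.
Unset Strict Implicit.
Unset Printing Implicit Defensive.

Import Order.TTheory GRing.Theory Num.Theory.
Import numFieldNormedType.Exports.

Local Open Scope classical_set_scope.
Local Open Scope ring_scope.

Definition rV_display : measure_display. Proof. exact: default_measure_display. Qed.

Section measurable_rV.
Context {R : realType} (n : nat).

Let coord (i : 'I_n) (x : 'rV[R]_n) : R := x ord0 i.

Let rV_set0 : g_sigma_preimage coord set0.
Proof. exact: sigma_algebra0. Qed.

Let rV_setC A : g_sigma_preimage coord A -> g_sigma_preimage coord (~` A).
Proof. exact: sigma_algebraC. Qed.

Let rV_bigcup (F : (set 'rV[R]_n)^nat) :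
  (forall i, g_sigma_preimage coord (F i)) ->
  g_sigma_preimage coord (\bigcup_i F i).
Proof. exact: sigma_algebra_bigcup. Qed.

(* The sigma-algebra generated by the coordinates, i.e. the Borel one. *)
HB.instance Definition _ := @isMeasurable.Build rV_display
  'rV[R]_n (g_sigma_preimage coord) rV_set0 rV_setC rV_bigcup.

End measurable_rV.

Section measurable_rV_theory.
Context {R : realType}.

Lemma measurable_coord n (i : 'I_n) :
  measurable_fun [set: 'rV[R]_n] (fun x : 'rV[R]_n => x ord0 i).
Proof.
move=> _ Y mY; rewrite setTI; apply: sub_sigma_algebra => /=.
rewrite -bigcup_seq/=; exists i => /=; first by rewrite mem_index_enum.
by exists Y => //; rewrite setTI.
Qed.

Lemma measurable_fun_coord d (T : measurableType d) n (f : T -> 'rV[R]_n) :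
  (forall i, measurable_fun [set: T] (fun t => f t ord0 i)) ->
  measurable_fun [set: T] f.
Proof.
move=> mf _ A mA; rewrite setTI.
pose G : set_system 'rV[R]_n := [set B | measurable (f @^-1` B)].
suff : (measurable : set_system 'rV[R]_n) `<=` G by apply.
apply: smallest_sub.
  split; rewrite /G/=.
  - by rewrite preimage_set0.
  - by move=> B mB; rewrite setTD preimage_setC; exact: measurableC.
  - by move=> F mF; rewrite preimage_bigcup; exact: bigcup_measurable.
rewrite -bigcup_seq; apply: bigcup_sub => i _ _ [C mC <-].
rewrite /G/= setTI.
by have := mf i measurableT C mC; rewrite setTI.
Qed.

Definition cons_rV n (xv : measurableTypeR R * 'rV[R]_n) : 'rV[R]_n.+1 :=
  row_mx (xv.1%:M : 'rV[R]_1) xv.2.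

Lemma cons_rV0 n xv : @cons_rV n xv ord0 ord0 = xv.1.
Proof.
transitivity (row_mx (xv.1%:M : 'rV[R]_1) xv.2 ord0 (lshift n ord0)).
  by congr (row_mx _ _ _ _); exact/val_inj.
by rewrite row_mxEl mxE eqxx mulr1n.
Qed.

Lemma cons_rVS n xv i : @cons_rV n xv ord0 (lift ord0 i) = xv.2 ord0 i.
Proof.
transitivity (row_mx (xv.1%:M : 'rV[R]_1) xv.2 ord0 (rshift 1 i)).
  by congr (row_mx _ _ _ _); exact/val_inj.
by rewrite row_mxEr.
Qed.

Lemma measurable_cons_rV n : measurable_fun setT (@cons_rV n).
Proof.
apply: measurable_fun_coord => i; case: (unliftP ord0 i) => [j ->|->].
  under eq_fun do rewrite cons_rVS.
  exact: (measurableT_comp (measurable_coord j) measurable_snd).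
under eq_fun do rewrite cons_rV0.
exact: measurable_fst.
Qed.

Definition uncons_rV n (v : 'rV[R]_n.+1) : measurableTypeR R * 'rV[R]_n :=
  (v ord0 ord0, \row_i v ord0 (lift ord0 i)).

Lemma cons_rVK n : cancel (@cons_rV n) (@uncons_rV n).
Proof.
move=> [a v]; rewrite /uncons_rV cons_rV0; congr pair.
by apply/rowP => i; rewrite mxE cons_rVS.
Qed.

Lemma measurable_uncons_rV n : measurable_fun setT (@uncons_rV n).
Proof.
apply/measurable_fun_pairP; split; first exact: (measurable_coord ord0).
apply: measurable_fun_coord => i.
rewrite (_ : (fun _ => _) = fun v : 'rV[R]_n.+1 => v ord0 (lift ord0 i)).
  exact: measurable_coord.
by apply/funext => v; rewrite /= mxE.
Qed.

End measurable_rV_theory.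

Section lebesgue_rV.
Context {R : realType}.
Local Open Scope ereal_scope.

Section step.
Variables (n : nat) (mu : {sigma_finite_measure set 'rV[R]_n -> \bar R}).

Definition lebesgue_rV_step : set 'rV[R]_n.+1 -> \bar R :=
  pushforward (lebesgue_measure \x mu) (@cons_rV R n).

Let nu : {measure set 'rV[R]_n.+1 -> \bar R} :=
  measure_function_pushforward__canonical__measure_function_Measure
    (lebesgue_measure \x mu) (@measurable_cons_rV R n).

HB.instance Definition _ := isMeasure.Build _ _ _ lebesgue_rV_step
  (measure0 nu) (measure_ge0 nu) (@measure_semi_sigma_additive _ _ _ nu).

Let lebesgue_rV_step_sigma_finite : sigma_finite setT lebesgue_rV_step.
Proof.
have /sigma_finiteP[F [FT ndF Foo]] := sigma_finiteT (@lebesgue_measure R).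
have /sigma_finiteP[G [GT ndG Goo]] := sigma_finiteT mu.
exists (fun k => @uncons_rV R n @^-1` (F k `*` G k)).
  rewrite -preimage_bigcup (_ : \bigcup_k _ = setT) ?preimage_setT//.
  apply/seteqP; split=> // -[x y] _.
  have [k _ Fkx] : (\bigcup_k F k) x by rewrite -FT.
  have [l _ Gly] : (\bigcup_k G k) y by rewrite -GT.
  exists (maxn k l) => //; split=> /=.
    by move: x Fkx; exact/subsetPset/ndF/leq_maxl.
  by move: y Gly; exact/subsetPset/ndG/leq_maxr.
move=> k; have [mF Fk] := Foo k; have [mG Gk] := Goo k; split.
  by rewrite -[X in measurable X]setTI; apply: measurable_uncons_rV => //;
    exact: measurableX.
rewrite /lebesgue_rV_step /pushforward -comp_preimage.
rewrite (_ : _ \o _ = id); last by apply/funext => x; exact: cons_rVK.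
by rewrite preimage_id product_measure1E// lte_mul_pinfty// ge0_fin_numE.
Qed.

HB.instance Definition _ := Measure_isSigmaFinite.Build _ _ _ lebesgue_rV_step
  lebesgue_rV_step_sigma_finite.

End step.

(* Lebesgue measure on R^n, as the n-fold product of that of R. *)
Fixpoint lebesgue_rV (n : nat) : {sigma_finite_measure set 'rV[R]_n -> \bar R} :=
  match n with
  | 0%N => \d_(0%R : 'rV[R]_0)
  | n'.+1 => lebesgue_rV_step (lebesgue_rV n')
  end.

Lemma lebesgue_rV_box n (A : 'I_n -> set R) :
  (forall i, measurable (A i)) ->
  lebesgue_rV n [set v : 'rV[R]_n | forall i, A i (v ord0 i)] =
  \prod_(i < n) lebesgue_measure (A i).
Proof.
elim: n A => [|n ih] A mA.
  by rewrite big_ord0 /= diracE mem_set// => -[].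
rewrite big_ord_recl /= /lebesgue_rV_step /pushforward -ih//.
rewrite -product_measure1E; last 2 first.
- exact: mA.
- rewrite (_ : mkset _ = \bigcap_(i in [set: 'I_n])
      ((fun v : 'rV[R]_n => v ord0 i) @^-1` A (lift ord0 i))).
    apply: fin_bigcap_measurable => // i _.
    by rewrite -[X in measurable X]setTI; exact: measurable_coord.
  by apply/seteqP; split=> v /= Av i; [move=> _|]; exact: Av.
congr (product_measure1 _ _ _); apply/seteqP; split=> -[a v] /=.
  move=> Av; split=> [|i]; first by have := Av ord0; rewrite cons_rV0.
  by have := Av (lift ord0 i); rewrite cons_rVS.
move=> [Aa Av] i; case: (unliftP ord0 i) => [k ->|->].
  by rewrite cons_rVS.
by rewrite cons_rV0.
Qed.

End lebesgue_rV.

Section setting.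
Context {R : realType} {N : nat}.
Implicit Types (x : 'rV[R]_N) (p beta : R).

(* The library norm of 'rV[R]_N is the sup norm. *)
Definition enorm x : R := Num.sqrt (\sum_i x ord0 i ^+ 2).

Definition grad (f : 'rV[R]_N -> R) x : 'rV[R]_N :=
  \row_i 'D_(delta_mx ord0 i) f x.

Definition crit_exp p beta : R := p * (N%:R - beta) / (N%:R - p).

Definition U_const p beta : R :=
  ((N%:R - beta) * ((N%:R - p) / (p - 1)) `^ (p - 1))
    `^ ((N%:R - p) / (p * (p - beta))).

Definition U p beta x : R :=
  U_const p beta *
  (1 + enorm x `^ ((p - beta) / (p - 1))) `^ (- ((N%:R - p) / (p - beta))).

(* At the origin, a null set, 0 `^ (- beta) is 0 instead of +oo. *)
Definition L2_weight p beta x : R :=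
  enorm x `^ (- beta) * U p beta x `^ (crit_exp p beta - 2).

Definition L2_enorm p beta (f : 'rV[R]_N -> R) : \bar R :=
  ((\int[lebesgue_rV N]_x (L2_weight p beta x * f x ^+ 2)%:E) `^ 2^-1)%E.

Definition D12_enorm p beta (u : 'rV[R]_N -> R) : \bar R :=
  ((\int[lebesgue_rV N]_x
      (enorm (grad (U p beta) x) `^ (p - 2) * enorm (grad u x) ^+ 2)%:E)
   `^ 2^-1)%E.

Lemma measurable_sqrt : measurable_fun setT (@Num.sqrt R).
Proof.
by apply: continuous_measurable_fun; exact: sqrt_continuous.
Qed.

Lemma measurable_enorm : measurable_fun setT enorm.
Proof.
have mS : measurable_fun setT (fun x : 'rV[R]_N => \sum_i x ord0 i ^+ 2).
  by apply: measurable_sum => i; apply: measurable_funX; exact: measurable_coord.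
exact: (measurableT_comp measurable_sqrt mS).
Qed.

Lemma measurable_L2_weight p beta : measurable_fun setT (L2_weight p beta).
Proof.
apply: measurable_funM.
  exact: (measurableT_comp (measurable_powR _) measurable_enorm).
apply: (measurableT_comp (measurable_powR _)).
apply: measurable_funM => //.
apply: (measurableT_comp (measurable_powR _)).
apply: measurable_funD => //.
exact: (measurableT_comp (measurable_powR _) measurable_enorm).
Qed.

Lemma L2_weight_ge0 p beta x : 0 <= L2_weight p beta x.
Proof. by rewrite mulr_ge0 ?powR_ge0. Qed.

Lemma L2_enormE p beta f : L2_enorm p beta f =
  'N[lebesgue_rV N]_2%:E[EFin \o ((Num.sqrt \o L2_weight p beta) \* f)%R]%E.
Proof.
rewrite unlock /L2_enorm; congr (_ `^ _)%E; apply: eq_integral => x _ /=.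
rewrite powR_mulrn// real_normK ?num_real// exprMn sqr_sqrtr//.
exact: L2_weight_ge0.
Qed.

End setting.

Section L2_space.
Context (R : realType) (N : nat) (p beta : R).
Notation rV := 'rV[R]_N.
Let w : rV -> R := L2_weight p beta.

Definition L2_pred : {pred rV -> R} :=
  mem [set f | measurable_fun setT f /\ (L2_enorm p beta f < +oo)%E].

Record L2fun := MkL2fun { L2fun_val :> rV -> R ; _ : L2fun_val \in L2_pred }.
HB.instance Definition _ := [isSub for L2fun_val].
HB.instance Definition _ := [Choice of L2fun by <:].

Let sw (f : rV -> R) : rV -> R := (Num.sqrt \o w) \* f.

Let msw f : measurable_fun setT f -> measurable_fun setT (sw f).
Proof.
move=> mf; apply: measurable_funM => //.
exact: (measurableT_comp measurable_sqrt (measurable_L2_weight p beta)).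
Qed.

Let L2_predP f : reflect
  (measurable_fun setT f /\ sw f \in Lfun (lebesgue_rV N) 2%:E)
  (f \in L2_pred).
Proof.
apply: (iffP idP) => [/set_mem[mf fin]|[mf /andP[_ /set_mem fin]]].
  split=> //; apply/andP; split; first by apply: mem_set; exact: msw.
  by apply/mem_set; rewrite /= /finite_norm -L2_enormE.
by apply/mem_set; split=> //; rewrite L2_enormE.
Qed.

Let le1_2 : (1 <= 2%:E :> \bar R)%E.
Proof. by rewrite lee_fin ler1n. Qed.

Lemma L2_submod_closed : submod_closed L2_pred.
Proof.
split.
  apply/L2_predP; split; first exact: measurable_cst.
  rewrite (_ : sw 0 = 0); first exact: (Lfun_submod_closed _ le1_2).1.
  by apply/funext => x; rewrite /sw /= mulr0.
move=> a f g /L2_predP[mf fL] /L2_predP[mg gL]; apply/L2_predP; split.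
  by apply: measurable_funD => //; exact: measurable_funM.
rewrite (_ : sw _ = a *: sw f + sw g).
  exact: (Lfun_submod_closed _ le1_2).2.
by apply/funext => x; rewrite /sw /= !fctE mulrDr scalerAr.
Qed.

HB.instance Definition _ := GRing.isSubmodClosed.Build _ _ L2_pred
  L2_submod_closed.
HB.instance Definition _ := [SubChoice_isSubLmodule of L2fun by <:].

Definition L2_seminorm (f : L2fun) : R := fine (L2_enorm p beta f).

Let L2fun_Lfun (f : L2fun) : sw f \in Lfun (lebesgue_rV N) 2%:E.
Proof. by case: f => f /= /L2_predP[]. Qed.

Let lf (f : L2fun) : LfunType (lebesgue_rV N) le1_2 :=
  Lfun_Sub le1_2 (L2fun_Lfun f).

Let L2_seminormE (f : L2fun) :
  (L2_seminorm f)%:E = ('N[lebesgue_rV N]_2%:E[EFin \o lf f])%E.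
Proof. by rewrite -finite_norm_fine /L2_seminorm L2_enormE. Qed.

Let lfD f g : lf (f + g) = lf f + lf g :> (_ -> _).
Proof. by apply/funext => x; rewrite /= /sw /= mulrDr. Qed.

Let lfZ a f : lf (a *: f) = a *: lf f :> (_ -> _).
Proof. by apply/funext => x; exact: mulrCA. Qed.

Lemma L2_seminormD f g : L2_seminorm (f + g) <= L2_seminorm f + L2_seminorm g.
Proof.
by rewrite -lee_fin EFinD !L2_seminormE lfD eminkowski//; exact/measurable_EFinP.
Qed.

Lemma L2_seminormZ a f : L2_seminorm (a *: f) = `|a| * L2_seminorm f.
Proof. by apply: EFin_inj; rewrite EFinM !L2_seminormE lfZ LnormZ. Qed.

Lemma L2_seminorm_ge0 f : 0 <= L2_seminorm f.
Proof. by rewrite -lee_fin L2_seminormE Lnorm_ge0. Qed.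

Definition L2_null : {pred L2fun} := mem [set f | L2_seminorm f = 0].

Lemma L2_null_submod_closed : submod_closed L2_null.
Proof.
have n0 : L2_seminorm 0 = 0 by rewrite -(scale0r 0) L2_seminormZ normr0 mul0r.
split=> [|a f g /set_mem/= f0 /set_mem/= g0]; apply/mem_set => //=.
apply/eqP; rewrite eq_le L2_seminorm_ge0 andbT.
by rewrite (le_trans (L2_seminormD _ _))// L2_seminormZ f0 g0 mulr0 addr0.
Qed.

HB.instance Definition _ := GRing.isSubmodClosed.Build _ _ L2_null
  L2_null_submod_closed.

(* Functions at distance zero are identified, as they must be for the given
   integral to be a norm. *)
Definition L2 : Type := Quotient.quot L2_null.
HB.instance Definition _ := GRing.Zmodule.on L2.

Definition L2_class (f : L2fun) : L2 :=
  (\pi_(Quotient.quot L2_null) f)%qT.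

Lemma L2_class_eq f g : (L2_class f == L2_class g) = (L2_seminorm (f - g) == 0).
Proof.
rewrite -[LHS]Quotient.idealrBE.
by apply/idP/eqP => [/set_mem//|fg]; exact/mem_set.
Qed.

Lemma L2_class_is_zmod_morphism : zmod_morphism L2_class.
Proof. by move=> f g; rewrite /L2_class raddfB. Qed.

HB.instance Definition _ := GRing.isZmodMorphism.Build L2fun L2 L2_class
  L2_class_is_zmod_morphism.

Lemma L2_class_surj (f : L2) : {g | L2_class g = f}.
Proof. by exists (repr f); exact: reprK. Qed.

Definition L2_scale (a : R) (f : L2) : L2 :=
  L2_class (a *: sval (L2_class_surj f)).

Definition L2_norm (f : L2) : R := L2_seminorm (sval (L2_class_surj f)).

Lemma L2_scale_class a f : L2_scale a (L2_class f) = L2_class (a *: f).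
Proof.
rewrite /L2_scale; case: L2_class_surj => g /= /eqP; rewrite L2_class_eq => /eqP gf.
by apply/eqP; rewrite L2_class_eq -scalerBr L2_seminormZ gf mulr0.
Qed.

Lemma L2_norm_class f : L2_norm (L2_class f) = L2_seminorm f.
Proof.
rewrite /L2_norm; case: L2_class_surj => g /= /eqP; rewrite L2_class_eq => /eqP gf.
have fg : L2_seminorm (f - g) = 0.
  by rewrite -opprB -scaleN1r L2_seminormZ gf mulr0.
apply/eqP; rewrite eq_le; apply/andP; split.
  by rewrite -[g](subrK f) (le_trans (L2_seminormD _ _))// gf add0r.
by rewrite -[f in leLHS](subrK g) (le_trans (L2_seminormD _ _))// fg add0r.
Qed.

Let L2_scaleA a b f : L2_scale a (L2_scale b f) = L2_scale (a * b) f.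
Proof. by have [g <-] := L2_class_surj f; rewrite !L2_scale_class scalerA. Qed.

Let L2_scale1 : left_id 1 L2_scale.
Proof. by move=> f; have [g <-] := L2_class_surj f; rewrite L2_scale_class scale1r. Qed.

Let L2_scaleDr : right_distributive L2_scale +%R.
Proof.
move=> a f g; have [f' <-] := L2_class_surj f; have [g' <-] := L2_class_surj g.
by rewrite -raddfD !L2_scale_class scalerDr raddfD.
Qed.

Let L2_scaleDl f : {morph L2_scale^~ f : a b / a + b}.
Proof.
move=> a b; have [g <-] := L2_class_surj f.
by rewrite !L2_scale_class scalerDl raddfD.
Qed.

HB.instance Definition _ := GRing.Zmodule_isLmodule.Build R L2
  L2_scaleA L2_scale1 L2_scaleDr L2_scaleDl.

Lemma L2_class_is_scalable : scalable L2_class.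
Proof. by move=> a f; rewrite -L2_scale_class. Qed.

HB.instance Definition _ := GRing.isScalable.Build R L2fun L2 *:%R L2_class
  L2_class_is_scalable.

Let L2_normD (f g : L2) : L2_norm (f + g) <= L2_norm f + L2_norm g.
Proof.
have [f' <-] := L2_class_surj f; have [g' <-] := L2_class_surj g.
by rewrite -raddfD !L2_norm_class L2_seminormD.
Qed.

Let L2_normZ a (f : L2) : L2_norm (a *: f) = `|a| * L2_norm f.
Proof.
have [g <-] := L2_class_surj f.
by rewrite -linearZ !L2_norm_class L2_seminormZ.
Qed.

Let L2_norm_eq0 (f : L2) : L2_norm f = 0 -> f = 0.
Proof.
have [g <-] := L2_class_surj f; rewrite L2_norm_class => g0.
by apply/eqP; rewrite -(raddf0 L2_class) L2_class_eq subr0 g0.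
Qed.

HB.instance Definition _ := Lmodule_isNormed.Build R L2
  L2_normD L2_normZ L2_norm_eq0.

End L2_space.

Section C1c0_space.
Context (R : realType) (N : nat).
Notation rV := 'rV[R]_N.

Definition C1c0_pred : {pred rV -> R} :=
  mem [set u | [/\ forall x, differentiable u x,
                   continuous (grad u),
                   compact (closure [set x | u x != 0])
                 & \forall x \near (0 : rV), u x = 0]].

Record C1c0 := MkC1c0 { C1c0_val :> rV -> R ; _ : C1c0_val \in C1c0_pred }.
HB.instance Definition _ := [isSub for C1c0_val].
HB.instance Definition _ := [Choice of C1c0 by <:].

Lemma C1c0_submod_closed : submod_closed C1c0_pred.
Proof.
split.
  apply/mem_set; split=> //.
  - rewrite (_ : grad 0 = cst 0); first by move=> x; exact: cst_continuous.
    by apply/funext => x; apply/rowP => i; rewrite !mxE; exact: (@derive_cst _ _ _ (0 : R)).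
  - rewrite (_ : [set _ | _] = set0) ?closure0; first exact: compact0.
    by apply/seteqP; split=> // x /=; rewrite eqxx.
  - by apply: (@filterE _ (nbhs (0 : rV))).
move=> a u v /set_mem[du cu ku u0] /set_mem[dv cv kv v0]; apply/mem_set; split.
- by move=> x; apply: differentiableD => //; exact: differentiableZ.
- rewrite (_ : grad _ = fun x => a *: grad u x + grad v x).
    by move=> x; exact: (cvgD (cvgZ (cvg_cst a) (cu x)) (cv x)).
  apply/funext => x; apply/rowP => i; rewrite !mxE deriveD ?deriveZ//.
  + exact: diff_derivable.
  + by apply: derivableZ; exact: diff_derivable.
  + exact: diff_derivable.
- apply: (@subclosed_compact _ _ (closure [set x | u x != 0] `|`
                                  closure [set x | v x != 0])).
  + exact: closed_closure.
  + exact: compactU.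
  + rewrite -closureU; apply: closure_subset => x /=; rewrite !fctE.
    have [->|] := eqVneq (u x) 0; last by left.
    by rewrite scaler0 add0r; right.
- have {}u0 : nbhs (0 : rV) [set x | u x = 0] by exact: u0.
  have {}v0 : nbhs (0 : rV) [set x | v x = 0] by exact: v0.
  suff : nbhs (0 : rV) [set x | (a *: u + v) x = 0] by [].
  apply: (@filterS2 _ (nbhs (0 : rV)) _ _ _ _ _ u0 v0) => x /= ux vx.
  by rewrite !fctE ux vx scaler0 addr0.
Qed.

HB.instance Definition _ := GRing.isSubmodClosed.Build _ _ C1c0_pred
  C1c0_submod_closed.
HB.instance Definition _ := [SubChoice_isSubLmodule of C1c0 by <:].

End C1c0_space.

(* nm is extended real-valued: its finiteness is part of the isometry. *)
Definition is_completion (R : realType) (E : lmodType R) (nm : E -> \bar R)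
    (D : completeNormedModType R) (j : {linear E -> D}) : Prop :=
  (forall u, `|j u|%:E = nm u) /\ dense (range j).

Definition compact_embedding (R : realType) (X Y : normedModType R)
    (T : {linear X -> Y}) : Prop :=
  [/\ injective T, continuous T
    & forall A : set X, bounded_set A -> precompact (T @` A)].

(* Main.v *)
Require Import Defs.
From mathcomp Require Import all_boot all_order all_algebra.
From mathcomp Require Import all_classical all_reals all_analysis.
From HB Require Import structures.
From mathcomp Require Import measurable_realfun ring lra.

Set Implicit Arguments.
Unset Strict Implicit.
Unset Printing Implicit Defensive.

Import Order.TTheory GRing.Theory Num.Theory.
Import numFieldNormedType.Exports.

Local Open Scope classical_set_scope.
Local Open Scope ring_scope.

(** Write [r = |x|] and [q = (p - beta) / (p - 1)].  Up to constants the weight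
    [a = |grad U|^(p-2)] of the energy and the weight [b = L2_weight] of the
    target space are
      [a ~ r^(2-beta-q) (1+r^q)^(2-tau)],   [b ~ r^(-beta) (1+r^q)^(-tau)],
    so that [a / (b r^2) ~ r^(-q) (1+r^q)^2] blows up both at the origin and at
    infinity.  There is room for an intermediate weight [V] with [V r^2 <= C a]
    and [V / b] tending to infinity at both ends, for which Hardy's inequality
    [int V u^2 <= C int a |grad u|^2] holds: the field [V x] has divergence at
    least [c V], and the integral of [div (u^2 V x)] is zero ([hardy],
    [weights_admissible]).

    Hardy's inequality gives the continuity of the embedding, and makes the mass
    [int b u^2] off a large shell [{r1 <= |x| <= r2}] a small multiple of the
    energy.  On a shell both weights are bounded above and below, and Rellich's
    argument applies: a function is compared with its means over finitely many
    small cubes, the error being controlled by the increments of the function,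
    hence by the energy ([rellich]).  The means are finitely many functionals
    that are bounded on bounded sets, so that bounded sets have totally bounded
    images ([emb_small_parts]).

    The embedding itself is the closure of the graph of the inclusion of the
    [C^1] functions into the target space.  It is defined everywhere because the
    target space is complete ([L2fun_complete]), and single-valued by Hardy's
    inequality.  It is injective because the energy is closable: if [w] has
    bounded energy and small mass, then the energy pairing of [w] with a fixed
    [u] is small, since up to a small error the derivative of [w] can be replaced
    by a difference quotient, which can be transferred to the other factor
    ([D12_pairing_small], [graph_closure_injective]).

    All integrations by parts rest on the translation invariance of Lebesgue
    measure, on Fubini's theorem and on the fundamental theorem of calculus along
    lines ([integral_increment]). *)

(** * Translation invariance of Lebesgue measure *)

Section translation.
Context {R : realType}.

Lemma lebesgue_measure_shift (r : R) (A : set R) : measurable A ->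
  lebesgue_measure A =
  pushforward lebesgue_measure ((fun x => x + r) : _ -> measurableTypeR R) A.
Proof.
move=> mA.
have mf : measurable_fun setT ((fun x => x + r) : measurableTypeR R -> measurableTypeR R).
  by apply: measurable_funD.
pose nu : {measure set (measurableTypeR R) -> \bar R} :=
  measure_function_pushforward__canonical__measure_function_Measure lebesgue_measure mf.
apply: (@lebesgue_measure_unique R nu) => //= _ [[a b]] _ <-.
rewrite /nu /= /pushforward.
rewrite (_ : _ @^-1` _ = `]a - r, b - r]%classic).
  by rewrite !lebesgue_measure_itv/= !lte_fin ltrD2r -!EFinB opprD opprK addrACA addNr addr0.
by apply/seteqP; split=> x /=; rewrite !in_itv/= ltrBlDr lerBrDr.
Qed.

Lemma ge0_integral_shift (r : R) (f : R -> \bar R) :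
  measurable_fun setT f -> (forall x, 0 <= f x)%E ->
  (\int[lebesgue_measure]_x f (x + r)%R = \int[lebesgue_measure]_x f x)%E.
Proof.
move=> mf f0.
have mg : measurable_fun setT ((fun x => x + r) : measurableTypeR R -> measurableTypeR R).
  by apply: measurable_funD.
have := @ge0_integral_pushforward _ _ _ _ R _ mg (@lebesgue_measure R) setT f measurableT mf (fun x _ => f0 x).
rewrite preimage_setT => <-.
by apply: eq_measure_integral => A mA _; exact/esym/lebesgue_measure_shift.
Qed.

Lemma ge0_integral_rVS n (f : 'rV[R]_n.+1 -> \bar R) :
  measurable_fun setT f -> (forall x, 0 <= f x)%E ->
  (\int[lebesgue_rV n.+1]_x f x =
   \int[lebesgue_measure]_a \int[lebesgue_rV n]_v f (cons_rV (a, v)))%E.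
Proof.
move=> mf f0.
transitivity (\int[(lebesgue_measure \x lebesgue_rV n)%E]_z (f \o (@cons_rV R n)) z)%E.
  have := @ge0_integral_pushforward _ _ _ _ R _ (@measurable_cons_rV R n)
    (lebesgue_measure \x lebesgue_rV n)%E setT f measurableT mf (fun x _ => f0 x).
  by rewrite preimage_setT => <-.
rewrite fubini_tonelli1//=.
exact: (measurableT_comp mf (@measurable_cons_rV R n)).
Qed.

Lemma cons_rVD n (a b : R) (v w : 'rV[R]_n) :
  cons_rV (a, v) + cons_rV (b, w) = cons_rV (a + b, v + w).
Proof.
apply/rowP => i; rewrite mxE; case: (unliftP ord0 i) => [k ->|->].
  by rewrite !cons_rVS/= mxE.
by rewrite !cons_rV0.
Qed.

Lemma uncons_rVK n : cancel (@uncons_rV R n) (@cons_rV R n).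
Proof.
move=> v; apply/rowP => i; case: (unliftP ord0 i) => [k ->|->].
  by rewrite !cons_rVS/= mxE.
by rewrite !cons_rV0.
Qed.

Lemma measurable_shift_rV n (z : 'rV[R]_n) :
  measurable_fun setT (fun x : 'rV[R]_n => x + z).
Proof.
apply: measurable_fun_coord => i.
under eq_fun do rewrite mxE.
by apply: measurable_funD => //; exact: measurable_coord.
Qed.

(** Induction on the dimension: Fubini's theorem splits off the first
    coordinate, along which the measure of the line is invariant. *)
Lemma ge0_integral_rV_shift n (z : 'rV[R]_n) (f : 'rV[R]_n -> \bar R) :
  measurable_fun setT f -> (forall x, 0 <= f x)%E ->
  (\int[lebesgue_rV n]_x f (x + z)%R = \int[lebesgue_rV n]_x f x)%E.
Proof.
elim: n z f => [z f mf f0|n ih z f mf f0].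
  by apply: eq_integral => x _; congr f; apply/rowP => -[].
rewrite ge0_integral_rVS//; last first.
  exact: (measurableT_comp mf (measurable_shift_rV z)).
rewrite (ge0_integral_rVS mf f0).
rewrite -(uncons_rVK z); move: (uncons_rV z) => -[b w].
have mF : measurable_fun setT (fun a => \int[lebesgue_rV n]_v f (cons_rV (a, v)))%E.
  apply: (@measurable_fun_fubini_tonelli_F _ _ _ _ _ _ (f \o (@cons_rV R n))).
    exact: (measurableT_comp mf (@measurable_cons_rV R n)).
  by move=> x; exact: f0.
rewrite -(ge0_integral_shift b mF); last by move=> x; exact: integral_ge0.
apply: eq_integral => a _.
under eq_integral do rewrite cons_rVD.
apply: (ih w (fun v => f (cons_rV (a + b, v)))) => //.
apply: (measurableT_comp mf).
apply: (measurableT_comp (@measurable_cons_rV R n)).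
exact: measurable_pair1.
Qed.

End translation.

(** * Borel sets, shells and compactly supported functions *)

Section topology_rV.
Context {R : realType}.

Lemma ler_coord_norm n (x : 'rV[R]_n) i : `|x ord0 i| <= `|x|.
Proof.
rewrite [leRHS]/Num.norm /= mx_normrE.
by apply/bigmax_geP; right => /=; exists (ord0, i).
Qed.

Lemma rV_norm_lt n (x : 'rV[R]_n) e :
  0 < e -> (forall i, `|x ord0 i| < e) -> `|x| < e.
Proof.
move=> e0 xe; rewrite [ltLHS]/Num.norm /= mx_normrE; apply/bigmax_ltP; split => //.
by move=> [i j] _ /=; rewrite ord1.
Qed.

Lemma rV_norm_le n (x : 'rV[R]_n) e :
  0 <= e -> (forall i, `|x ord0 i| <= e) -> `|x| <= e.
Proof.
move=> e0 xe; rewrite [leLHS]/Num.norm /= mx_normrE; apply/bigmax_leP; split => //.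
by move=> [i j] _ /=; rewrite ord1.
Qed.

Lemma measurable_norm_lt n (c : 'rV[R]_n) e :
  measurable [set x : 'rV[R]_n | `|c - x| < e].
Proof.
have [e0|e0] := leP e 0.
  rewrite (_ : mkset _ = set0)//; apply/seteqP; split => x //=.
  by rewrite ltNge (le_trans e0).
rewrite (_ : mkset _ = \bigcap_(i in [set: 'I_n])
    ((fun x : 'rV[R]_n => x ord0 i) @^-1` [set y | `|c ord0 i - y| < e])).
  apply: fin_bigcap_measurable => // i _.
  rewrite -[X in measurable X]setTI; apply: measurable_coord => //.
  have : open [set y : R | `|c ord0 i - y| < e] by exact: (@ball_open _ R^o).
  exact: open_measurable.
apply/seteqP; split => [x /= cx i _ /=|x /= cx].
  by apply: le_lt_trans cx; have := ler_coord_norm (c - x) i; rewrite !mxE.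
by apply: rV_norm_lt => // i; rewrite !mxE; exact: cx.
Qed.

(** The rational cubes form a countable base of the topology. *)
Lemma open_measurable_rV n (A : set 'rV[R]_n) : open A -> measurable A.
Proof.
move=> oA.
pose B (ck : 'rV[rat]_n * nat) : set 'rV[R]_n :=
  [set x | `|map_mx ratr ck.1 - x| < ck.2.+1%:R^-1].
rewrite (_ : A = \bigcup_(ck in [set ck | B ck `<=` A]) B ck).
  rewrite bigcup_mkcond; apply: countable_bigcupT_measurable.
    exact: countableP.
  move=> ck; case: ifPn => _; last exact: measurable0.
  exact: measurable_norm_lt.
apply/seteqP; split => [x Ax|x [ck /= BA /BA//]].
have /nbhs_ballP[e /= e0 xeA] := open_nbhs_nbhs (conj oA Ax).
have [k ke] : exists k, k.+1%:R^-1 < e / 2.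
  have e20 : 0 < e / 2 by rewrite divr_gt0.
  by have [k _ /(_ k (leqnn k))] := near_infty_natSinv_lt (PosNum e20); exists k.
have k0 : 0 < k.+1%:R^-1 :> R by rewrite invr_gt0.
have [c xc] : exists c : 'rV[rat]_n, forall i, `|ratr (c ord0 i) - x ord0 i| < k.+1%:R^-1.
  have H i : exists q : rat, `|ratr q - x ord0 i| < k.+1%:R^-1.
    have /rat_in_itvoo[q] : x ord0 i - k.+1%:R^-1 < x ord0 i + k.+1%:R^-1.
      by rewrite ltrD2l gtrN.
    rewrite in_itv/= => /andP[q1 q2]; exists q.
    by rewrite ltr_distl q1.
  have [f Hf] := choice H.
  by exists (\row_i f i) => i; rewrite mxE.
have xB : B (c, k) x by apply: rV_norm_lt => // i; rewrite !mxE.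
exists (c, k) => //= y By; apply: xeA; rewrite mx_norm_ball /ball_/=.
rewrite -(subrK (map_mx ratr c) x) -addrA (le_lt_trans (ler_normD _ _))//.
rewrite (splitr e) ltrD//; last exact: lt_trans ke.
by rewrite distrC; exact: lt_trans ke.
Qed.

Lemma continuous_measurable_rV n (f : 'rV[R]_n -> R) :
  continuous f -> measurable_fun setT f.
Proof.
move=> /continuousP cf; apply: (measurability _ (RGenOpens.measurableE R)).
move=> _ [_ [a [b ->] <-]]; rewrite setTI; apply: open_measurable_rV.
exact/cf/interval_open.
Qed.

End topology_rV.

Section enorm.
Context {R : realType} {N : nat}.
Implicit Type x : 'rV[R]_N.

Lemma enorm_ge0 x : 0 <= enorm x. Proof. exact: sqrtr_ge0. Qed.

Lemma sqr_enorm x : enorm x ^+ 2 = \sum_i x ord0 i ^+ 2.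
Proof. by rewrite sqr_sqrtr// sumr_ge0// => i _; exact: sqr_ge0. Qed.

Lemma enorm0 : enorm (0 : 'rV[R]_N) = 0.
Proof.
by rewrite /enorm big1 ?sqrtr0// => i _; rewrite mxE expr0n.
Qed.

Lemma norm_le_enorm x : `|x| <= enorm x.
Proof.
apply: rV_norm_le; first exact: enorm_ge0.
move=> i; rewrite -ler_sqr ?nnegrE ?enorm_ge0// sqr_enorm real_normK ?num_real//.
by rewrite (bigD1 i)//= lerDl sumr_ge0// => j _; exact: sqr_ge0.
Qed.

Lemma enorm_le_norm x : enorm x <= N%:R * `|x|.
Proof.
rewrite -ler_sqr ?nnegrE ?enorm_ge0 ?mulr_ge0// sqr_enorm.
rewrite (@le_trans _ _ (\sum_(i < N) `|x| ^+ 2))//.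
  apply: ler_sum => i _; rewrite -[leLHS]real_normK ?num_real//.
  by rewrite ler_sqr ?nnegrE//; exact: ler_coord_norm.
rewrite sumr_const card_ord exprMn -[leLHS]mulr_natl ler_wpM2r ?sqr_ge0//.
case: N => [|n]; first by rewrite expr0n.
by rewrite -natrX ler_nat expnS expn1 leq_pmulr.
Qed.

Lemma enorm_gt0 x : (0 < enorm x) = (x != 0).
Proof.
have [->|x0] := eqVneq x 0; first by rewrite enorm0 ltxx.
by rewrite (lt_le_trans _ (norm_le_enorm x))// normr_gt0.
Qed.

Lemma continuous_coord i : continuous (fun x : 'rV[R]_N => x ord0 i).
Proof. by move=> x; exact: coord_continuous. Qed.

Lemma continuous_enorm : continuous (@enorm R N).
Proof.
move=> x; apply: continuous_comp; last exact: sqrt_continuous.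
move: x; apply: continuous_big => [|i _ x]; first exact: add_continuous.
apply: (@continuous_comp _ _ _ (fun y : 'rV[R]_N => y ord0 i) (fun y => y ^+ 2)).
  exact: continuous_coord.
exact: exprn_continuous.
Qed.

End enorm.

Section shells.
Context {R : realType} {N : nat}.
Notation rV := 'rV[R]_N.
Notation leb := (@lebesgue_rV R N).

Definition shell (r1 r2 : R) : set rV := [set x | r1 <= `|x| <= r2].

Lemma closed_shell r1 r2 : closed (shell r1 r2).
Proof.
rewrite (_ : shell r1 r2 = (fun x : rV => `|x|) @^-1` `[r1, r2]%classic).
  apply: closed_comp; last exact: itv_closed.
  by move=> x _; exact: norm_continuous.
by apply/seteqP; split => x; rewrite /shell /= in_itv.
Qed.

Lemma compact_shell r1 r2 : compact (shell r1 r2).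
Proof.
apply: bounded_closed_compact; last exact: closed_shell.
exists r2; split; first exact: num_real.
by move=> M r2M x /andP[_ xr2]; apply: le_trans xr2 (ltW r2M).
Qed.

Lemma measurable_shell r1 r2 : measurable (shell r1 r2).
Proof.
rewrite -[shell _ _]setCK; apply: measurableC; apply: open_measurable_rV.
exact/closed_openC/closed_shell.
Qed.

Lemma lebesgue_cube (c : rV) (r : R) : 0 < r ->
  leb [set x | `|c - x| < r] = ((2 * r) ^+ N)%:E.
Proof.
move=> r0.
have -> : [set x : rV | `|c - x| < r] =
    [set v | forall i, `]c ord0 i - r, c ord0 i + r[%classic (v ord0 i)].
  apply/seteqP; split => [x /= cx i|x /= cx].
    rewrite in_itv/= -ltr_distlC; apply: le_lt_trans cx.
    by have := ler_coord_norm (c - x) i; rewrite !mxE.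
  by apply: rV_norm_lt => // i; rewrite !mxE ltr_distlC; have := cx i; rewrite in_itv.
rewrite (lebesgue_rV_box (A := fun i => `]c ord0 i - r, c ord0 i + r[%classic))//.
 under eq_bigr do rewrite lebesgue_measure_itv/= lte_fin.
rewrite (eq_bigr (fun=> (2 * r)%:E)) => [|i _].
  elim: N => [|n ih]; first by rewrite big_ord0.
  by rewrite big_ord_recl ih exprS EFinM.
rewrite ltrD2l gtrN// -EFinB; congr EFin.
by rewrite opprD opprK addrACA subrr add0r mulr2n mulrDl mul1r.
Qed.

Lemma shell_sub_cube r1 r2 : shell r1 r2 `<=` [set x | `|0 - x| < `|r2| + 1].
Proof.
move=> x /andP[_ xr2]; rewrite /= sub0r normrN (le_lt_trans xr2)//.
by rewrite (le_lt_trans (ler_norm _))// ltrDl.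
Qed.

Lemma shell_fin r1 r2 : (leb (shell r1 r2) < +oo)%E.
Proof.
apply: le_lt_trans (le_measure _ _ _ (@shell_sub_cube r1 r2)) _.
- by rewrite inE; exact: measurable_shell.
- by rewrite inE; exact: measurable_norm_lt.
- by rewrite [ltLHS](_ : _ = ((2 * (`|r2| + 1)) ^+ N)%:E) ?ltry//;
    apply: lebesgue_cube; rewrite ltr_wpDl.
Qed.

(** Continuous functions supported in a spherical shell around the origin:
    all weights are continuous off the origin, so products with them remain
    in this class. *)
Definition shell_supp (r1 r2 : R) (f : rV -> R) :=
  forall x, ~ shell r1 r2 x -> f x = 0.

Definition shell_continuous (f : rV -> R) :=
  continuous f /\ exists r1 r2, 0 < r1 /\ shell_supp r1 r2 f.

Lemma shell_supp_widen r1 r2 s1 s2 f : s1 <= r1 -> r2 <= s2 ->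
  shell_supp r1 r2 f -> shell_supp s1 s2 f.
Proof.
move=> sr rs fs x nx; apply: fs => /andP[rx xr]; apply: nx.
by rewrite /shell /= (le_trans sr rx) (le_trans xr rs).
Qed.

Lemma shell_supp_near0 r1 r2 f : 0 < r1 -> shell_supp r1 r2 f ->
  nbhs (0 : rV) [set x | f x = 0].
Proof.
move=> r10 fs; apply: filterS (nbhs0_lt r10) => x xr; apply: fs => /andP[rx _].
by move: xr; rewrite ltNge rx.
Qed.

(** The factor [k] may be singular at the origin, where [f] vanishes. *)
Lemma shell_continuousM f (k : rV -> R) : shell_continuous f ->
  (forall x, x != 0 -> {for x, continuous k}) ->
  shell_continuous (fun x => f x * k x).
Proof.
move=> [cf [r1 [r2 [r10 fs]]]] ck; split; last first.
  by exists r1, r2; split => // x nx; rewrite fs// mul0r.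
move=> x; have [->|x0] := eqVneq x 0; last first.
  by apply: continuousM; [exact: cf|exact: ck].
have f0 := shell_supp_near0 r10 fs.
apply: (near_cst_continuous 0).
suff : nbhs (0 : rV) [set y | f y * k y = 0] by [].
by apply: (@filterS _ (nbhs (0 : rV)) _ _ _ _ f0) => y /= ->; rewrite mul0r.
Qed.

Lemma shell_continuousD f g : shell_continuous f -> shell_continuous g ->
  shell_continuous (fun x => f x + g x).
Proof.
move=> [cf [r1 [r2 [r10 fs]]]] [cg [s1 [s2 [s10 gs]]]]; split.
  by move=> x; apply: continuousD; [exact: cf|exact: cg].
exists (Num.min r1 s1), (Num.max r2 s2); split; first by rewrite lt_min r10.
move=> x nx.
rewrite (shell_supp_widen _ _ fs nx) ?(shell_supp_widen _ _ gs nx) ?addr0//.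
- by rewrite ge_min lexx orbT.
- by rewrite le_max lexx orbT.
- by rewrite ge_min lexx.
- by rewrite le_max lexx.
Qed.

Lemma shell_continuous_sum (I : Type) (s : seq I) (F : I -> rV -> R) :
  (forall i, shell_continuous (F i)) ->
  shell_continuous (fun x => \sum_(i <- s) F i x).
Proof.
move=> sF; elim: s => [|i s ih].
  under [X in shell_continuous X]eq_fun do rewrite big_nil.
  split; first by move=> x; exact: cst_continuous.
  by exists 1, 1; split.
under [X in shell_continuous X]eq_fun do rewrite big_cons.
exact: shell_continuousD.
Qed.

Lemma continuous_shell_bounded (k : rV -> R) r1 r2 : 0 < r1 ->
  (forall x, x != 0 -> {for x, continuous k}) ->
  exists2 M, 0 < M & forall x, shell r1 r2 x -> `|k x| <= M.
Proof.
move=> r10 ck.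
have : compact (k @` shell r1 r2).
  apply: continuous_compact; last exact: compact_shell.
  apply: continuous_in_subspaceT => x; rewrite inE => /andP[rx _]; apply: ck.
  by rewrite -normr_gt0 (lt_le_trans r10).
move=> /compact_bounded[M [_ HM]].
exists (`|M| + 1); first by rewrite ltr_wpDl.
move=> x sx; apply: (HM (`|M| + 1)); last by exists x.
by rewrite (le_lt_trans (ler_norm _))// ltrDl.
Qed.

Lemma integrable_indic_rV (A : set rV) : measurable A -> (leb A < +oo)%E ->
  leb.-integrable setT (EFin \o \1_A).
Proof.
move=> mA Afin; apply/integrableP; split; first exact/measurable_EFinP.
under eq_integral do rewrite /= ger0_norm//.
by rewrite integral_indic// setIT.
Qed.

Lemma shell_continuous_measurable f : shell_continuous f -> measurable_fun setT f.
Proof. by move=> [cf _]; exact: continuous_measurable_rV. Qed.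

Lemma shell_continuous_integrable f : shell_continuous f ->
  leb.-integrable setT (EFin \o f).
Proof.
move=> sf; have mf := shell_continuous_measurable sf.
move: sf => [cf [r1 [r2 [r10 fs]]]].
have [M M0 HM] := continuous_shell_bounded r2 r10 (fun x _ => cf x).
apply: (@le_integrable _ _ _ _ _ _ _ (EFin \o (cst M \* \1_(shell r1 r2)))) => //.
- exact/measurable_EFinP.
- move=> x _ /=; rewrite lee_fin indicE.
  have [sx|nx] := pselect (shell r1 r2 x).
    by rewrite mem_set// mulr1 [leRHS]ger0_norm ?(ltW M0)// HM.
  by rewrite fs// normr0.
- apply: (@integrableZl _ _ _ _ _ _ M (EFin \o \1_(shell r1 r2))) => //.
  exact: integrable_indic_rV (measurable_shell _ _) (shell_fin _ _).
Qed.

End shells.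

(** * Increments along lines *)

Section increments.
Context {R : realType} {N : nat}.
Notation rV := 'rV[R]_N.
Notation leb := (@lebesgue_rV R N).
Notation leb1 := (@lebesgue_measure R).

Lemma integral_rV_shift (z : rV) (f : rV -> \bar R) : measurable_fun setT f ->
  (\int[leb]_x f (x + z)%R = \int[leb]_x f x)%E.
Proof.
move=> mf; rewrite integralE [RHS]integralE; congr (_ - _)%E.
  rewrite -(ge0_integral_rV_shift z (f := (f^\+)%E))//; last exact: measurable_funepos.
  by apply: eq_integral => x _; rewrite !funeposE.
rewrite -(ge0_integral_rV_shift z (f := (f^\-)%E))//; last exact: measurable_funeneg.
by apply: eq_integral => x _; rewrite !funenegE.
Qed.

Lemma integrable_rV_shift (z : rV) (f : rV -> R) :
  leb.-integrable setT (EFin \o f) ->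
  leb.-integrable setT (EFin \o (fun x => f (x + z))).
Proof.
move=> /integrableP[mf fi]; apply/integrableP; split.
  exact: (measurableT_comp mf (measurable_shift_rV z)).
rewrite (ge0_integral_rV_shift z (f := fun x => `|(EFin \o f) x|%E))//.
exact: measurableT_comp.
Qed.

Lemma is_derive_line (g : rV -> R) (x v : rV) (t d : R) :
  is_derive (x + t *: v) v g d -> is_derive t 1 (fun s => g (x + s *: v)) d.
Proof.
have E : (fun h => h^-1 *: ((g \o shift (x + t *: v)) (h *: v) - g (x + t *: v))) =
  (fun h => h^-1 *: (((fun s => g (x + s *: v)) \o shift t) (h *: (1 : R)) - g (x + t *: v))).
  by apply/funext => h /=; rewrite [h *: 1]mulr1 scalerDl addrA [h *: v + x]addrC -addrA
    [h *: v + _]addrC.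
by move=> [dg <-]; split; rewrite /derivable /derive -E.
Qed.

Lemma continuous_line (x v : rV) : continuous (fun t : R => x + t *: v).
Proof.
move=> t; apply: cvgD; first exact: cvg_cst.
by apply: cvgZ; [exact: cvg_id|exact: cvg_cst].
Qed.

Lemma FTC_line (g dg : rV -> R) (v x : rV) (h : R) : 0 < h ->
  (forall y, is_derive y v g (dg y)) -> continuous dg ->
  (\int[leb1]_(t in `[0%R, h]) (dg (x + t *: v)%R)%:E =
   (g (x + h *: v) - g x)%:E)%E.
Proof.
move=> h0 dgE cdg.
have dl (t : R) : is_derive t 1 (fun s => g (x + s *: v)) (dg (x + t *: v)).
  by apply: is_derive_line; exact: dgE.
have cg : continuous (fun s : R => g (x + s *: v)).
  move=> t; apply: differentiable_continuous; apply/derivable1_diffP.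
  by have [] := dl t.
rewrite (@continuous_FTC2 _ _ (fun s => g (x + s *: v)))//.
- by rewrite scale0r addr0.
- apply: continuous_subspaceT => t.
  by apply: continuous_comp; [exact: continuous_line|exact: cdg].
- split; first by move=> t _; have [] := dl t.
    exact/cvg_at_right_filter/cg.
  exact/cvg_at_left_filter/cg.
- by move=> t _; rewrite derive1E; have [] := dl t.
Qed.

Lemma measurable_line2 (v : rV) :
  measurable_fun setT (fun z : rV * measurableTypeR R => z.1 + z.2 *: v).
Proof.
apply: measurable_fun_coord => i; under eq_fun do rewrite !mxE.
apply: measurable_funD.
  exact: (measurableT_comp (measurable_coord i) measurable_fst).
by apply: measurable_funM => //; exact: measurable_snd.
Qed.

(** Integrating the fundamental theorem of calculus along the lines directed
    by [v], and exchanging the two integrals. *)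
Lemma integral_increment (k g dg : rV -> R) (v : rV) (h M : R) : 0 < h ->
  continuous k -> (forall x, `|k x| <= M) ->
  (forall y, is_derive y v g (dg y)) ->
  continuous dg -> leb.-integrable setT (EFin \o dg) ->
  let I t := (\int[leb]_x (k x * dg (x + t *: v)%R)%:E)%E in
  measurable_fun `[0, h] I /\
  (\int[leb]_x (k x * (g (x + h *: v)%R - g x))%:E =
   \int[leb1]_(t in `[0%R, h]) I t)%E.
Proof.
move=> h0 ck kM dgE cdg idg I.
have mk := continuous_measurable_rV ck.
have mdg := continuous_measurable_rV cdg.
pose D : set (measurableTypeR R) := `[0, h]%classic.
have mD : measurable D by exact: measurable_itv.
have lebD : leb1 D = h%:E.
  by rewrite /D lebesgue_measure_itv/= lte_fin h0 oppr0 adde0.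
pose F (z : rV * measurableTypeR R) : \bar R :=
  (k z.1 * dg (z.1 + z.2 *: v) * \1_D z.2)%:E.
have mF : measurable_fun setT F.
  apply/measurable_EFinP; apply: measurable_funM.
    apply: measurable_funM; first exact: (measurableT_comp mk measurable_fst).
    exact: (measurableT_comp mdg (measurable_line2 v)).
  exact: (measurableT_comp (measurable_indic mD) measurable_snd).
have M0 : 0 <= M by rewrite (le_trans _ (kM 0)).
have iF : (leb \x leb1)%E.-integrable setT F.
  apply/(integrable21ltyP _ _ mF).
  pose C := (\int[leb]_x `|(dg x)%:E|)%E.
  have Cfin : (C < +oo)%E by have /integrableP[] := idg.
  apply: (@le_lt_trans _ _ (\int[leb1]_t ((M%:E * C) * (\1_D t)%:E))%E); last first.
    rewrite ge0_integralZl//.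
    - rewrite integral_indic// setIT [X in (_ * X)%E]lebD.
      rewrite lte_mul_pinfty ?mule_ge0 ?integral_ge0 ?ltry//.
      by rewrite ge0_fin_numE ?mule_ge0 ?integral_ge0// lte_mul_pinfty// lee_fin.
    - by apply/measurable_EFinP.
    - by rewrite mule_ge0 ?integral_ge0.
  apply: ge0_le_integral => //.
  - by move=> t _; exact: integral_ge0.
  - apply: (measurable_fun_fubini_tonelli_G (fun z => `|F z|%E)) => //.
    exact: measurableT_comp.
  - by apply: measurable_funeM; exact/measurable_EFinP.
  move=> t _; rewrite /F /=.
  have [Dt|nDt] := pselect (D t); last first.
    rewrite indicE memNset// mule0 integral0_eq// => x _.
    by rewrite mulr0 normr0.
  rewrite indicE mem_set// mule1.
  rewrite /C -(ge0_integral_rV_shift (t *: v) (f := fun x => `|(dg x)%:E|%E))//; last first.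
    by apply: measurableT_comp => //; exact/measurable_EFinP.
  have mdgt : measurable_fun setT (fun x : rV => dg (x + t *: v)).
    exact: (measurableT_comp mdg (measurable_shift_rV (t *: v))).
  rewrite -ge0_integralZl//; last by apply/measurableT_comp => //; exact/measurable_EFinP.
  apply: ge0_le_integral => //.
  - apply/measurable_EFinP; apply: measurableT_comp => //.
    by apply: measurable_funM => //; exact: measurable_funM.
  - apply: measurable_funeM.
    by apply: measurableT_comp => //; exact/measurable_EFinP.
  - by move=> x _ /=; rewrite mulr1 lee_fin normrM ler_wpM2r.
have mI : I \_ D = fun t => (\int[leb]_x F (x, t))%E.
  apply/funext => t; rewrite patchE; case: ifPn => Dt.
    apply: eq_integral => x _.
    by rewrite /F /= indicE Dt mulr1.
  rewrite integral0_eq// => x _.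
  by rewrite /F /= indicE (negbTE Dt) mulr0.
split.
  apply/(measurable_restrictT _ mD); rewrite mI.
  exact: measurable_fubini_G iF.
rewrite [RHS]integral_mkcond mI (integral21_prod_meas1 iF) -(integral12_prod_meas1 iF).
apply: eq_integral => x _; rewrite /fubini_F EFinM -(FTC_line x h0 dgE cdg).
rewrite -integralZl//; last first.
  apply: continuous_compact_integrable; first exact: segment_compact.
  apply: continuous_subspaceT => t.
  by apply: continuous_comp; [exact: continuous_line|exact: cdg].
rewrite [LHS]integral_mkcond; apply: eq_integral => t _; rewrite patchE /F /= indicE.
case: ifPn => Dt; first by rewrite mulr1 EFinM.
by rewrite mulr0.
Qed.

End increments.

(** * Partial derivatives of the test functions *)

Section C1c0_facts.
Context {R : realType} {N : nat}.
Notation rV := 'rV[R]_N.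
Notation e_ i := (delta_mx ord0 i : rV).

Lemma is_derive_lineP (g : rV -> R) (x v : rV) (d : R) :
  is_derive (0 : R) 1 (fun s : R => g (x + s *: v)) d -> is_derive x v g d.
Proof.
have E : (fun h => h^-1 *: ((g \o shift x) (h *: v) - g x)) =
  (fun h => h^-1 *: (((fun s => g (x + s *: v)) \o shift 0) (h *: (1 : R)) -
     g (x + 0 *: v))).
  apply/funext => h /=; rewrite [h *: 1]mulr1 scale0r !addr0.
  by rewrite [h *: v + x]addrC.
by move=> [dg <-]; split; rewrite /derivable /derive E.
Qed.

Lemma is_derive_cst_near (x v : rV) (u : rV -> R) :
  nbhs x [set y | u y = 0] -> is_derive x v u 0.
Proof.
move=> u0; apply: (@near_eq_is_derive _ _ _ (cst (0 : R))).
suff : nbhs x [set y | cst 0 y = u y] by [].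
by apply: (@filterS _ (nbhs x) _ _ _ _ u0) => y /= ->.
Qed.

Lemma shell_supp_near (r1 r2 : R) (u : rV -> R) (x : rV) :
  shell_supp r1 r2 u -> ~ shell r1 r2 x -> nbhs x [set y | u y = 0].
Proof.
move=> us nx; have : open (~` shell r1 r2 : set rV).
  exact/closed_openC/closed_shell.
move=> o; have := open_nbhs_nbhs (conj o (nx : (~` shell r1 r2) x)).
by apply: filterS => y; exact: us.
Qed.

Lemma shell_supp_derive (r1 r2 : R) (u : rV -> R) (x v : rV) :
  shell_supp r1 r2 u -> ~ shell r1 r2 x -> 'D_v u x = 0.
Proof.
by move=> us nx; have [] := is_derive_cst_near v (shell_supp_near us nx).
Qed.

Variable u : C1c0 R N.

Let up : [/\ forall x, differentiable u x, continuous (grad u),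
   compact (closure [set x | u x != 0]) & \forall x \near (0 : rV), u x = 0].
Proof. by case: u => f /= /set_mem. Qed.

Lemma C1c0_supp : exists r1 r2, 0 < r1 /\ shell_supp r1 r2 u.
Proof.
case: up => _ _ /compact_bounded[M [_ HM]] u0.
have {u0} : nbhs (0 : rV) [set x | u x = 0] by exact: u0.
move=> /nbhs_ballP[e /= e0 he].
exists e, (`|M| + 1); split => // x nx; apply: contrapT => /eqP ux; apply: nx.
apply/andP; split.
  rewrite leNgt; apply/negP => xe; move/eqP: ux; apply; apply: he.
  by rewrite mx_norm_ball /ball_/= sub0r normrN.
apply: (HM (`|M| + 1)); first by rewrite (le_lt_trans (ler_norm _))// ltrDl.
exact: subset_closure.
Qed.

Lemma C1c0_derive x (v : rV) : is_derive x v u ('D_v u x).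
Proof. by split => //; apply: diff_derivable; case: up. Qed.

Lemma C1c0_continuous : continuous u.
Proof. by move=> x; apply: differentiable_continuous; case: up. Qed.

Lemma C1c0_shell_continuous : shell_continuous u.
Proof. by split; [exact: C1c0_continuous|exact: C1c0_supp]. Qed.

Definition partial i (x : rV) : R := grad u x ord0 i.

Lemma partialE i x : partial i x = 'D_(e_ i) u x. Proof. by rewrite /partial mxE. Qed.

Lemma partial_shell_continuous i : shell_continuous (partial i).
Proof.
split; last first.
  have [r1 [r2 [r10 us]]] := C1c0_supp.
  by exists r1, r2; split => // x nx; rewrite partialE; exact: shell_supp_derive us nx.
move=> x; apply: (@continuous_comp _ _ _ (grad u) (fun y : rV => y ord0 i)).
  by case: up => _ + _ _; exact.
exact: continuous_coord.
Qed.

Lemma C1c0_deriveE x (v : rV) : 'D_v u x = \sum_i v ord0 i * partial i x.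
Proof.
have du : differentiable u x by case: up.
rewrite [in LHS](row_sum_delta v) deriveE// linear_sum; apply: eq_bigr => i _.
by rewrite linearZ /= partialE deriveE.
Qed.

Lemma sqr_enorm_grad x : enorm (grad u x) ^+ 2 = \sum_i partial i x ^+ 2.
Proof. exact: sqr_enorm. Qed.

Lemma shell_continuous_grad2 : shell_continuous (fun x => enorm (grad u x) ^+ 2).
Proof.
rewrite (_ : (fun x => _) = fun x => \sum_i partial i x * partial i x).
  apply: shell_continuous_sum => i; apply: shell_continuousM.
    exact: partial_shell_continuous.
  by move=> x _; case: (partial_shell_continuous i) => + _; exact.
by apply/funext => x; rewrite sqr_enorm_grad; apply: eq_bigr => i _; rewrite expr2.
Qed.

End C1c0_facts.

Section integral_partial.
Context {R : realType} {N : nat}.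
Notation rV := 'rV[R]_N.
Notation leb := (@lebesgue_rV R N).
Notation leb1 := (@lebesgue_measure R).

(** Translation invariance: the increments of [g] have integral zero. *)
Lemma integral_derive_eq0 (g dg : rV -> R) (v : rV) :
  shell_continuous g -> shell_continuous dg ->
  (forall y, is_derive y v g (dg y)) ->
  (\int[leb]_x (dg x)%:E = 0)%E.
Proof.
move=> sg sdg dgE.
have ig := shell_continuous_integrable sg.
have idg := shell_continuous_integrable sdg.
have mg := shell_continuous_measurable sg.
have mdg := shell_continuous_measurable sdg.
have [|k1|_] := @integral_increment R N (cst 1) g dg v 1 1 ltr01 _ _ dgE sdg.1 idg.
- by move=> x; exact: cst_continuous.
- by rewrite normr1.
have -> : (\int[leb1]_(t in `[0%R, 1%R]) \int[leb]_x (cst 1 x * dg (x + t *: v)%R)%:E =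
    \int[leb]_x (dg x)%:E)%E.
  transitivity (\int[leb1]_(t in `[0%R, 1%R]) cst (\int[leb]_x (dg x)%:E) t)%E.
    apply: eq_integral => t _; under eq_integral do rewrite mul1r.
    by rewrite (@integral_rV_shift _ _ (t *: v) (EFin \o dg))//; exact/measurable_EFinP.
  by rewrite integral_cst//= lebesgue_measure_itv/= lte_fin ltr01 oppr0 adde0 mule1.
move=> <-; under eq_integral do rewrite mul1r scale1r EFinB.
rewrite integralB//; last exact: integrable_rV_shift.
rewrite (@integral_rV_shift _ _ v (EFin \o g)); last exact/measurable_EFinP.
by rewrite subee//; exact: integrable_fin_num.
Qed.

(** The Cauchy-Schwarz inequality, from [sum (A b_i - S a_i)^2 = A (A B - S^2)]. *)
Lemma sqr_sum_mul_le (a b : 'I_N -> R) :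
  (\sum_i a i * b i) ^+ 2 <= (\sum_i a i ^+ 2) * (\sum_i b i ^+ 2).
Proof.
set S := \sum_i _; set A := \sum_i _ ^+ 2; set B := \sum_i _.
have A0 : 0 <= A by apply: sumr_ge0 => i _; exact: sqr_ge0.
have [A00|An0] := eqVneq A 0.
  rewrite /S big1 ?expr0n ?A00 ?mul0r// => i _.
  have /eqP := A00; rewrite /A psumr_eq0; last by move=> ? _; exact: sqr_ge0.
  by move=> /allP/(_ i (mem_index_enum _)); rewrite /= sqrf_eq0 => /eqP->; rewrite mul0r.
have : 0 <= \sum_i (A * b i - S * a i) ^+ 2 by apply: sumr_ge0 => i _; exact: sqr_ge0.
have -> : \sum_i (A * b i - S * a i) ^+ 2 = A * (A * B - S ^+ 2).
  transitivity (\sum_i (A ^+ 2 * b i ^+ 2 - 2 * A * S * (a i * b i) + S ^+ 2 * a i ^+ 2)).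
    by apply: eq_bigr => i _; ring.
  rewrite big_split/= sumrB -!mulr_sumr -/A -/B -/S; ring.
by rewrite pmulr_rge0 ?subr_ge0// lt_def An0.
Qed.

End integral_partial.

(** * Hardy's inequality for radial weights *)

Section Rintegral_shell.
Context {R : realType} {N : nat}.
Notation rV := 'rV[R]_N.
Notation leb := (@lebesgue_rV R N).

Lemma le_Rintegral_shell (f g : rV -> R) :
  shell_continuous f -> shell_continuous g -> (forall x, f x <= g x) ->
  \int[leb]_x f x <= \int[leb]_x g x.
Proof.
by move=> sf sg fg; apply: le_Rintegral => //; exact: shell_continuous_integrable.
Qed.

Lemma RintegralD_shell (f g : rV -> R) :
  shell_continuous f -> shell_continuous g ->
  \int[leb]_x (f x + g x) = \int[leb]_x f x + \int[leb]_x g x.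
Proof. by move=> sf sg; apply: RintegralD => //; exact: shell_continuous_integrable. Qed.

Lemma RintegralZ_shell (c : R) (f : rV -> R) : shell_continuous f ->
  \int[leb]_x (c * f x) = c * \int[leb]_x f x.
Proof. by move=> sf; apply: RintegralZl => //; exact: shell_continuous_integrable. Qed.

Lemma shell_continuousZ (c : R) (f : rV -> R) : shell_continuous f ->
  shell_continuous (fun x => c * f x).
Proof.
move=> sf; rewrite (_ : (fun x => _) = fun x => f x * cst c x).
  by apply: shell_continuousM => // x _; exact: cst_continuous.
by apply/funext => x; rewrite mulrC.
Qed.

Lemma EFin_Rintegral_shell (f : rV -> R) : shell_continuous f ->
  (\int[leb]_x (f x)%:E = (\int[leb]_x f x)%:E)%E.
Proof.
move=> sf; rewrite /Rintegral fineK//; apply: integrable_fin_num => //.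
exact: shell_continuous_integrable.
Qed.

Lemma Rintegral_sum_shell (I : Type) (s : seq I) (F : I -> rV -> R) :
  (forall i, shell_continuous (F i)) ->
  \int[leb]_x (\sum_(i <- s) F i x) = \sum_(i <- s) \int[leb]_x F i x.
Proof.
move=> sF; elim: s => [|i s ih].
  rewrite big_nil /Rintegral integral0_eq// => x _; by rewrite big_nil.
rewrite big_cons -ih -RintegralD_shell//; last exact: shell_continuous_sum.
by apply: eq_Rintegral => x _; rewrite big_cons.
Qed.

End Rintegral_shell.

Section radial.
Context {R : realType} {N : nat}.
Notation rV := 'rV[R]_N.
Notation leb := (@lebesgue_rV R N).
Notation e_ i := (delta_mx ord0 i : rV).

Lemma enorm_line (x : rV) i (t : R) :
  enorm (x + t *: e_ i) ^+ 2 = enorm x ^+ 2 + (2 * x ord0 i) * t + t ^+ 2.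
Proof.
rewrite !sqr_enorm (bigD1 i)//= [X in _ = X + _ + _](bigD1 i)//= !mxE !eqxx/=.
rewrite (eq_bigr (fun j => x ord0 j ^+ 2)); first by ring.
by move=> j ji; rewrite !mxE (negbTE ji)/= mulr0 addr0.
Qed.

Lemma is_derive_quadratic (a b : R) :
  is_derive (0 : R) (1 : R) (fun t : R => a + b * t + t ^+ 2) b.
Proof.
have d1 : is_derive (0 : R) (1 : R) (id : R -> R) 1 by exact: is_derive_id.
have := is_deriveD (is_derive_cst a (0 : R) (1 : R))
  (is_deriveD (is_deriveZ b d1) (is_deriveM d1 d1)).
move/is_derive_eq => /(_ b) H.
rewrite (_ : (fun t => _) = cst a + ((b \*: id) + id * id)).
  by apply: H; rewrite /GRing.scale/= !mul0r !addr0 add0r mulr1.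
by apply/funext => t; rewrite [RHS]/= !fctE expr2 addrA.
Qed.

Lemma is_derive_coord (x : rV) i : is_derive x (e_ i) (fun y : rV => y ord0 i) 1.
Proof.
apply: is_derive_lineP.
rewrite (_ : (fun s : R => _) = cst (x ord0 i) + id).
  by apply: is_derive_eq; rewrite add0r.
by apply/funext => s; rewrite !mxE !eqxx mulr1.
Qed.

Lemma is_derive_radial (phi : R -> R) (d : R) (x : rV) i :
  is_derive (enorm x ^+ 2) 1 phi d ->
  is_derive x (e_ i) (fun y => phi (enorm y ^+ 2)) (d * (2 * x ord0 i)).
Proof.
move=> dphi; apply: is_derive_lineP.
rewrite (_ : (fun s : R => _) =
    phi \o (fun t => enorm x ^+ 2 + (2 * x ord0 i) * t + t ^+ 2)).
  apply: is_derive1_comp; last exact: is_derive_quadratic.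
  by rewrite mulr0 expr0n/= !addr0.
by apply/funext => s; rewrite /= enorm_line.
Qed.

Lemma enorm2_gt0 (x : rV) : x != 0 -> 0 < enorm x ^+ 2.
Proof. by rewrite -enorm_gt0 => x0; rewrite exprn_gt0. Qed.

Lemma continuous_radial (phi : R -> R) (x : rV) :
  {for enorm x ^+ 2, continuous phi} ->
  {for x, continuous (fun y => phi (enorm y ^+ 2))}.
Proof.
move=> cphi; apply: (@continuous_comp _ _ _ (fun y : rV => enorm y ^+ 2) phi) => //.
apply: (@continuous_comp _ _ _ (@enorm R N) (fun r => r ^+ 2)).
  exact: continuous_enorm.
exact: exprn_continuous.
Qed.

Section hardy.
Variables (phi dphi : R -> R) (c : R).
Hypothesis c0 : 0 < c.
Hypothesis phi_ge0 : forall r, 0 < r -> 0 <= phi r.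
Hypothesis dphiE : forall r : R, 0 < r -> is_derive r 1 phi (dphi r).
Hypothesis cdphi : forall r, 0 < r -> {for r, continuous dphi}.
Hypothesis phi_div : forall r, 0 < r -> c * phi r <= N%:R * phi r + 2 * r * dphi r.
Variable u : C1c0 R N.

Let cphi r : 0 < r -> {for r, continuous phi}.
Proof.
move=> r0; apply: differentiable_continuous; apply/derivable1_diffP.
by have [] := dphiE r0.
Qed.

Let Phi (x : rV) := phi (enorm x ^+ 2).
Let dPhi (x : rV) := dphi (enorm x ^+ 2).

Let cPhi x : x != 0 -> {for x, continuous Phi}.
Proof. by move=> x0; apply: continuous_radial; apply: cphi; exact: enorm2_gt0. Qed.

Let cdPhi x : x != 0 -> {for x, continuous dPhi}.
Proof. by move=> x0; apply: continuous_radial; apply: cdphi; exact: enorm2_gt0. Qed.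

Let u0 : nbhs (0 : rV) [set x | u x = 0].
Proof. by have [r1 [r2 [r10 us]]] := C1c0_supp u; exact: shell_supp_near0 us. Qed.

Let g i (x : rV) : R := u x * u x * Phi x * x ord0 i.
Let dg i (x : rV) : R := (2 * u x * partial u i x) * Phi x * x ord0 i +
  u x * u x * dPhi x * 2 * x ord0 i ^+ 2 + u x * u x * Phi x.

Let su := C1c0_shell_continuous u.
Let spd := partial_shell_continuous u.
Let cu : continuous u := su.1.
Let ccoord i (x : rV) : {for x, continuous (fun y : rV => y ord0 i)}.
Proof. exact: continuous_coord. Qed.

Let suu : shell_continuous (fun x => u x * u x).
Proof. by apply: shell_continuousM => // x _; exact: cu. Qed.

Let suuPhi : shell_continuous (fun x => u x * u x * Phi x).
Proof. exact: shell_continuousM. Qed.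

Let sg i : shell_continuous (g i).
Proof. by apply: shell_continuousM => // x _; exact: ccoord. Qed.

Let sdg i : shell_continuous (dg i).
Proof.
apply: shell_continuousD => //; apply: shell_continuousD.
- apply: shell_continuousM => [|x _]; last exact: ccoord.
  apply: shell_continuousM => //; apply: shell_continuousM => [|x _].
    exact: shell_continuousZ.
  exact: (spd i).1.
- rewrite (_ : (fun x => _) = fun x => u x * u x * dPhi x * (2 * x ord0 i ^+ 2)).
    apply: shell_continuousM => [|x _]; first exact: shell_continuousM.
    apply: continuousM; first exact: cst_continuous.
    apply: (@continuous_comp _ _ _ (fun y : rV => y ord0 i) (fun r => r ^+ 2)).
      exact: ccoord.
    exact: exprn_continuous.
  by apply/funext => x; rewrite !mulrA.
Qed.

Let dgE i x : is_derive x (e_ i) (g i) (dg i x).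
Proof.
have [->|x0] := eqVneq x 0.
  have -> : dg i 0 = 0 by rewrite /dg (nbhs_singleton u0) !(mulr0, mul0r) !addr0.
  apply: is_derive_cst_near.
  apply: (@filterS _ (nbhs (0 : rV)) _ _ _ _ u0) => y /= uy.
  by rewrite /g uy !mul0r.
have du : is_derive x (e_ i) u (partial u i x) by rewrite partialE; exact: C1c0_derive.
have dP := is_derive_radial i (dphiE (enorm2_gt0 x0)).
have dc := is_derive_coord x i.
have := is_deriveM (is_deriveM (is_deriveM du du) dP) dc.
move/is_derive_eq; apply.
by rewrite !fctE /dg /Phi /dPhi /GRing.scale/=; ring.
Qed.

(** With [P = x . grad u], the inequality [(c u + 2 P)^2 >= 0] absorbs the cross
    term [2 u P phi] of the divergence, and [P^2 <= |x|^2 |grad u|^2]. *)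
Let hardy_pointwise x : (c / 2) * (u x * u x * Phi x) <=
  \sum_i dg i x + (2 / c) * (enorm (grad u x) ^+ 2 * (Phi x * enorm x ^+ 2)).
Proof.
have [->|x0] := eqVneq x 0.
  rewrite (nbhs_singleton u0) !mul0r mulr0 enorm0 expr0n/= !mulr0 addr0.
  by rewrite big1// => i _; rewrite /dg (nbhs_singleton u0) !(mulr0, mul0r) !addr0.
have r0 := enorm2_gt0 x0.
set P := \sum_i partial u i x * x ord0 i.
have sumE : \sum_i dg i x = 2 * u x * Phi x * P +
    u x ^+ 2 * (N%:R * Phi x + 2 * enorm x ^+ 2 * dPhi x).
  rewrite big_split/= big_split/= sumr_const card_ord.
  rewrite (eq_bigr (fun i => (2 * u x * Phi x) * (partial u i x * x ord0 i))); last first.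
    by move=> i _; ring.
  rewrite -mulr_sumr -mulr_sumr -sqr_enorm -/P -mulr_natl.
  by ring.
have P2 : P ^+ 2 <= enorm (grad u x) ^+ 2 * enorm x ^+ 2.
  by rewrite sqr_enorm_grad sqr_enorm; exact: sqr_sum_mul_le.
have Ph0 : 0 <= Phi x by exact: phi_ge0.
have key : c * Phi x * u x ^+ 2 <= u x ^+ 2 * (N%:R * Phi x + 2 * enorm x ^+ 2 * dPhi x).
  rewrite [leLHS]mulrC ler_wpM2l ?sqr_ge0//; exact: phi_div.
have ci0 : 0 < c^-1 by rewrite invr_gt0.
have sq : 0 <= c^-1 * Phi x * (c * u x + 2 * P) ^+ 2.
  by apply: mulr_ge0; [apply: mulr_ge0 => //; exact: ltW|exact: sqr_ge0].
have sqE : c^-1 * Phi x * (c * u x + 2 * P) ^+ 2 =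
   c * Phi x * u x ^+ 2 + 4 * u x * Phi x * P + 4 / c * (Phi x * P ^+ 2).
  by field; rewrite gt_eqF.
have PP : Phi x * P ^+ 2 <= enorm (grad u x) ^+ 2 * (Phi x * enorm x ^+ 2).
  by rewrite [leRHS]mulrCA ler_wpM2l.
have cPP : c^-1 * (Phi x * P ^+ 2) <= c^-1 * (enorm (grad u x) ^+ 2 * (Phi x * enorm x ^+ 2)).
  by rewrite ler_wpM2l// ltW.
rewrite sumE.
have E1 : c / 2 * (u x * u x * Phi x) = 2^-1 * (c * Phi x * u x ^+ 2) by ring.
have E2 : 2 / c * (enorm (grad u x) ^+ 2 * (Phi x * enorm x ^+ 2)) =
  2 * (c^-1 * (enorm (grad u x) ^+ 2 * (Phi x * enorm x ^+ 2))) by ring.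
have E3 : 4 / c * (Phi x * P ^+ 2) = 4 * (c^-1 * (Phi x * P ^+ 2)) by ring.
have E4 : 2 * u x * Phi x * P = 2^-1 * (4 * u x * Phi x * P) by field.
rewrite E1 E2 E4; move: sq; rewrite sqE E3 => sq.
lra.
Qed.

Let sgrad : shell_continuous (fun x => enorm (grad u x) ^+ 2 * (Phi x * enorm x ^+ 2)).
Proof.
apply: shell_continuousM; first exact: shell_continuous_grad2.
move=> x x0; apply: continuousM; first exact: cPhi.
exact: (@continuous_radial id).
Qed.

(** Integrate the divergence of the field [u^2 phi(|x|^2) x]: its integral is
    zero, and Young's inequality absorbs the cross term. *)
Lemma hardy : \int[leb]_x (phi (enorm x ^+ 2) * u x ^+ 2) <=
  4 / c ^+ 2 * \int[leb]_x (enorm (grad u x) ^+ 2 * (phi (enorm x ^+ 2) * enorm x ^+ 2)).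
Proof.
have sS : shell_continuous (fun x => \sum_i dg i x) by exact: shell_continuous_sum.
have := @le_Rintegral_shell _ _ _ _ (shell_continuousZ (c / 2) suuPhi)
  (shell_continuousD sS (shell_continuousZ (2 / c) sgrad)) hardy_pointwise.
rewrite RintegralD_shell//; last exact: shell_continuousZ.
rewrite !RintegralZ_shell// Rintegral_sum_shell//.
rewrite [X in _ <= X + _]big1 ?add0r; last first.
  by move=> i _; rewrite /Rintegral (integral_derive_eq0 (sg i) (sdg i) (dgE i)).
rewrite (_ : \int[leb]_x (u x * u x * Phi x) = \int[leb]_x (Phi x * u x ^+ 2)); last first.
  by apply: eq_Rintegral => x _; rewrite mulrC expr2.
set A := Rintegral _ _ _; set B := Rintegral _ _ _ => AB.
have c20 : 0 < 2 / c by rewrite divr_gt0.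
have -> : A = 2 / c * (c / 2 * A) by field; rewrite gt_eqF.
have -> : 4 / c ^+ 2 * B = 2 / c * (2 / c * B) by field; rewrite gt_eqF.
by rewrite ler_pM2l.
Qed.

End hardy.
End radial.

(** * The weights of the two spaces *)

Section weights.
Context {R : realType} {N : nat} (p beta : R).
Hypotheses (hp : 1 < p) (hpN : p < N%:R) (hbetap : beta < p).
Notation rV := 'rV[R]_N.
Notation leb := (@lebesgue_rV R N).

Variables (q s tau eps Uc : R).
Hypotheses (qE : q = (p - beta) / (p - 1)) (sE : s = (N%:R - p) / (p - beta))
  (tauE : tau = s * (@crit_exp R N p beta - 2))
  (epsE : eps = Num.min q ((N%:R - beta) / 2)) (UcE : Uc = @U_const R N p beta).
Let A r := 1 + r `^ (q / 2).

Let p10 : 0 < p - 1. Proof. by rewrite subr_gt0. Qed.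
Let pb0 : 0 < p - beta. Proof. by rewrite subr_gt0. Qed.
Let Np0 : 0 < N%:R - p. Proof. by rewrite subr_gt0. Qed.
Let Nb0 : 0 < N%:R - beta. Proof. by rewrite subr_gt0 (lt_trans hbetap). Qed.
Let q0 : 0 < q. Proof. by rewrite qE divr_gt0. Qed.
Let s0 : 0 < s. Proof. by rewrite sE divr_gt0. Qed.
Let eps0 : 0 < eps. Proof. by rewrite epsE lt_min q0 divr_gt0. Qed.
Let epsq : eps <= q. Proof. by rewrite epsE ge_min lexx. Qed.
Let epsN : eps < N%:R - beta.
Proof.
by rewrite epsE gt_min; apply/orP; right; rewrite ltr_pdivrMr// ltr_pMr// ltr1n.
Qed.
Let A1 r : 1 <= A r. Proof. by rewrite lerDl powR_ge0. Qed.
Let A0 r : 0 < A r. Proof. exact: lt_le_trans (A1 r). Qed.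

Lemma powR_enorm (x : rV) y : enorm x `^ y = (enorm x ^+ 2) `^ (y / 2).
Proof.
rewrite -powR_mulrn ?enorm_ge0// -powRrM; congr (_ `^ _).
by rewrite mulrC divfK// pnatr_eq0.
Qed.

Let Uc0 : 0 < Uc.
Proof. by rewrite UcE powR_gt0// mulr_gt0// powR_gt0// divr_gt0. Qed.

Lemma UE (x : rV) : U p beta x = Uc * A (enorm x ^+ 2) `^ (- s).
Proof. by rewrite /U /A powR_enorm UcE sE qE. Qed.

Let cb := Uc `^ (@crit_exp R N p beta - 2).
Let cb0 : 0 < cb. Proof. exact: powR_gt0. Qed.

Lemma L2_weightE (x : rV) : L2_weight p beta x =
  cb * ((enorm x ^+ 2) `^ (- beta / 2) * A (enorm x ^+ 2) `^ (- tau)).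
Proof.
rewrite /L2_weight UE powR_enorm powRM ?(ltW Uc0) ?powR_ge0// -(powRrM (A (enorm x ^+ 2)) (- s)) [- s * _]mulNr -tauE.
by rewrite mulrCA.
Qed.

Lemma is_derive_A_powR (r a : R) : 0 < r ->
  is_derive r 1 (fun t => A t `^ a) (a * A r `^ (a - 1) * (q / 2 * r `^ (q / 2 - 1))).
Proof.
move=> r0.
have d1 : is_derive r 1 (fun t => A t) (q / 2 * r `^ (q / 2 - 1)).
  have d2 := is_derive1_powR (q / 2) r0.
  rewrite (_ : (fun t => A t) = cst 1 + (fun t => t `^ (q / 2)))//.
  by apply: is_derive_eq; rewrite add0r.
have d3 := is_derive1_powR a (A0 r).
exact: (@is_derive1_comp _ (fun t => t `^ a) A).
Qed.

Let cU0 : 0 < Uc * s * q.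
Proof. by apply: mulr_gt0 => //; exact: mulr_gt0. Qed.

(** The weight [|grad U|^(p-2)] off the origin, as a function of [|x|^2]. *)
Definition grad_weight (x : rV) : R := (Uc * s * q) `^ (p - 2) *
  ((enorm x ^+ 2) `^ ((2 - beta - q) / 2) * A (enorm x ^+ 2) `^ (2 - tau)).

Lemma grad_U (x : rV) : x != 0 -> grad (U p beta) x =
  (- (Uc * s * q * A (enorm x ^+ 2) `^ (- s - 1) * (enorm x ^+ 2) `^ (q / 2 - 1))) *: x.
Proof.
move=> x0; apply/rowP => i; rewrite !mxE.
have d1 := is_derive_A_powR (- s) (enorm2_gt0 x0).
have d2 := is_deriveZ Uc d1.
have d3 := is_derive_radial i d2.
rewrite (_ : U p beta = fun x : rV =>
    (Uc \*: (fun t => A t `^ (- s))) (enorm x ^+ 2)); last first.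
  by apply/funext => y; rewrite UE.
by have [_ ->] := d3; rewrite /GRing.scale/=; field.
Qed.

Lemma enormZ (c : R) (x : rV) : enorm (c *: x) = `|c| * enorm x.
Proof.
rewrite /enorm -sqrtr_sqr -sqrtrM ?sqr_ge0//; congr Num.sqrt.
by rewrite mulr_sumr; apply: eq_bigr => i _; rewrite mxE exprMn.
Qed.

Lemma grad_weightE (x : rV) : x != 0 ->
  enorm (grad (U p beta) x) `^ (p - 2) = grad_weight x.
Proof.
move=> x0; rewrite grad_U// enormZ normrN.
have r0 := enorm2_gt0 x0.
rewrite ger0_norm; last first.
  by apply: mulr_ge0; [apply: mulr_ge0; [exact: ltW|exact: powR_ge0]|exact: powR_ge0].
have rE : enorm x = (enorm x ^+ 2) `^ (1 / 2).
  by rewrite -powR_enorm powRr1// enorm_ge0.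
rewrite /grad_weight; move: rE r0; set r := enorm x ^+ 2 => -> r0.
rewrite -(mulrA _ (r `^ (q / 2 - 1))) -powRD; last by rewrite (gt_eqF r0) implybT.
rewrite -(mulrA (Uc * s * q)) powRM ?(ltW cU0)//; last first.
  by rewrite mulr_ge0 ?powR_ge0.
congr (_ * _); rewrite powRM ?powR_ge0// -(powRrM r) -(powRrM (A r)) mulrC.
have p1N : p - 1 != 0 by rewrite gt_eqF.
have pbN : p - beta != 0 by rewrite gt_eqF.
have NpN : N%:R - p != 0 by rewrite gt_eqF.
by congr (_ `^ _ * _ `^ _); rewrite ?tauE ?sE /crit_exp ?qE; field; rewrite ?p1N ?pbN ?NpN.
Qed.

(** With [r^2] for the argument, this is [r^(-beta) (1 + r^q)^(-tau)], the
    profile of the weight of the target space, times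
    [r^(-eps) (1 + r^q)^(1 + eps/q)], which is unbounded at both ends. *)
Definition hardy_profile (r : R) : R :=
  r `^ (- (beta + eps) / 2) * A r `^ (1 + eps / q - tau).

Definition hardy_weight (x : rV) : R := hardy_profile (enorm x ^+ 2).

Let dprofile (r : R) : R :=
  r `^ (- (beta + eps) / 2) *
    ((1 + eps / q - tau) * A r `^ (1 + eps / q - tau - 1) * (q / 2 * r `^ (q / 2 - 1))) +
  A r `^ (1 + eps / q - tau) *
    (- (beta + eps) / 2 * r `^ (- (beta + eps) / 2 - 1)).

Let dprofileE (r : R) : 0 < r -> is_derive r 1 hardy_profile (dprofile r).
Proof.
move=> r0; have d1 := is_derive_A_powR (1 + eps / q - tau) r0.
have d2 := is_derive1_powR (- (beta + eps) / 2) r0.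
exact: is_deriveM.
Qed.

Let cpowR (r a : R) : 0 < r -> {for r, continuous (fun t => t `^ a)}.
Proof.
move=> r0; apply: differentiable_continuous; apply/derivable1_diffP.
by have [] := is_derive1_powR a r0.
Qed.

Let cApowR (r a : R) : 0 < r -> {for r, continuous (fun t => A t `^ a)}.
Proof.
move=> r0; apply: differentiable_continuous; apply/derivable1_diffP.
by have [] := is_derive_A_powR a r0.
Qed.

Let cdprofile (r : R) : 0 < r -> {for r, continuous dprofile}.
Proof.
move=> r0; apply: cvgD; apply: cvgM.
- exact: cpowR.
- apply: cvgM; first by apply: cvgM; [exact: cvg_cst|exact: cApowR].
  by apply: cvgM; [exact: cvg_cst|exact: cpowR].
- exact: cApowR.
- by apply: cvgM; [exact: cvg_cst|exact: cpowR].
Qed.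

Let c0 := Num.min (N%:R - beta - eps) ((N%:R - p) / (p - 1)).

Let c0_gt0 : 0 < c0.
Proof. by rewrite lt_min subr_gt0 epsN divr_gt0. Qed.

(** Where [r^(q/2)] is small, resp. large, the factor multiplying the profile
    is close to [N - beta - eps], resp. [(N - p)/(p - 1)]. *)
Let profile_div (r : R) : 0 < r ->
  c0 * hardy_profile r <= N%:R * hardy_profile r + 2 * r * dprofile r.
Proof.
move=> r0; rewrite /hardy_profile /dprofile.
set a := - (beta + eps) / 2; set b := 1 + eps / q - tau.
have rN : (r == 0) = false by rewrite gt_eqF.
have AN : (A r == 0) = false by rewrite gt_eqF.
have -> : r `^ (a - 1) = r `^ a / r.
  by rewrite powRB ?rN ?implybT// powRr1// ltW.
have -> : A r `^ (b - 1) = A r `^ b / A r.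
  by rewrite powRB ?AN ?implybT// powRr1// ltW.
have -> : r `^ (q / 2 - 1) = r `^ (q / 2) / r.
  by rewrite powRB ?rN ?implybT// powRr1// ltW.
set G := r `^ a * A r `^ b.
have G0 : 0 <= G by rewrite mulr_ge0// powR_ge0.
set y := r `^ (q / 2).
have AE : A r = 1 + y by [].
have y0 : 0 <= y by exact: powR_ge0.
have E : N%:R * G + 2 * r *
    (r `^ a * (b * (A r `^ b / A r) * (q / 2 * (y / r))) +
     A r `^ b * (a * (r `^ a / r))) =
  G * ((N%:R + 2 * a) * (1 / A r) + (N%:R + 2 * a + q * b) * (y / A r)).
  rewrite /G AE; field; rewrite -AE gt_eqF ?gt_eqF//.
rewrite E mulrC ler_wpM2l//.
have p1N : p - 1 != 0 by rewrite gt_eqF.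
have pbN : p - beta != 0 by rewrite gt_eqF.
have NpN : N%:R - p != 0 by rewrite gt_eqF.
have E1 : N%:R + 2 * a = N%:R - beta - eps by rewrite /a; field.
have E2 : N%:R + 2 * a + q * b = (N%:R - p) / (p - 1).
  have qN : q != 0 by rewrite gt_eqF.
  have -> : q * b = q + eps - q * tau by rewrite /b; field.
  rewrite E1 tauE sE /crit_exp qE; field; by rewrite p1N pbN NpN.
rewrite E2 E1.
have -> : c0 = c0 * (1 / A r) + c0 * (y / A r).
  by rewrite -mulrDr -mulrDl -AE divff ?mulr1// AN.
apply: lerD; apply: ler_wpM2r.
- by rewrite divr_ge0// ltW.
- by rewrite ge_min lexx.
- by rewrite divr_ge0// ltW.
- by rewrite ge_min lexx orbT.
Qed.

Let profile_ge0 (r : R) : 0 < r -> 0 <= hardy_profile r.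
Proof. by move=> _; rewrite mulr_ge0// powR_ge0. Qed.

Lemma continuous_hardy_weight (x : rV) : x != 0 -> {for x, continuous hardy_weight}.
Proof.
move=> x0; apply: continuous_radial; apply: differentiable_continuous.
by apply/derivable1_diffP; have [] := dprofileE (enorm2_gt0 x0).
Qed.

Lemma continuous_grad_weight (x : rV) : x != 0 -> {for x, continuous grad_weight}.
Proof.
move=> x0; have r0 := enorm2_gt0 x0.
apply: (@continuous_radial _ _ (fun r => (Uc * s * q) `^ (p - 2) *
  (r `^ ((2 - beta - q) / 2) * A r `^ (2 - tau)))).
by apply: cvgM; [exact: cvg_cst|apply: cvgM; [exact: cpowR|exact: cApowR]].
Qed.

Lemma continuous_L2_weight (x : rV) : x != 0 -> {for x, continuous (L2_weight p beta)}.
Proof.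
move=> x0; have r0 := enorm2_gt0 x0.
rewrite (_ : L2_weight p beta = fun x : rV => cb * ((enorm x ^+ 2) `^ (- beta / 2) *
   A (enorm x ^+ 2) `^ (- tau))); last by apply/funext => y; exact: L2_weightE.
apply: (@continuous_radial _ _ (fun r => cb * (r `^ (- beta / 2) * A r `^ (- tau)))).
by apply: cvgM; [exact: cvg_cst|apply: cvgM; [exact: cpowR|exact: cApowR]].
Qed.

Lemma grad_weight_gt0 (x : rV) : x != 0 -> 0 < grad_weight x.
Proof.
move=> x0; rewrite mulr_gt0 ?(powR_gt0 _ cU0)// mulr_gt0 ?(powR_gt0 _ (A0 _))//.
by rewrite powR_gt0// enorm2_gt0.
Qed.

Lemma L2_weight_gt0 (x : rV) : x != 0 -> 0 < L2_weight p beta x.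
Proof.
move=> x0; rewrite L2_weightE mulr_gt0// mulr_gt0//.
  by rewrite powR_gt0// enorm2_gt0.
exact: powR_gt0.
Qed.

(** Up to a constant the quotient is [(r^q / (1 + r^q))^(1 - eps/q)]. *)
Lemma hardy_weight_le_grad : exists2 C, 0 < C & forall x : rV, x != 0 ->
  hardy_weight x * enorm x ^+ 2 <= C * grad_weight x.
Proof.
exists ((Uc * s * q) `^ (p - 2))^-1; first by rewrite invr_gt0 powR_gt0.
move=> x x0; rewrite /grad_weight mulKf; last by rewrite gt_eqF ?powR_gt0.
rewrite /hardy_weight /hardy_profile; have := enorm2_gt0 x0.
move: (enorm x ^+ 2) => r r0.
have rN : (r == 0) = false by rewrite gt_eqF.
have rA : r `^ (q / 2) <= A r by rewrite /A lerDr.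
move: (A r) (A0 r) rA => a a0 rA.
have AN : (a == 0) = false by rewrite gt_eqF.
have -> : r `^ (- (beta + eps) / 2) = r `^ ((2 - beta - q) / 2) * r `^ ((q - eps) / 2) / r.
  apply: (canRL (mulfK (negbT rN))).
  rewrite -[X in _ * X = _]powRr1 ?ltW// -!powRD ?rN ?implybT//.
  by congr (_ `^ _); field.
have -> : a `^ (1 + eps / q - tau) = a `^ (2 - tau) * a `^ (- (1 - eps / q)).
  by rewrite -powRD ?AN ?implybT//; congr (_ `^ _); ring.
rewrite powRN.
have le1 : r `^ ((q - eps) / 2) / a `^ (1 - eps / q) <= 1.
  rewrite ler_pdivrMr ?powR_gt0// mul1r.
  have -> : (q - eps) / 2 = q / 2 * (1 - eps / q) by field; rewrite gt_eqF.
  rewrite powRrM ge0_ler_powR ?nnegrE ?powR_ge0 ?(ltW a0)//.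
  by rewrite subr_ge0 ler_pdivrMr// mul1r.
rewrite -[leRHS]mulr1.
apply: le_trans (ler_wpM2l _ le1); last by rewrite mulr_ge0// powR_ge0.
rewrite le_eqVlt; apply/orP; left; apply/eqP; field.
by rewrite rN gt_eqF ?powR_gt0.
Qed.

(** The quotient of the two weights is at least [r^(-eps)] and at least [r^q],
    up to a constant: the former is used near the origin, the latter at
    infinity. *)
Lemma L2_weight_tail (M : R) : 0 < M -> exists r1 r2, [/\ 0 < r1, 0 < r2 &
  forall x : rV, x != 0 -> ~ shell r1 r2 x -> M * L2_weight p beta x <= hardy_weight x].
Proof.
move=> M0; have [K [K0 KE]] : exists K, 0 < K /\ K = M * cb.
  by exists (M * cb); rewrite mulr_gt0.
have N0 : 0 < N%:R :> R by rewrite (lt_trans _ hpN)// (lt_trans _ hp).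
exists (K `^ (- eps^-1) / N%:R), (K `^ q^-1).
split; [by rewrite divr_gt0 ?powR_gt0|by rewrite powR_gt0|move=> x x0 nx].
rewrite L2_weightE mulrA -KE /hardy_weight /hardy_profile.
have er0 : 0 < enorm x by rewrite enorm_gt0.
have r0 := enorm2_gt0 x0.
have rN : (enorm x ^+ 2 == 0) = false by rewrite gt_eqF.
have AN : (A (enorm x ^+ 2) == 0) = false by rewrite gt_eqF.
set r := enorm x ^+ 2 in r0 rN AN *.
have rA : r `^ (q / 2) <= A r by rewrite /A lerDr.
move: (A r) (A0 r) (A1 r) rA AN => a a0 a1 rA AN.
have -> : r `^ (- (beta + eps) / 2) = r `^ (- beta / 2) * r `^ (- eps / 2).
  by rewrite -powRD ?rN ?implybT//; congr (_ `^ _); field.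
have -> : a `^ (1 + eps / q - tau) = a `^ (- tau) * a `^ (1 + eps / q).
  by rewrite -powRD ?AN ?implybT//; congr (_ `^ _); ring.
have -> : r `^ (- beta / 2) * r `^ (- eps / 2) * (a `^ (- tau) * a `^ (1 + eps / q)) =
   r `^ (- eps / 2) * a `^ (1 + eps / q) * (r `^ (- beta / 2) * a `^ (- tau)) by ring.
apply: ler_wpM2r; first by rewrite mulr_ge0// powR_ge0.
have [small|big] : enorm x < K `^ (- eps^-1) \/ K `^ q^-1 < enorm x.
  have [xr1|xr1] := ltP `|x| (K `^ (- eps^-1) / N%:R).
    left; apply: le_lt_trans (enorm_le_norm x) _.
    by rewrite mulrC -ltr_pdivlMr.
  right; apply: lt_le_trans (norm_le_enorm x); rewrite ltNge; apply/negP => xr2.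
  by apply: nx; rewrite /shell/= xr1.
- apply: (@le_trans _ _ (r `^ (- eps / 2) * 1)); last first.
    rewrite ler_wpM2l ?powR_ge0// -[leLHS](powRr0 a) ler_powR//.
    by rewrite addr_ge0// divr_ge0// ltW.
  rewrite mulr1 -powR_enorm powRN -[leLHS]invrK lef_pV2 ?posrE ?invr_gt0 ?powR_gt0//.
  have -> : K^-1 = (K `^ (- eps^-1)) `^ eps.
    by rewrite -powRrM mulNr mulVf ?gt_eqF// powR_inv1// ltW.
  by rewrite ge0_ler_powR ?nnegrE ?powR_ge0 ?ltW.
- apply: (@le_trans _ _ (r `^ (q / 2))).
    rewrite -powR_enorm.
    have -> : K = (K `^ (q^-1)) `^ q.
      by rewrite -powRrM mulVf ?gt_eqF// powRr1// ltW.
    by rewrite ge0_ler_powR ?nnegrE ?powR_ge0 ?ltW// -powR_gt0.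
  have -> : r `^ (q / 2) = r `^ (- eps / 2) * (r `^ (q / 2) * r `^ (eps / 2)).
    by rewrite -!powRD ?rN ?implybT//; congr (_ `^ _); field.
  rewrite ler_wpM2l ?powR_ge0//.
  have -> : r `^ (q / 2) * r `^ (eps / 2) = (r `^ (q / 2)) `^ (1 + eps / q).
    rewrite -powRrM -powRD ?rN ?implybT//; congr (_ `^ _); field.
    by rewrite gt_eqF.
  rewrite ge0_ler_powR ?nnegrE ?powR_ge0 ?(ltW a0)//.
  by rewrite addr_ge0// divr_ge0// ltW.
Qed.

Lemma D12_integrandE (u : C1c0 R N) (x : rV) :
  enorm (grad (U p beta) x) `^ (p - 2) * enorm (grad u x) ^+ 2 =
  enorm (grad u x) ^+ 2 * grad_weight x.
Proof.
have [->|x0] := eqVneq x 0; last by rewrite mulrC grad_weightE.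
rewrite (_ : grad u 0 = 0) ?enorm0 ?expr0n/= ?mulr0 ?mul0r//.
apply/rowP => i; rewrite [LHS]partialE mxE.
have [r1 [r2 [r10 us]]] := C1c0_supp u.
apply: shell_supp_derive us _ => /andP[]; rewrite normr0 leNgt => /negP r1N _.
exact: r1N.
Qed.

Lemma shell_continuous_D12 (u : C1c0 R N) :
  shell_continuous (fun x => enorm (grad u x) ^+ 2 * grad_weight x).
Proof.
apply: shell_continuousM; first exact: shell_continuous_grad2.
exact: continuous_grad_weight.
Qed.

Lemma weighted_hardy : exists2 C, 0 < C & forall u : C1c0 R N,
  \int[leb]_x (hardy_weight x * u x ^+ 2) <=
  C * \int[leb]_x (enorm (grad u x) ^+ 2 * grad_weight x).
Proof.
have [C C0 HC] := hardy_weight_le_grad.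
exists (4 / c0 ^+ 2 * C).
  by rewrite mulr_gt0// divr_gt0// exprn_gt0.
move=> u; have := hardy c0_gt0 profile_ge0 dprofileE cdprofile profile_div u.
move/le_trans; apply.
rewrite -[leRHS]mulrA; apply: ler_wpM2l.
  by rewrite divr_ge0// exprn_ge0// ltW.
rewrite -RintegralZ_shell; last exact: shell_continuous_D12.
apply: le_Rintegral_shell.
- apply: shell_continuousM; first exact: shell_continuous_grad2.
  move=> x x0; apply: continuousM; first exact: continuous_hardy_weight.
  exact: (@continuous_radial _ _ id).
- exact/shell_continuousZ/shell_continuous_D12.
- move=> x; rewrite [leRHS]mulrCA.
  have [->|x0] := eqVneq x 0; last by rewrite ler_wpM2l ?sqr_ge0// HC.
  rewrite [X in hardy_weight _ * X]sqr_enorm big1 ?mulr0; last first.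
    by move=> i _; rewrite mxE expr0n.
  apply: mulr_ge0; first exact: sqr_ge0.
  apply: mulr_ge0; first exact: ltW.
  by apply: mulr_ge0; [exact: powR_ge0|apply: mulr_ge0; exact: powR_ge0].
Qed.

Lemma hardy_weight_gt0 (x : rV) : x != 0 -> 0 < hardy_weight x.
Proof.
move=> x0; rewrite mulr_gt0 ?(powR_gt0 _ (A0 _))//.
by rewrite powR_gt0// enorm2_gt0.
Qed.

End weights.

(** What the embedding argument uses of the two weights. *)
Record admissible_weights (R : realType) (N : nat) (a b : 'rV[R]_N -> R) : Prop := {
  weight_a_cont : forall x, x != 0 -> {for x, continuous a} ;
  weight_b_cont : forall x, x != 0 -> {for x, continuous b} ;
  weight_a_gt0 : forall x, x != 0 -> 0 < a x ;
  weight_b_gt0 : forall x, x != 0 -> 0 < b x ;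
  weight_hardy : exists V : 'rV[R]_N -> R,
    [/\ forall x, x != 0 -> {for x, continuous V},
       forall x, x != 0 -> 0 < V x,
       exists2 C, 0 < C & forall u : C1c0 R N,
         \int[lebesgue_rV N]_x (V x * u x ^+ 2) <=
         C * \int[lebesgue_rV N]_x (enorm (grad u x) ^+ 2 * a x)
     & forall M, 0 < M -> exists r1 r2, [/\ 0 < r1, 0 < r2 &
         forall x, x != 0 -> ~ shell r1 r2 x -> M * b x <= V x]] }.

Lemma weights_admissible (R : realType) (N : nat) (p beta : R) :
  1 < p -> p < N%:R -> beta < p ->
  exists2 a : 'rV[R]_N -> R, admissible_weights a (L2_weight p beta) &
    forall (u : C1c0 R N) (x : 'rV[R]_N),
      enorm (grad (U p beta) x) `^ (p - 2) * enorm (grad u x) ^+ 2 =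
      enorm (grad u x) ^+ 2 * a x.
Proof.
move=> hp hpN hbetap.
pose q := (p - beta) / (p - 1).
pose s := (N%:R - p) / (p - beta).
pose tau := s * (@crit_exp R N p beta - 2).
pose eps := Num.min q ((N%:R - beta) / 2).
pose Uc := @U_const R N p beta.
exists (grad_weight p beta q s tau Uc); last first.
  by move=> u x; eapply D12_integrandE; eauto.
split.
- exact: continuous_grad_weight.
- by move=> x x0; eapply continuous_L2_weight; eauto.
- by move=> x x0; eapply grad_weight_gt0; eauto.
- by move=> x x0; eapply L2_weight_gt0; eauto.
exists (hardy_weight beta q tau eps); split.
- exact: continuous_hardy_weight.
- exact: hardy_weight_gt0.
- by eapply weighted_hardy; eauto.
- by move=> M M0; eapply L2_weight_tail; eauto.
Qed.

(** * Means over cubes *)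

Section cubes.
Context {R : realType} {N : nat}.
Notation rV := 'rV[R]_N.
Notation leb := (@lebesgue_rV R N).

Lemma Rintegral_le_ub (f : rV -> R) (c : R) : (forall x, 0 <= f x) ->
  (\int[leb]_x (f x)%:E <= c%:E)%E -> \int[leb]_x f x <= c.
Proof.
move=> f0 fc; rewrite -lee_fin /Rintegral fineK//.
rewrite ge0_fin_numE ?(le_lt_trans fc) ?ltry//.
by apply: integral_ge0 => x _; rewrite lee_fin.
Qed.

Lemma shell_continuous_bounded (f : rV -> R) : shell_continuous f ->
  exists2 M, 0 < M & forall x, `|f x| <= M.
Proof.
move=> [cf [r1 [r2 [r10 fs]]]].
have [M M0 HM] := continuous_shell_bounded r2 r10 (fun x _ => cf x).
exists M => // x; have [sx|nx] := pselect (shell r1 r2 x); first exact: HM.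
by rewrite fs// normr0 ltW.
Qed.

Lemma shell_continuous_at0 (f : rV -> R) : shell_continuous f -> f 0 = 0.
Proof.
by move=> [_ [r1 [r2 [r10 fs]]]]; exact: (nbhs_singleton (shell_supp_near0 r10 fs)).
Qed.

Definition cube (c : rV) (h : R) : set rV := [set y | `|c - y| < h].

Lemma measurable_cube c h : measurable (cube c h).
Proof. exact: measurable_norm_lt. Qed.

Lemma leb_cube c h : 0 < h -> leb (cube c h) = ((2 * h) ^+ N)%:E.
Proof. exact: lebesgue_cube. Qed.

Lemma leb_cube_fin c h : (leb (cube c h) < +oo)%E.
Proof.
have [h0|h0] := ltP 0 h; first by rewrite leb_cube// ltry.
rewrite (_ : cube c h = set0) ?measure0//; apply/seteqP; split => x //=.
by rewrite /cube/= ltNge (le_trans h0).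
Qed.

Definition cube_int (c : rV) (h : R) (f : rV -> R) : R := \int[leb]_(y in cube c h) f y.

Lemma integrable_cube (c : rV) (h : R) (f : rV -> R) : continuous f ->
  (exists M, forall x, `|f x| <= M) -> leb.-integrable (cube c h) (EFin \o f).
Proof.
move=> cf [M fM]; apply: measurable_bounded_integrable.
- exact: measurable_cube.
- exact: leb_cube_fin.
- by apply: measurable_funTS; exact: continuous_measurable_rV.
- exists M; split; first exact: num_real.
  by move=> M' MM' x _; exact: le_trans (fM x) (ltW MM').
Qed.

(** The mean [m] of [f] over the cube minimises the quadratic deviation, here
    through the tangent inequality [(s - t)^2 >= (s - m)^2 + 2 (s - m)(m - t)]. *)
Lemma sqr_le_cube_deviation (f : rV -> R) (c : rV) (h : R) (x : rV) : 0 < h ->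
  shell_continuous f ->
  f x ^+ 2 * (2 * h) ^+ N <= 2 * \int[leb]_(y in cube c h) (f x - f y) ^+ 2 +
     2 / (2 * h) ^+ N * cube_int c h f ^+ 2.
Proof.
move=> h0 sf; set vol := (2 * h) ^+ N.
have vol0 : 0 < vol by rewrite exprn_gt0// mulr_gt0.
have [M M0 fM] := shell_continuous_bounded sf.
have mC := measurable_cube c h.
set l := cube_int c h f; set m := l / vol.
have if1 : leb.-integrable (cube c h) (EFin \o f).
  by apply: integrable_cube; [case: sf|exists M].
have icst k : leb.-integrable (cube c h) (EFin \o cst k).
  by apply: integrable_cube; [move=> y; exact: cst_continuous|exists `|k|].
have if2 : leb.-integrable (cube c h) (EFin \o (fun y => (f x - f y) ^+ 2)).
  apply: integrable_cube.
    move=> y; apply: (@continuous_comp _ _ _ (fun y => f x - f y) (fun r => r ^+ 2)).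
      by apply: (@continuousB _ _ _ (cst (f x)) f); [exact: cst_continuous|exact: sf.1].
    exact: exprn_continuous.
  exists ((M + M) ^+ 2) => y; rewrite normrX ler_sqr ?nnegrE ?addr_ge0 ?(ltW M0)//.
  by rewrite (le_trans (ler_normB _ _))// lerD.
have volE k : \int[leb]_(y in cube c h) k = k * vol.
  transitivity (k * fine (leb (cube c h))); first exact: Rintegral_cst.
  by rewrite leb_cube.
have D0 : vol * (f x - m) ^+ 2 <= \int[leb]_(y in cube c h) (f x - f y) ^+ 2.
  pose k1 := (f x - m) ^+ 2 + 2 * (f x - m) * m; pose k2 := 2 * (f x - m).
  have ik2 : leb.-integrable (cube c h) (EFin \o (fun y => k2 * f y)).
    exact: (integrableZl mC k2 if1).
  have ik12 : leb.-integrable (cube c h) (EFin \o (fun y => k1 - k2 * f y)).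
    exact: (integrableB mC (icst k1) ik2).
  have : \int[leb]_(y in cube c h) (k1 - k2 * f y) <=
      \int[leb]_(y in cube c h) (f x - f y) ^+ 2.
    apply: le_Rintegral => // y _; rewrite -subr_ge0 /k1 /k2.
    have -> : (f x - f y) ^+ 2 - ((f x - m) ^+ 2 + 2 * (f x - m) * m - 2 * (f x - m) * f y)
       = (m - f y) ^+ 2 by ring.
    exact: sqr_ge0.
  have -> : \int[leb]_(y in cube c h) (k1 - k2 * f y) = k1 * vol - k2 * l.
    transitivity (\int[leb]_(y in cube c h) (cst k1 y) -
      \int[leb]_(y in cube c h) (k2 * f y)); first exact: (RintegralB mC (icst k1) ik2).
    by congr (_ - _); [exact: volE|exact: RintegralZl].
  have -> : l = m * vol by rewrite /m divfK ?gt_eqF.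
  have -> : k1 * vol - k2 * (m * vol) = vol * (f x - m) ^+ 2 by rewrite /k1 /k2; ring.
  by [].
have -> : 2 / vol * l ^+ 2 = 2 * (vol * m ^+ 2) by rewrite /m; field; rewrite gt_eqF.
have sq : 0 <= vol * (f x - 2 * m) ^+ 2 by rewrite mulr_ge0 ?sqr_ge0// ltW.
have : f x ^+ 2 * vol = 2 * (vol * (f x - m) ^+ 2) + 2 * (vol * m ^+ 2) -
  vol * (f x - 2 * m) ^+ 2 by ring.
lra.
Qed.

(** Both points lie in a cube of side [2 h], so they differ by at most [2 h]
    in each coordinate; substitute [y = x + z]. *)
Lemma cube_deviation_le (f : rV -> R) (c : rV) (h : R) (x : rV) :
  continuous f -> cube c h x ->
  (\int[leb]_(y in cube c h) ((f x - f y) ^+ 2)%:E <=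
   \int[leb]_z ((\1_(cube 0 (2 * h)) z * (f (x + z)%R - f x) ^+ 2)%R)%:E)%E.
Proof.
move=> cf cx; have mC := measurable_cube c h.
have mf := continuous_measurable_rV cf.
have mg : measurable_fun setT (fun y : rV => (f x - f y) ^+ 2).
  by apply: measurable_funX; exact: measurable_funB.
pose g (y : rV) : \bar R := ((\1_(cube c h) y * (f x - f y) ^+ 2)%R)%:E.
have mg1 : measurable_fun setT g.
  by apply/measurable_EFinP; apply: measurable_funM.
rewrite integral_mkcond (_ : (_ \_ _) = g); last first.
  apply/funext => y; rewrite patchE /g indicE; case: ifPn => _.
    by rewrite mul1r.
  by rewrite mul0r.
rewrite -(ge0_integral_rV_shift x mg1); last first.
  by move=> y; rewrite lee_fin mulr_ge0 ?sqr_ge0.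
apply: ge0_le_integral => //.
- by move=> z _; rewrite lee_fin mulr_ge0 ?sqr_ge0.
- exact: (measurableT_comp mg1 (measurable_shift_rV x)).
- apply/measurable_EFinP; apply: measurable_funM.
    by apply: measurable_indic; exact: measurable_cube.
  apply: measurable_funX; apply: measurable_funB => //.
  under eq_fun do rewrite addrC.
  exact: (measurableT_comp mf (measurable_shift_rV x)).
move=> z _; rewrite /g lee_fin !indicE [z + x]addrC -[f x - _]opprB sqrrN.
apply: ler_wpM2r; first exact: sqr_ge0.
case: (boolP (x + z \in cube c h)) => //; rewrite inE => cxz.
rewrite mem_set// /cube/= sub0r normrN.
have -> : z = (c - x) - (c - (x + z)) by apply/rowP => i; rewrite !mxE; ring.
rewrite (le_lt_trans (ler_normB _ _))// mulrDl mul1r ltrD//.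
Qed.

End cubes.

(** * Rellich's estimate *)

Section rellich.
Context {R : realType} {N : nat}.
Notation rV := 'rV[R]_N.
Notation leb := (@lebesgue_rV R N).
Notation leb1 := (@lebesgue_measure R).
Variables (a b : rV -> R).
Hypothesis ab : admissible_weights a b.

Definition D12_density (u : C1c0 R N) (x : rV) : R := enorm (grad u x) ^+ 2 * a x.
Definition D12_energy (u : C1c0 R N) : R := \int[leb]_x D12_density u x.
Definition L2_mass (u : C1c0 R N) : R := \int[leb]_x (b x * u x ^+ 2).

Lemma shell_continuous_density u : shell_continuous (D12_density u).
Proof.
apply: shell_continuousM; first exact: shell_continuous_grad2.
exact: weight_a_cont ab.
Qed.

Lemma D12_density_ge0 u x : 0 <= D12_density u x.
Proof.
have [->|x0] := eqVneq x 0; last first.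
  by rewrite mulr_ge0 ?sqr_ge0// ltW// (weight_a_gt0 ab).
by rewrite (shell_continuous_at0 (shell_continuous_density u)).
Qed.

Lemma D12_energy_ge0 u : 0 <= D12_energy u.
Proof. by apply: Rintegral_ge0 => x _; exact: D12_density_ge0. Qed.

Lemma shell_continuous_sqr (u : C1c0 R N) : shell_continuous (fun x : rV => u x ^+ 2).
Proof.
rewrite (_ : (fun x => _) = fun x => u x * u x); last by apply/funext => x; rewrite expr2.
apply: (@shell_continuousM _ _ u u); first exact: C1c0_shell_continuous.
by move=> x _; exact: (@C1c0_continuous _ _ u).
Qed.

Lemma shell_continuous_weighted (k : rV -> R) (u : C1c0 R N) :
  (forall x, x != 0 -> {for x, continuous k}) ->
  shell_continuous (fun x : rV => k x * u x ^+ 2).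
Proof.
move=> ck; rewrite (_ : (fun x => _) = fun x => u x ^+ 2 * k x).
  by apply: shell_continuousM => //; exact: shell_continuous_sqr.
by apply/funext => x; rewrite mulrC.
Qed.

Lemma C1c0_at0 (u : C1c0 R N) : u 0 = 0.
Proof. exact: shell_continuous_at0 (C1c0_shell_continuous u). Qed.

Lemma continuousV_off0 (k : rV -> R) : (forall x, x != 0 -> {for x, continuous k}) ->
  (forall x, x != 0 -> 0 < k x) -> forall x, x != 0 -> {for x, continuous (fun y => (k y)^-1)}.
Proof. by move=> ck k0 x x0; apply: continuousV; [rewrite gt_eqF// k0|exact: ck]. Qed.

(** Off the origin a positive continuous weight is bounded below on shells. *)
Lemma shell_weight_lb (k : rV -> R) r1 r2 : 0 < r1 ->
  (forall x, x != 0 -> {for x, continuous k}) -> (forall x, x != 0 -> 0 < k x) ->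
  exists2 C, 0 < C & forall x, shell r1 r2 x -> 1 <= C * k x.
Proof.
move=> r10 ck k0; have [C C0 HC] := continuous_shell_bounded r2 r10 (continuousV_off0 ck k0).
exists C => // x sx; have x0 : x != 0.
  by case/andP: sx => rx _; rewrite -normr_gt0 (lt_le_trans r10).
have := HC x sx; rewrite ger0_norm ?invr_ge0 ?(ltW (k0 _ x0))// => kC.
by rewrite -ler_pdivrMr ?k0// div1r.
Qed.

(** The Hardy weight dominates [b] off some shell by [weight_hardy], and on that
    shell by compactness. *)
Lemma L2_mass_le_energy : exists2 C, 0 < C & forall u, L2_mass u <= C * D12_energy u.
Proof.
case: (weight_hardy ab) => V [cV V0 [C C0 HC] tail].
have [r1 [r2 [r10 r20 tl]]] := tail 1 ltr01.
have [K K0 HK] := continuous_shell_bounded r2 r10 (weight_b_cont ab).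
have [L L0 HL] := shell_weight_lb r2 r10 cV V0.
have bV x : x != 0 -> b x <= (K * L + 1) * V x.
  move=> x0; have Vx := ltW (V0 _ x0).
  have [sx|nx] := pselect (shell r1 r2 x); last first.
    have := tl _ x0 nx; rewrite mul1r => /le_trans; apply.
    by rewrite mulrDl mul1r lerDr mulr_ge0// mulr_ge0// ltW.
  have KL : K <= K * L * V x by rewrite -mulrA ler_pMr// HL.
  rewrite (le_trans (ler_norm _))// (le_trans (HK _ sx))// (le_trans KL)//.
  by rewrite mulrDl lerDl mul1r.
exists ((K * L + 1) * C).
  by rewrite mulr_gt0// addr_gt0// mulr_gt0.
move=> u; rewrite -mulrA.
apply: (@le_trans _ _ ((K * L + 1) * \int[leb]_x (V x * u x ^+ 2))); last first.
  by rewrite ler_wpM2l ?HC// ltW// addr_gt0// mulr_gt0.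
rewrite -RintegralZ_shell; last exact: shell_continuous_weighted.
apply: le_Rintegral_shell.
- by apply: shell_continuous_weighted; exact: weight_b_cont ab.
- exact/shell_continuousZ/shell_continuous_weighted.
move=> x; have [->|x0] := eqVneq x 0; first by rewrite C1c0_at0 expr0n/= !mulr0.
by rewrite mulrA ler_wpM2r ?sqr_ge0// bV.
Qed.

Lemma shell_shift (r1 r2 : R) (x y : rV) (r : R) : shell r1 r2 x -> `|y| <= r ->
  shell (r1 - r) (r2 + r) (x + y).
Proof.
move=> /andP[r1x xr2] yr; rewrite /shell/= lerBlDr; apply/andP; split.
  rewrite (le_trans r1x)// -[in leLHS](addrK y x) (le_trans (ler_normB _ _))//.
  by rewrite lerD2l.
by rewrite (le_trans (ler_normD _ _))// lerD.
Qed.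

Lemma sqr_derive_le (u : C1c0 R N) (x z : rV) :
  ('D_z u x) ^+ 2 <= enorm z ^+ 2 * enorm (grad u x) ^+ 2.
Proof. by rewrite C1c0_deriveE sqr_enorm_grad sqr_enorm; exact: sqr_sum_mul_le. Qed.

Lemma continuous_derive (u : C1c0 R N) (z : rV) : continuous (fun x => 'D_z u x).
Proof.
rewrite (_ : (fun x => _) = fun x => \sum_i partial u i x * z ord0 i); last first.
  by apply/funext => x; rewrite C1c0_deriveE; apply: eq_bigr => i _; rewrite mulrC.
suff : shell_continuous (fun x => \sum_i partial u i x * z ord0 i) by case.
apply: shell_continuous_sum => i; apply: shell_continuousM.
  exact: partial_shell_continuous.
by move=> x _; exact: cst_continuous.
Qed.

(** By the fundamental theorem of calculus along [x + t z] the increment is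
    the mean of the directional derivative; its square is at most the mean of
    the squares, and for [t] in [[0, 1]] the segment stays in the larger
    shell, where the weight [a] is at least [C^-1]. *)
Lemma increment_sqr_pointwise (u : C1c0 R N) (r1 r2 C : R) (z x : rV) : 0 <= C ->
  `|z| <= r1 / 2 ->
  (forall y, shell (r1 / 2) (r2 + r1 / 2) y -> 1 <= C * a y) ->
  shell r1 r2 x ->
  (((u (x + z)%R - u x) ^+ 2)%:E <=
   \int[leb1]_(t in `[0%R, 1%R]) ((enorm z ^+ 2 * C) * D12_density u (x + t *: z)%R)%:E)%E.
Proof.
move=> C0 zr Ca sx.
set d := u (x + z) - u x.
have FTC := FTC_line x ltr01 (fun y => C1c0_derive u y z) (@continuous_derive u z).
rewrite scale1r -/d in FTC.
have cl := @continuous_line R N x z.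
have i1 : leb1.-integrable `[0, 1] (EFin \o (fun t : R => 'D_z u (x + t *: z))).
  apply: continuous_compact_integrable; first exact: segment_compact.
  apply: continuous_subspaceT => t.
  apply: (@continuous_comp _ _ _ (fun t : R => x + t *: z) (fun y => 'D_z u y)).
    exact: cl.
  exact: continuous_derive.
have i2 : leb1.-integrable `[0, 1] (EFin \o (fun t : R => (enorm z ^+ 2 * C) * D12_density u (x + t *: z))).
  apply: continuous_compact_integrable; first exact: segment_compact.
  apply: continuous_subspaceT => t.
  apply: (@continuous_comp _ _ _ (fun t : R => x + t *: z)
    (fun y => (enorm z ^+ 2 * C) * D12_density u y)); first exact: cl.
  by case: (shell_continuousZ (enorm z ^+ 2 * C) (shell_continuous_density u)) => + _; exact.
have mI : measurable (`[0, 1]%classic : set (measurableTypeR R)) by exact: measurable_itv.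
have ic : leb1.-integrable `[0, 1] (EFin \o (fun t : R => d ^+ 2)).
  apply: continuous_compact_integrable; first exact: segment_compact.
  by apply: continuous_subspaceT => t; exact: cst_continuous.
have i3 : leb1.-integrable `[0, 1] (EFin \o (fun t : R => 2 * d * 'D_z u (x + t *: z))).
  exact: (integrableZl mI _ i1).
have -> : ((d ^+ 2)%:E = \int[leb1]_(t in `[0%R, 1%R]) (2 * d * 'D_z u (x + t *: z)%R - d ^+ 2)%:E)%E.
  under eq_integral do rewrite EFinB.
  rewrite (integralB mI i3 ic).
  have -> : (\int[leb1]_(t in `[0%R, 1%R]) (2 * d * 'D_z u (x + t *: z)%R)%:E = (2 * d * d)%:E)%E.
    by under eq_integral do rewrite EFinM; rewrite integralZl// FTC -EFinM.
  have -> : (\int[leb1]_(t in `[0%R, 1%R]) ((d ^+ 2)%:E) = (d ^+ 2)%:E)%E.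
    by rewrite integral_cst//= lebesgue_measure_itv/= lte_fin ltr01 oppr0 adde0 mule1.
  by rewrite -EFinB; congr EFin; ring.
apply: le_integral => //.
  exact: (integrableB mI i3 ic).
move=> t; rewrite inE/= in_itv/= => /andP[t0 t1]; rewrite lee_fin.
set D := 'D_z u _.
have D2 : 2 * d * D - d ^+ 2 <= D ^+ 2.
  by rewrite -subr_ge0 (_ : _ - _ = (D - d) ^+ 2) ?sqr_ge0//; ring.
apply: (le_trans D2); apply: (le_trans (sqr_derive_le _ _ _)).
rewrite -mulrA ler_wpM2l ?sqr_ge0// /D12_density mulrCA ler_peMr ?sqr_ge0//.
apply: Ca; have {1}-> : r1 / 2 = r1 - r1 / 2 by field.
apply: shell_shift => //; rewrite normrZ ger0_norm//.
by rewrite (le_trans _ zr)// ler_piMl.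
Qed.

Lemma measurable_density_line (u : C1c0 R N) (z : rV) (k : R) :
  measurable_fun setT (fun xt : rV * measurableTypeR R =>
    ((k * D12_density u (xt.1 + xt.2 *: z) * \1_`[0%R, 1%R]%classic xt.2)%:E)).
Proof.
apply/measurable_EFinP; apply: measurable_funM.
  apply: measurable_funM => //.
  apply: (measurableT_comp _ (measurable_line2 z)).
  exact: shell_continuous_measurable (shell_continuous_density u).
have mI : measurable (`[0, 1]%classic : set (measurableTypeR R)) by exact: measurable_itv.
exact: (measurableT_comp (measurable_indic mI) measurable_snd).
Qed.

(** Integrate the previous bound over the shell; every translate of the energy
    density has the same integral. *)
Lemma increment_sqr (u : C1c0 R N) (r1 r2 C : R) (z : rV) : 0 <= C ->
  `|z| <= r1 / 2 ->
  (forall y, shell (r1 / 2) (r2 + r1 / 2) y -> 1 <= C * a y) ->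
  (\int[leb]_x (\1_(shell r1 r2) x * (u (x + z)%R - u x) ^+ 2)%:E <=
   (enorm z ^+ 2 * C * D12_energy u)%:E)%E.
Proof.
move=> C0 zr Ca; set k := enorm z ^+ 2 * C.
have k0 : 0 <= k by rewrite mulr_ge0 ?sqr_ge0.
pose F (xt : rV * measurableTypeR R) : \bar R :=
  ((k * D12_density u (xt.1 + xt.2 *: z) * \1_`[0%R, 1%R]%classic xt.2)%:E).
have mF : measurable_fun setT F by exact: measurable_density_line.
have F0 xt : (0 <= F xt)%E.
  by rewrite lee_fin mulr_ge0// mulr_ge0// D12_density_ge0.
have mu := continuous_measurable_rV (@C1c0_continuous _ _ u).
have mG := shell_continuous_measurable (shell_continuous_density u).
apply: (@le_trans _ _ (\int[leb]_x \int[leb1]_t F (x, t))%E).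
  apply: ge0_le_integral => //.
  - by move=> x _; rewrite lee_fin mulr_ge0 ?sqr_ge0.
  - apply/measurable_EFinP; apply: measurable_funM.
      by apply: measurable_indic; exact: measurable_shell.
    apply: measurable_funX; apply: measurable_funB => //.
    exact: (measurableT_comp mu (measurable_shift_rV z)).
  - exact: measurable_fun_fubini_tonelli_F.
  move=> x _; rewrite indicE; case: (boolP (x \in shell r1 r2)) => [|_].
    rewrite inE mul1r => sx.
    apply: le_trans; first exact: (@increment_sqr_pointwise u _ _ _ _ _ C0 zr Ca sx).
    rewrite integral_mkcond le_eqVlt; apply/orP; left; apply/eqP.
    apply: eq_integral => t _; rewrite patchE /F/= indicE.
    by case: ifPn => _; rewrite ?mulr1 ?mulr0.
  by rewrite mul0r; exact: integral_ge0.
rewrite fubini_tonelli//.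
apply: (@le_trans _ _ (\int[leb1]_(t in `[0%R, 1%R]) cst (k * D12_energy u)%:E t)%E).
  rewrite [leRHS]integral_mkcond le_eqVlt; apply/orP; left; apply/eqP.
  apply: eq_integral => t _; rewrite patchE /F/= indicE.
  case: ifPn => _; last by apply: integral0_eq => x _; rewrite mulr0.
  under eq_integral do rewrite mulr1 EFinM.
  rewrite ge0_integralZl//; last first.
  - by move=> x _; rewrite lee_fin D12_density_ge0.
  - apply/measurable_EFinP.
    exact: (measurableT_comp mG (measurable_shift_rV (t *: z))).
  rewrite (@ge0_integral_rV_shift _ _ (t *: z) (EFin \o D12_density u))//; last first.
  - by move=> x; rewrite lee_fin D12_density_ge0.
  - exact/measurable_EFinP.
  by rewrite EFin_Rintegral_shell//; exact: shell_continuous_density.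
rewrite integral_cst//=.
by rewrite lebesgue_measure_itv/= lte_fin ltr01 oppr0 adde0 mule1.
Qed.

End rellich.

Section rellich_estimate.
Context {R : realType} {N : nat}.
Notation rV := 'rV[R]_N.
Notation leb := (@lebesgue_rV R N).
Variables (a b : rV -> R).
Hypothesis ab : admissible_weights a b.
Notation energy := (D12_energy a).
Notation mass := (L2_mass b).

Lemma shell_finite_cover (r1 r2 h : R) : 0 < h ->
  exists cs : seq rV, (forall c, c \in cs -> shell r1 r2 c) /\
    forall x, shell r1 r2 x -> exists2 c, c \in cs & cube c h x.
Proof.
move=> h0; have := @compact_shell R N r1 r2; rewrite compact_cover.
move=> /(_ rV (shell r1 r2) (fun c => cube c h)) [].
- move=> c _; rewrite (_ : cube c h = ball c h); first exact: ball_open.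
  by rewrite mx_norm_ball.
- by move=> x sx; exists x => //; rewrite /cube/= subrr normr0.
move=> cs csS cov; exists (finmap.enum_fset cs); split.
  by move=> c /csS; rewrite inE.
by move=> x /cov[c /= ccs cx]; exists c.
Qed.

(** A point of the shell lies in a cube of the covering, whose mean is one of
    those summed on the right. *)
Lemma shell_mass_pointwise (u : C1c0 R N) (r1 r2 h : R) (cs : seq rV) (x : rV) :
  0 < h -> (forall y, shell r1 r2 y -> exists2 c, c \in cs & cube c h y) ->
  (((2 * h) ^+ N * (\1_(shell r1 r2) x * u x ^+ 2))%:E <=
   2%:E * \int[leb]_z (\1_(cube 0 (2 * h)) z *
            (\1_(shell r1 r2) x * (u (x + z)%R - u x) ^+ 2))%:E +
   (2 / (2 * h) ^+ N * (\sum_(c <- cs) cube_int c h u ^+ 2) * \1_(shell r1 r2) x)%:E)%E.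
Proof.
move=> h0 cov; set vol := (2 * h) ^+ N.
have vol0 : 0 < vol by rewrite exprn_gt0// mulr_gt0.
have S0 : 0 <= \sum_(c <- cs) cube_int c h u ^+ 2.
  by apply: sumr_ge0 => c _; exact: sqr_ge0.
rewrite indicE; case: (boolP (x \in shell r1 r2)) => [xs|_]; last first.
  rewrite mul0r !mulr0 adde0 mule_ge0//; apply: integral_ge0 => z _.
  by rewrite lee_fin !mul0r mulr0.
rewrite !mul1r mulr1; under eq_integral do rewrite mul1r.
move: xs; rewrite inE => xs; have [c ccs cx] := cov _ xs.
have su := C1c0_shell_continuous u; have cu := @C1c0_continuous _ _ u.
have [M M0 uM] := shell_continuous_bounded su.
apply: le_trans; last first.
  apply: leeD2r; apply: lee_wpmul2l; first by rewrite lee_fin.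
  exact: (cube_deviation_le cu cx).
have ii : leb.-integrable (cube c h) (EFin \o (fun y => (u x - u y) ^+ 2)).
  apply: integrable_cube.
    move=> y; apply: (@continuous_comp _ _ _ (fun y => u x - u y) (fun r => r ^+ 2)).
      by apply: (@continuousB _ _ _ (cst (u x)) u); [exact: cst_continuous|exact: cu].
    exact: exprn_continuous.
  exists ((M + M) ^+ 2) => y; rewrite normrX ler_sqr ?nnegrE ?addr_ge0 ?(ltW M0)//.
  by rewrite (le_trans (ler_normB _ _))// lerD.
have := sqr_le_cube_deviation c x h0 su; rewrite -/vol => key.
rewrite -[X in (_ * X)%E]fineK; last by apply: (integrable_fin_num _ ii); exact: measurable_cube.
rewrite -EFinM -EFinD lee_fin mulrC (le_trans key)// lerD2l ler_wpM2l//.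
  by rewrite divr_ge0// ltW.
by rewrite (big_rem c)//= lerDl sumr_ge0// => d _; exact: sqr_ge0.
Qed.

(** Integrate the pointwise bound over the shell and exchange the integrals in
    [x] and in the displacement [z], which is at most [2 h]. *)
Lemma shell_mass_le (u : C1c0 R N) (r1 r2 C h : R) (cs : seq rV) : 0 <= C ->
  (forall y, shell (r1 / 2) (r2 + r1 / 2) y -> 1 <= C * a y) ->
  0 < h -> 2 * h <= r1 / 2 ->
  (forall y, shell r1 r2 y -> exists2 c, c \in cs & cube c h y) ->
  (2 * h) ^+ N * \int[leb]_x (\1_(shell r1 r2) x * u x ^+ 2) <=
  2 * ((4 * h) ^+ N * ((N%:R * (2 * h)) ^+ 2 * C * energy u)) +
  2 / (2 * h) ^+ N * (\sum_(c <- cs) cube_int c h u ^+ 2) * fine (leb (shell r1 r2)).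
Proof.
move=> C0 Ca h0 hr cov; set vol := (2 * h) ^+ N; set S := \sum_(c <- cs) _.
have vol0 : 0 < vol by rewrite exprn_gt0// mulr_gt0.
have S0 : 0 <= S by apply: sumr_ge0 => c _; exact: sqr_ge0.
have E0 : 0 <= energy u by exact: D12_energy_ge0 ab _.
have mK := @measurable_shell R N r1 r2.
have Kfin := @shell_fin R N r1 r2.
have mu := continuous_measurable_rV (@C1c0_continuous _ _ u).
pose K (x : rV) : R := \1_(shell r1 r2) x.
have mK1 : measurable_fun setT K by exact: measurable_indic.
pose Z := cube (0 : rV) (2 * h).
have mZ : measurable Z by exact: measurable_cube.
pose F (xz : rV * rV) : \bar R :=
  (\1_Z xz.2 * (K xz.1 * (u (xz.1 + xz.2) - u xz.1) ^+ 2))%:E.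
have madd : measurable_fun setT (fun xz : rV * rV => xz.1 + xz.2).
  apply: measurable_fun_coord => i; under eq_fun do rewrite mxE.
  apply: measurable_funD.
    exact: (measurableT_comp (measurable_coord i) measurable_fst).
  exact: (measurableT_comp (measurable_coord i) measurable_snd).
have mF : measurable_fun setT F.
  apply/measurable_EFinP; apply: measurable_funM.
    exact: (measurableT_comp (measurable_indic mZ) measurable_snd).
  apply: measurable_funM; first exact: (measurableT_comp mK1 measurable_fst).
  apply: measurable_funX; apply: measurable_funB.
    exact: (measurableT_comp mu madd).
  exact: (measurableT_comp mu measurable_fst).
have c0 : 0 <= (N%:R * (2 * h)) ^+ 2 * C * energy u.
  by apply: mulr_ge0 => //; apply: mulr_ge0 => //; exact: sqr_ge0.
have K0 x : 0 <= K x by [].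
have F0 xz : (0 <= F xz)%E.
  by rewrite lee_fin mulr_ge0// mulr_ge0// sqr_ge0.
have mJ : measurable_fun setT (fun x => \int[leb]_z F (x, z))%E.
  exact: measurable_fun_fubini_tonelli_F.
have step1 : (\int[leb]_x (vol * (K x * u x ^+ 2))%:E <=
    2%:E * \int[leb]_x \int[leb]_z F (x, z) + (2 / vol * S * fine (leb (shell r1 r2)))%:E)%E.
  apply: (@le_trans _ _ (\int[leb]_x (2%:E * \int[leb]_z F (x, z) + (2 / vol * S * K x)%:E))%E).
    apply: ge0_le_integral => //.
    - by move=> x _; rewrite lee_fin mulr_ge0 ?(ltW vol0)// mulr_ge0 ?sqr_ge0.
    - apply/measurable_EFinP; apply: measurable_funM => //.
      by apply: measurable_funM => //; exact: measurable_funX.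
    - apply: emeasurable_funD; first exact: measurable_funeM.
      by apply/measurable_EFinP; exact: measurable_funM.
    - by move=> x _; exact: shell_mass_pointwise.
  have c1 : 0 <= 2 / vol * S by rewrite mulr_ge0// divr_ge0// ltW.
  rewrite ge0_integralD//; last first.
  - by apply/measurable_EFinP; exact: measurable_funM.
  - by move=> x _; rewrite lee_fin mulr_ge0.
  - exact: measurable_funeM.
  - by move=> x _; rewrite mule_ge0//; exact: integral_ge0.
  rewrite ge0_integralZl//; last by move=> x _; exact: integral_ge0.
  apply: leeD2l; under eq_integral do rewrite EFinM.
  rewrite ge0_integralZl//; last 2 first.
  - exact/measurable_EFinP.
  - by move=> x _; rewrite lee_fin.
  rewrite integral_indic// setIT [X in (_ <= X)%E]EFinM fineK//.
  by rewrite ge0_fin_numE.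
have step2 : (\int[leb]_x \int[leb]_z F (x, z) <=
    ((4 * h) ^+ N * ((N%:R * (2 * h)) ^+ 2 * C * energy u))%:E)%E.
  rewrite fubini_tonelli//.
  apply: (@le_trans _ _ (\int[leb]_z (((N%:R * (2 * h)) ^+ 2 * C * energy u)%:E * (\1_Z z)%:E))%E).
    apply: ge0_le_integral => //.
    - by move=> z _; exact: integral_ge0.
    - exact: measurable_fun_fubini_tonelli_G.
    - by apply: measurable_funeM; apply/measurable_EFinP; exact: measurable_indic.
    move=> z _; rewrite /F/= indicE; case: (boolP (z \in Z)) => [|_]; last first.
      by rewrite mule0 integral0_eq// => x _; rewrite mul0r.
    rewrite inE /Z /cube/= sub0r normrN => zh; rewrite mule1.
    under eq_integral do rewrite mul1r.
    have zr : `|z| <= r1 / 2 by rewrite (le_trans _ hr)// ltW.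
    apply: le_trans; first exact: (@increment_sqr _ _ _ _ ab u _ _ _ _ C0 zr Ca).
    rewrite lee_fin ler_wpM2r// ler_wpM2r// ler_sqr ?nnegrE ?enorm_ge0//.
      by rewrite (le_trans (enorm_le_norm _))// ler_wpM2l// ltW.
    by rewrite mulr_ge0// mulr_ge0// ltW.
  rewrite ge0_integralZl//; last first.
  - by apply/measurable_EFinP; exact: measurable_indic.
  rewrite integral_indic// setIT muleC.
  have lebZ : leb Z = ((4 * h) ^+ N)%:E.
    by rewrite leb_cube ?mulr_gt0// mulrA -natrM.
  by rewrite [X in (X * _ <= _)%E]lebZ -EFinM.
rewrite -RintegralZl//; last first.
  apply: (le_integrable measurableT _ _ (shell_continuous_integrable (shell_continuous_sqr u))).
    by apply/measurable_EFinP; apply: measurable_funM => //; exact: measurable_funX.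
  move=> x _ /=; rewrite lee_fin normrM ler_piMl// indicE.
  by case: (_ \in _); rewrite ?normr1 ?normr0.
apply: Rintegral_le_ub.
  by move=> x; rewrite mulr_ge0 ?(ltW vol0)// mulr_ge0 ?sqr_ge0.
apply: (le_trans step1); rewrite [leRHS]EFinD; apply: leeD2r.
rewrite [leRHS]EFinM; apply: lee_wpmul2l => //; by rewrite lee_fin.
Qed.

Lemma Rintegral_indic_bound (F g : rV -> R) (A : set rV) (k : R) :
  leb.-integrable setT (EFin \o F) -> measurable A -> (leb A < +oo)%E ->
  shell_continuous g -> (forall x, `|F x| <= k * \1_A x + g x) ->
  `|\int[leb]_x F x| <= k * fine (leb A) + \int[leb]_x g x.
Proof.
move=> iF mA Afin sg Fg.
have iA : leb.-integrable setT (EFin \o (fun x => k * \1_A x)).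
  exact: (integrableZl measurableT k (integrable_indic_rV mA Afin)).
have ig := shell_continuous_integrable sg.
apply: le_trans; first exact: (le_normr_Rintegral measurableT iF).
have -> : k * fine (leb A) + \int[leb]_x g x = \int[leb]_x (k * \1_A x + g x).
  rewrite (RintegralD measurableT iA ig); congr (_ + _).
  rewrite (RintegralZl _ measurableT (integrable_indic_rV mA Afin)); congr (_ * _).
  by rewrite /Rintegral integral_indic// setIT.
apply: le_Rintegral => //; first exact: integrable_norm.
exact: (integrableD measurableT iA ig).
Qed.

Lemma normr_le_1Dsqr (r : R) : `|r| <= 1 + r ^+ 2.
Proof.
rewrite -[r ^+ 2]real_normK ?num_real//; set t := `|r|.
have : 0 <= (t - 1) ^+ 2 by exact: sqr_ge0.
have : 0 <= t by exact: normr_ge0.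
have -> : (t - 1) ^+ 2 = t ^+ 2 - 2 * t + 1 by ring.
move: (t ^+ 2) => t2; lra.
Qed.

(** Off a large shell the mass is a small part of the energy by Hardy's
    inequality; on the shell the deviation from the means over cubes of size
    [h] is of order [h^2] times the energy. *)
Lemma rellich (eps : R) : 0 < eps -> exists h cs K, [/\ 0 < h, 0 <= K,
  (forall u, mass u <= eps * energy u + K * \sum_(c <- cs) cube_int c h u ^+ 2) &
  exists C, forall (u : C1c0 R N) c, c \in cs -> `|cube_int c h u| <= C * (1 + energy u)].
Proof.
move=> eps0.
case: (weight_hardy ab) => V [cV V0 [CV CV0 HCV] tail].
have M0 : 0 < 2 * CV / eps by rewrite divr_gt0// mulr_gt0.
have [r1 [r2 [r10 r20 tl]]] := tail _ M0.
have r120 : 0 < r1 / 2 by rewrite divr_gt0.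
have [C C0 HC] := shell_weight_lb (r2 + r1 / 2) r120 (weight_a_cont ab) (weight_a_gt0 ab).
have [Cb Cb0 HCb] := shell_weight_lb (r2 + r1 / 2) r120 (weight_b_cont ab) (weight_b_gt0 ab).
have [B B0 HB] := continuous_shell_bounded r2 r10 (weight_b_cont ab).
pose Q := B * (2 * (2 ^+ N * ((N%:R * 2) ^+ 2 * C))).
have Q0 : 0 <= Q.
  apply: mulr_ge0; first exact: ltW.
  apply: mulr_ge0 => //; apply: mulr_ge0; first exact: exprn_ge0.
  by apply: mulr_ge0; [exact: sqr_ge0|exact: ltW].
have Q1 : 0 < Q + 1 by rewrite ltr_wpDl.
(* The first bound keeps the cubes off the origin; the other two make
   [Q * h^2], the factor of the energy on the shell, at most [eps / 2]. *)
pose h := Num.min (Num.min (r1 / 4) 1) (eps / 2 / (Q + 1)).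
have h0 : 0 < h by rewrite !lt_min ltr01 !divr_gt0.
have h1 : h <= 1 by rewrite !ge_min lexx orbT.
have hr : 2 * h <= r1 / 2.
  have : h <= r1 / 4 by rewrite !ge_min lexx.
  lra.
have hQ : Q * h ^+ 2 <= eps / 2.
  have hh : h ^+ 2 <= h by rewrite expr2 ler_piMl// ltW.
  have hq : h <= eps / 2 / (Q + 1) by rewrite ge_min lexx orbT.
  rewrite (le_trans (ler_wpM2l Q0 (le_trans hh hq)))//.
  rewrite mulrCA ler_piMr ?divr_ge0 ?(ltW eps0)//.
  by rewrite ler_pdivrMr// mul1r lerDl.
have [cs [csK cov]] := @shell_finite_cover r1 r2 h h0.
pose vol := (2 * h) ^+ N.
have vol0 : 0 < vol by rewrite exprn_gt0// mulr_gt0.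
pose L := fine (leb (shell r1 r2)).
have L0 : 0 <= L by rewrite fine_ge0.
have mK := @measurable_shell R N r1 r2.
have Kfin := @shell_fin R N r1 r2.
exists h, cs, (B * (vol^-1 * (2 / vol * L))); split => //.
- apply: mulr_ge0; first exact: ltW.
  by rewrite mulr_ge0 ?invr_ge0 ?(ltW vol0)// mulr_ge0// divr_ge0// ltW.
- move=> u; have E0 : 0 <= energy u := D12_energy_ge0 ab u.
  pose S := \sum_(c <- cs) cube_int c h u ^+ 2.
  have su2 := shell_continuous_sqr u.
  have iKu : leb.-integrable setT (EFin \o (fun x : rV => \1_(shell r1 r2) x * u x ^+ 2)).
    apply: (le_integrable measurableT _ _ (shell_continuous_integrable su2)).
      apply/measurable_EFinP; apply: measurable_funM => //.
      exact: shell_continuous_measurable.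
    move=> x _ /=; rewrite lee_fin normrM ler_piMl// indicE.
    by case: (_ \in _); rewrite ?normr1 ?normr0.
  have iB : leb.-integrable setT
      (EFin \o (fun x : rV => B * (\1_(shell r1 r2) x * u x ^+ 2))).
    exact: (integrableZl measurableT B iKu).
  have sV : shell_continuous (fun x : rV => (2 * CV / eps)^-1 * (V x * u x ^+ 2)).
    by apply: shell_continuousZ; exact: shell_continuous_weighted.
  have iV := shell_continuous_integrable sV.
  have sb := shell_continuous_weighted u (weight_b_cont ab).
  have step : mass u <= B * \int[leb]_x (\1_(shell r1 r2) x * u x ^+ 2) +
      (2 * CV / eps)^-1 * \int[leb]_x (V x * u x ^+ 2).
    rewrite -RintegralZl// -RintegralZ_shell; last exact: shell_continuous_weighted.
    rewrite -(RintegralD measurableT iB iV).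
    apply: le_Rintegral => //; first exact: shell_continuous_integrable.
      exact: (integrableD measurableT iB iV).
    move=> x _; have [->|x0] := eqVneq x 0.
      by rewrite C1c0_at0 expr0n/= !mulr0 addr0.
    have u20 : 0 <= u x ^+ 2 by exact: sqr_ge0.
    have V1 : 0 <= (2 * CV / eps)^-1 * (V x * u x ^+ 2).
      by rewrite mulr_ge0 ?invr_ge0 ?(ltW M0)// mulr_ge0// ltW// V0.
    rewrite indicE; case: (boolP (x \in shell r1 r2)) => xs.
      rewrite mul1r; move: xs; rewrite inE => xs.
      apply: ler_wpDr => //; apply: ler_wpM2r => //.
      exact: le_trans (ler_norm _) (HB _ xs).
    rewrite mul0r mulr0 add0r [leRHS]mulrA; apply: ler_wpM2r => //.
    rewrite ler_pdivlMl//.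
    by apply: tl => // sx; move/negP: xs; rewrite inE.
  apply: (le_trans step).
  have VE : (2 * CV / eps)^-1 * \int[leb]_x (V x * u x ^+ 2) <= eps / 2 * energy u.
    have -> : eps / 2 * energy u = (2 * CV / eps)^-1 * (CV * energy u).
      by field; rewrite !gt_eqF.
    by apply: ler_wpM2l; [rewrite invr_ge0 ltW|exact: HCV].
  have KE : B * \int[leb]_x (\1_(shell r1 r2) x * u x ^+ 2) <=
     Q * h ^+ 2 * energy u + B * (vol^-1 * (2 / vol * L)) * S.
    have -> : Q * h ^+ 2 * energy u + B * (vol^-1 * (2 / vol * L)) * S =
      B * (vol^-1 * (2 * ((4 * h) ^+ N * ((N%:R * (2 * h)) ^+ 2 * C * energy u)) +
         2 / vol * S * L)).
      have -> : (4 * h) ^+ N = 2 ^+ N * vol.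
        by rewrite /vol -exprMn mulrA -natrM.
      rewrite /Q; field; by rewrite gt_eqF.
    apply: ler_wpM2l; first exact: ltW.
    rewrite ler_pdivlMl//.
    exact: (shell_mass_le u (ltW C0) HC h0 hr cov).
  have hQE : Q * h ^+ 2 * energy u <= eps / 2 * energy u by apply: ler_wpM2r.
  move: KE hQE VE; rewrite -/S; lra.
have [CB CB0 HCB] := L2_mass_le_energy ab.
exists (vol + Cb * CB) => u c ccs.
have E0 : 0 <= energy u := D12_energy_ge0 ab u.
have su := C1c0_shell_continuous u.
have mC := measurable_cube c h.
have sb := shell_continuous_weighted u (weight_b_cont ab).
rewrite /cube_int Rintegral_mkcond.
have iF : leb.-integrable setT (EFin \o ((u : rV -> R) \_ (cube c h))).
  rewrite -restrict_EFin; apply/(integrable_mkcond _ mC).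
  exact: (integrableS measurableT mC (@subsetT _ _) (shell_continuous_integrable su)).
have key x : `|((u : rV -> R) \_ (cube c h)) x| <= 1 * \1_(cube c h) x + Cb * (b x * u x ^+ 2).
  have [->|x0] := eqVneq x 0.
    rewrite C1c0_at0 expr0n/= !mulr0 addr0 mul1r patchE; case: ifP => _.
      by rewrite C1c0_at0 normr0.
    by rewrite normr0.
  have bu0 : 0 <= b x * u x ^+ 2 by rewrite mulr_ge0 ?sqr_ge0// ltW// (weight_b_gt0 ab).
  rewrite patchE indicE; case: (boolP (x \in cube c h)) => [|_]; last first.
    by rewrite normr0 mulr0 add0r mulr_ge0// ltW.
  rewrite inE mulr1 => cx; apply: (le_trans (normr_le_1Dsqr _)); rewrite lerD2l mulrA.
  apply: ler_peMl; first exact: sqr_ge0.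
  apply: HCb; have -> : x = c + (x - c) by rewrite addrC subrK.
  have {1}-> : r1 / 2 = r1 - r1 / 2 by field.
  apply: shell_shift; first exact: csK.
  rewrite distrC (le_trans (ltW cx))// (le_trans _ hr)//.
  by rewrite ler_peMl ?ler1n// ltW.
have := Rintegral_indic_bound iF mC (leb_cube_fin c h) (shell_continuousZ Cb sb) key.
rewrite RintegralZ_shell// mul1r leb_cube//= -/vol => /le_trans; apply.
have mE : mass u <= CB * energy u := HCB u.
have : Cb * mass u <= Cb * (CB * energy u) by rewrite ler_wpM2l// ltW.
rewrite mulrDr mulr1 mulrDl [Cb * (CB * _)]mulrA => mE2.
have v0 : 0 <= vol * energy u by rewrite mulr_ge0// ltW.
have c0 : 0 <= Cb * CB by rewrite mulr_ge0// ltW.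
rewrite -/(mass u); lra.
Qed.

End rellich_estimate.

(** * Closability of the energy *)

Section closability.
Context {R : realType} {N : nat}.
Notation rV := 'rV[R]_N.
Notation leb := (@lebesgue_rV R N).
Notation leb1 := (@lebesgue_measure R).
Variables (a b : rV -> R).
Hypothesis ab : admissible_weights a b.
Notation energy := (D12_energy a).
Notation mass := (L2_mass b).
Notation e_ i := (delta_mx ord0 i : rV).

Lemma seq_common_radius (I : eqType) (s : seq I) (P : I -> R -> Prop) :
  (forall i, exists2 e, 0 < e & P i e) ->
  (forall i e e', e' <= e -> P i e -> P i e') ->
  exists2 e, 0 < e & forall i, i \in s -> P i e.
Proof.
move=> exP monP; elim: s => [|i s [e e0 He]]; first by exists 1.
have [d d0 Hd] := exP i; exists (Num.min e d); first by rewrite lt_min e0.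
move=> j; rewrite inE => /predU1P[->|js].
  by apply: monP Hd; rewrite ge_min lexx orbT.
by apply: monP (He _ js); rewrite ge_min lexx.
Qed.

(** Heine's theorem; the bound [h <= r1 / 2] keeps the translated supports off
    the origin. *)
Lemma shell_unif_continuous (v : rV -> R) (r1 r2 omega : R) : continuous v ->
  0 < r1 -> shell_supp r1 r2 v -> 0 < omega ->
  exists2 h, 0 < h & h <= r1 / 2 /\
    forall x z, `|z| <= h -> `|v (x + z) - v x| <= omega.
Proof.
move=> cv r10 vs om0.
have om20 : 0 < omega / 2 by rewrite divr_gt0.
have H c : exists e, 0 < e /\ forall y, `|c - y| < e -> `|v c - v y| < omega / 2.
  have /cvgrPdist_lt/(_ _ om20) := cv c.
  move=> /nbhs_ballP[e /= e0 He]; exists e; split => // y cy.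
  by apply: He; rewrite mx_norm_ball.
have [e He] := choice H.
have := @compact_shell R N (r1 / 2) (r2 + r1 / 2); rewrite compact_cover.
move=> /(_ rV (shell (r1 / 2) (r2 + r1 / 2)) (fun c => ball c (e c / 2))) [].
- by move=> c _; exact: ball_open.
- by move=> x sx; exists x => //; apply: ballxx; rewrite divr_gt0//; have [] := He x.
move=> cs _ cov.
have [h h0 Hh] : exists2 h, 0 < h &
    forall c, c \in finmap.enum_fset cs -> h <= e c / 2.
  apply: (@seq_common_radius rV _ (fun c h => h <= e c / 2)) => [c|c x y yx xe].
    by exists (e c / 2) => //; rewrite divr_gt0// (He c).1.
  exact: le_trans yx xe.
exists (Num.min h (r1 / 2)); first by rewrite lt_min h0 divr_gt0.
split; first by rewrite ge_min lexx orbT.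
move=> x z; rewrite le_min => /andP[zh zr].
have [sx|nx] := pselect (shell (r1 / 2) (r2 + r1 / 2) x); last first.
  rewrite (vs x) ?(vs (x + z)) ?subrr ?normr0 ?(ltW om0)//.
    move=> sxz; apply: nx.
    rewrite -(addrK z x) (_ : r1 / 2 = r1 - r1 / 2); last by field.
    rewrite (_ : r2 + (r1 - r1 / 2) = r2 + r1 / 2); last by field.
    by apply: shell_shift => //; rewrite normrN.
  move=> /andP[rx xr]; apply: nx; rewrite /shell/=; apply/andP; split; lra.
have [c /= ccs] := cov _ sx; rewrite mx_norm_ball /ball_/= => cx.
have [ec0 Hc] := He c.
have vcx : `|v c - v x| < omega / 2.
  by apply: Hc; apply: lt_trans cx _; rewrite ltr_pdivrMr// ltr_pMr// ltr1n.
have vcxz : `|v c - v (x + z)| < omega / 2.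
  apply: Hc; rewrite opprD addrA (le_lt_trans (ler_normB _ _))//.
  by rewrite [ltRHS]splitr ltr_leD// (le_trans zh)// Hh.
have -> : v (x + z) - v x = (v c - v x) - (v c - v (x + z)).
  by rewrite opprB [RHS]addrC addrA subrK.
by rewrite (le_trans (ler_normB _ _))// [leRHS]splitr lerD// ltW.
Qed.

Lemma shell_supp_shift (v : rV -> R) (r1 r2 : R) (z : rV) : `|z| <= r1 / 2 ->
  shell_supp r1 r2 v -> shell_supp (r1 / 2) (r2 + r1 / 2) (fun x => v (x + z)).
Proof.
move=> zr vs x nx; apply: vs => sxz; apply: nx.
rewrite -(addrK z x) (_ : r1 / 2 = r1 - r1 / 2); last by field.
rewrite (_ : r2 + (r1 - r1 / 2) = r2 + r1 / 2); last by field.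
by apply: shell_shift => //; rewrite normrN.
Qed.

Lemma shell_continuous_increment (v : rV -> R) (r1 r2 : R) (z : rV) :
  continuous v -> 0 < r1 -> `|z| <= r1 / 2 -> shell_supp r1 r2 v ->
  shell_continuous (fun x => v (x + z) - v x) /\
  shell_supp (r1 / 2) (r2 + r1 / 2) (fun x => v (x + z) - v x).
Proof.
move=> cv r10 zr vs.
have S : shell_supp (r1 / 2) (r2 + r1 / 2) (fun x => v (x + z) - v x).
  move=> x nx; rewrite (shell_supp_shift zr vs nx) (shell_supp_widen _ _ vs nx) ?subrr//.
    by move: r10; lra.
  by rewrite lerDl divr_ge0// ltW.
split => //; split; last by exists (r1 / 2), (r2 + r1 / 2); rewrite divr_gt0.
move=> x; apply: (@continuousB _ _ _ (fun y : rV => v (y + z)) v); last exact: cv.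
apply: (@continuous_comp _ _ _ (fun y : rV => y + z) v); last exact: cv.
by apply: (@continuousD _ _ _ id (cst z)); [exact: cvg_id|exact: cst_continuous].
Qed.

Section pairing.
Variables (v : rV -> R) (r1 r2 : R).
Hypotheses (cv : continuous v) (r10 : 0 < r1) (vs : shell_supp r1 r2 v).
Let K := shell (r1 / 2) (r2 + r1 / 2) : set rV.
Let L := fine (leb K).

Let r120 : 0 < r1 / 2. Proof. by rewrite divr_gt0. Qed.

(** A bound on [k + f^2/k] suffices to control [f], and the squares of [w] and
    of its derivatives are integrable against the weights. *)
Lemma increment_pairing_le (z : rV) (omega k : R) (f g : rV -> R) :
  0 <= omega -> `|z| <= r1 / 2 -> (forall x, `|v (x + z) - v x| <= omega) ->
  shell_continuous f -> shell_continuous g -> (forall x, 0 <= g x) ->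
  (forall x, K x -> `|f x| <= k + g x) ->
  `|\int[leb]_x ((v (x + z) - v x) * f x)| <= omega * k * L + omega * \int[leb]_x g x.
Proof.
move=> om0 zr vom sf sg g0 fg.
have [sD Ds] := shell_continuous_increment cv r10 zr vs.
have sDf : shell_continuous (fun x => (v (x + z) - v x) * f x).
  by apply: shell_continuousM => // x _; case: sf => + _; exact.
have mK : measurable K by exact: measurable_shell.
have Kfin : (leb K < +oo)%E by exact: shell_fin.
rewrite -RintegralZ_shell//.
apply: (Rintegral_indic_bound (shell_continuous_integrable sDf) mK Kfin).
  exact: shell_continuousZ.
move=> x; rewrite normrM indicE; case: (boolP (x \in K)) => [|xK].
  rewrite inE => xK; rewrite mulr1 -mulrDr.
  by apply: ler_pM => //; exact: fg.
rewrite Ds ?normr0 ?mul0r ?mulr0 ?add0r ?mulr_ge0//.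
by move=> xK'; move/negP: xK; rewrite inE.
Qed.

(** Let [J t] be the integral of [v (x) dw (x + t e_i)].  Translating [v] instead
    of [dw] shows that [J t] is within [omega * C1] of [J 0] for [t <= h].  The
    integral of [J] over [[0, h]] is the integral of [v (x) (w (x + h e_i) - w x)],
    that is, of an increment of [v] times [w], which is small with the mass. *)
Lemma derive_pairing_small (i : 'I_N) (M eta : R) : 0 <= M -> 0 < eta ->
  exists2 d, 0 < d & forall w : C1c0 R N, energy w <= M -> mass w <= d ->
    `|\int[leb]_x (v x * partial w i x)| <= eta.
Proof.
move=> M0 eta0.
have [Ca Ca0 HCa] := shell_weight_lb (r2 + r1 / 2) r120 (weight_a_cont ab) (weight_a_gt0 ab).
have [Cb Cb0 HCb] := shell_weight_lb (r2 + r1 / 2) r120 (weight_b_cont ab) (weight_b_gt0 ab).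
have L0 : 0 <= L by exact: fine_ge0.
pose C1 := L + Ca * M.
have C10 : 0 <= C1 by rewrite addr_ge0// mulr_ge0// ltW.
pose omega := eta / (2 * (C1 + 1)).
have om0 : 0 < omega by rewrite divr_gt0// mulr_gt0// ltr_wpDl.
have omC : omega * C1 <= eta / 2.
  rewrite /omega invfM [eta * _]mulrA -[leLHS]mulrA ler_piMr ?divr_ge0 ?(ltW eta0)//.
  by rewrite mulrC ler_pdivrMr ?mul1r ?lerDl// ltr_wpDl.
have [h h0 [hr Hh]] := shell_unif_continuous cv r10 vs om0.
(* Since [|w| <= k + w^2 / k], the increment term is at most
   [omega * (k * L + Cb * d / k)]; [k] and [d] make each part [eta * h / 4]. *)
pose k := eta * h / (4 * omega * (L + 1)).
have L10 : 0 < L + 1 by rewrite ltr_wpDl.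
have k0 : 0 < k.
  by apply: divr_gt0; apply: mulr_gt0 => //; exact: mulr_gt0.
pose d := eta * h * k / (4 * omega * (Cb + 1)).
have Cb10 : 0 < Cb + 1 by rewrite addr_gt0.
have d0 : 0 < d.
  by apply: divr_gt0; apply: mulr_gt0 => //; exact: mulr_gt0.
exists d => // w Ew Bw.
pose dw := partial w i.
have sw := C1c0_shell_continuous w; have sdw : shell_continuous dw by exact: partial_shell_continuous.
have norm_te t : 0 <= t <= h -> `|t *: e_ i| <= h.
  move=> /andP[t0 th]; rewrite normrZ ger0_norm//.
  rewrite (le_trans _ th)// ler_piMr//; apply: rV_norm_le => // j; rewrite mxE eqxx/=.
  by case: (_ == _); rewrite ?normr1 ?normr0.
pose I0 := \int[leb]_x (v x * dw x).
have svdw : shell_continuous (fun x => v x * dw x).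
  rewrite (_ : (fun x => _) = fun x => dw x * v x); last by apply/funext => x; rewrite mulrC.
  by apply: shell_continuousM => // x _; exact: cv.
have FEr (f : rV -> R) : leb.-integrable setT (EFin \o f) ->
    (\int[leb]_x (f x)%:E = (\int[leb]_x f x)%:E)%E.
  by move=> If; rewrite /Rintegral fineK//; exact: integrable_fin_num.
have idw := shell_continuous_integrable sdw.
have mv := continuous_measurable_rV cv.
have mdw := shell_continuous_measurable sdw.
have mw := shell_continuous_measurable sw.
have [Mv Mv0 HMv] : exists2 Mv, 0 < Mv & forall x, `|v x| <= Mv.
  by apply: shell_continuous_bounded; split => //; exists r1, r2.
(* Move the translation from one factor to the other. *)
have shiftE (f : rV -> R) (t : R) : shell_continuous f -> 0 <= t <= h ->
    leb.-integrable setT (EFin \o (fun x => v x * f (x + t *: e_ i))) /\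
    \int[leb]_x (v x * f (x + t *: e_ i)) = \int[leb]_x (v x * f x) +
      \int[leb]_x ((v (x + (- t) *: e_ i) - v x) * f x).
  move=> sf th.
  have tN : `|(- t) *: e_ i| <= r1 / 2.
    by rewrite scaleNr normrN (le_trans (norm_te _ th)).
  have [sD Ds] := shell_continuous_increment cv r10 tN vs.
  have svf : shell_continuous (fun x => v x * f x).
    rewrite (_ : (fun x => _) = fun x => f x * v x); last by apply/funext => x; rewrite mulrC.
    by apply: shell_continuousM => // x _; exact: cv.
  have sDf : shell_continuous (fun x => (v (x + (- t) *: e_ i) - v x) * f x).
    by apply: shell_continuousM => // x _; case: sf => + _; exact.
  have svtf : shell_continuous (fun x => v (x + (- t) *: e_ i) * f x).
    have := shell_continuousD svf sDf.
    by congr shell_continuous; apply/funext => x; ring.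
  have E : (fun x => v x * f (x + t *: e_ i)) =
      (fun x => (fun y => v (y + (- t) *: e_ i) * f y) (x + t *: e_ i)).
    by apply/funext => x; rewrite /= -addrA -scalerDl subrr scale0r addr0.
  split.
    by rewrite E; exact: (integrable_rV_shift (t *: e_ i) (shell_continuous_integrable svtf)).
  rewrite E {1}/Rintegral (@integral_rV_shift _ _ (t *: e_ i)
    (EFin \o (fun y => v (y + (- t) *: e_ i) * f y))); last first.
    by apply/measurable_EFinP; exact: shell_continuous_measurable.
  rewrite -/(Rintegral _ _ _) -RintegralD_shell//.
  by apply: eq_Rintegral => x _; ring.
have incr_le t (f g : rV -> R) (kk : R) : 0 <= t <= h -> shell_continuous f ->
    shell_continuous g -> (forall x, 0 <= g x) -> (forall x, K x -> `|f x| <= kk + g x) ->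
    `|\int[leb]_x ((v (x + (- t) *: e_ i) - v x) * f x)| <=
    omega * kk * L + omega * \int[leb]_x g x.
  move=> th sf sg g0 fg.
  have tN : `|(- t) *: e_ i| <= h by rewrite scaleNr normrN norm_te.
  apply: increment_pairing_le => //; first exact: ltW.
    exact: le_trans hr.
  by move=> x; exact: Hh.
pose J t := \int[leb]_x (v x * dw (x + t *: e_ i)).
have JI t : 0 <= t <= h -> `|J t - I0| <= omega * C1.
  move=> th; have [_ JE] := shiftE dw t sdw th.
  rewrite /J JE addrC addKr.
  have sden := shell_continuous_density ab w.
  have := incr_le t dw (fun x => Ca * D12_density a w x) 1 th sdw
    (shell_continuousZ Ca sden).
  rewrite RintegralZ_shell// -/(D12_energy a w) mulr1 -mulrDr => H.
  apply: (le_trans (H _ _)).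
  - by move=> x; rewrite mulr_ge0 ?(ltW Ca0)// (D12_density_ge0 ab).
  - move=> x Kx; apply: (le_trans (normr_le_1Dsqr _)); rewrite lerD2l /D12_density.
    have gw : dw x ^+ 2 <= enorm (grad w x) ^+ 2.
      rewrite sqr_enorm_grad (bigD1 i)//= lerDl.
      by apply: sumr_ge0 => j _; exact: sqr_ge0.
    apply: (le_trans gw); rewrite mulrCA; apply: ler_peMr; first exact: sqr_ge0.
    exact: HCa.
  by rewrite ler_wpM2l ?(ltW om0)// lerD2l ler_wpM2l// ltW.
have dwE y : is_derive y (e_ i) w (dw y) by rewrite /dw partialE; exact: C1c0_derive.
have [mI incE] := integral_increment h0 cv HMv dwE sdw.1 idw.
pose D : set (measurableTypeR R) := `[0, h]%classic.
have mD : measurable D by exact: measurable_itv.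
have lebD : leb1 D = h%:E by rewrite /D lebesgue_measure_itv/= lte_fin h0 oppr0 adde0.
have Dt t : D t -> 0 <= t <= h by rewrite /D/= in_itv.
have mJ : measurable_fun D J by apply: measurableT_comp mI.
have iD (f : R -> R) (c : R) : measurable_fun D f -> (forall t, D t -> `|f t| <= c) ->
    leb1.-integrable D (EFin \o f).
  move=> mf fc; apply: measurable_bounded_integrable => //.
    by rewrite [ltLHS]lebD ltry.
  exists c; split; first exact: num_real.
  by move=> c' cc' t; move=> /fc tc; exact: le_trans tc (ltW cc').
have JdefE t : J t = \int[leb]_x (v x * dw (x + t *: e_ i)) by [].
have I0E : I0 = \int[leb]_x (v x * dw x) by [].
clearbody J I0.
have iJ0 : leb1.-integrable D (EFin \o (fun t => J t - I0)).
  apply: (iD (fun t => J t - I0) (omega * C1)); first exact: measurable_funB.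
  by move=> t /Dt th; exact: JI.
have icst c : leb1.-integrable D (EFin \o cst c) by apply: (iD (cst c) `|c|).
have cstE c : \int[leb1]_(t in D) (cst c t) = c * h.
  transitivity (c * fine (leb1 D)); first exact: Rintegral_cst.
  by rewrite lebD.
have hh : 0 <= h <= h by rewrite (ltW h0) lexx.
have svw : shell_continuous (fun x => v x * w x).
  rewrite (_ : (fun x => _) = fun x => w x * v x); last by apply/funext => x; rewrite mulrC.
  by apply: (@shell_continuousM _ _ w v) => // x _; exact: cv.
pose W := \int[leb]_x ((v (x + (- h) *: e_ i) - v x) * w x).
have LW : W%:E = (\int[leb]_x (v x * (w (x + h *: e_ i)%R - w x))%:E)%E.
  have [iwh wE] := shiftE w h sw hh.
  under eq_integral do rewrite mulrBr EFinB.
  rewrite (integralB measurableT iwh (shell_continuous_integrable svw)).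
  by rewrite !FEr//=; [rewrite wE -EFinB addrC addKr|exact: shell_continuous_integrable].
have JE : (\int[leb1]_(t in D) (J t - I0)) = W - I0 * h.
  have iJ : leb1.-integrable D (EFin \o J).
    have := integrableD mD iJ0 (icst I0).
    apply: eq_integrable => // t _ /=.
    by rewrite -EFinD subrK.
  rewrite (RintegralB mD iJ (icst I0)) cstE; congr (_ - _).
  rewrite /Rintegral -[RHS]/(fine W%:E) LW incE; congr fine.
  apply: eq_integral => t; rewrite inE => /Dt th.
  by have [it _] := shiftE dw t sdw th; rewrite /= JdefE -FEr.
have JW : `|W - I0 * h| <= omega * C1 * h.
  rewrite -JE; apply: le_trans; first exact: (le_normr_Rintegral mD iJ0).
  rewrite -[leRHS]cstE.
  apply: le_Rintegral => //; first exact: integrable_norm.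
have Wle : `|W| <= omega * k * L + omega * (k^-1 * Cb * d).
  have sb := shell_continuous_weighted w (weight_b_cont ab).
  apply: (@le_trans _ _ (omega * k * L + omega * \int[leb]_x (k^-1 * Cb * (b x * w x ^+ 2)))).
    apply: incr_le => //; first exact: shell_continuousZ.
    - move=> x; have [->|x0] := eqVneq x 0; first by rewrite C1c0_at0 expr0n/= !mulr0.
      apply: mulr_ge0; first by rewrite mulr_ge0 ?invr_ge0 ?ltW.
      by rewrite mulr_ge0 ?sqr_ge0// ltW// (weight_b_gt0 ab).
    - move=> x Kx; have := normr_le_1Dsqr (w x / k).
      rewrite normrM normfV (ger0_norm (ltW k0)) ler_pdivrMr// mulrDl mul1r.
      move/le_trans; apply; rewrite lerD2l exprMn.
      have -> : w x ^+ 2 * k^-1 ^+ 2 * k = k^-1 * w x ^+ 2 by field; rewrite gt_eqF.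
      rewrite -[leRHS]mulrA; apply: ler_wpM2l; first by rewrite invr_ge0 ltW.
      by rewrite mulrA; apply: ler_peMl; [exact: sqr_ge0|exact: HCb].
  rewrite lerD2l RintegralZ_shell//; apply: ler_wpM2l; first exact: ltW.
  by apply: ler_wpM2l => //; rewrite mulr_ge0 ?invr_ge0 ?ltW.
have B1 : omega * k * L <= eta * h / 4.
  have -> : omega * k * L = eta * h / 4 * (L / (L + 1)) by rewrite /k; field; rewrite !gt_eqF.
  rewrite ler_piMr ?divr_ge0 ?mulr_ge0 ?(ltW eta0) ?(ltW h0)//.
  by rewrite ler_pdivrMr// mul1r lerDl.
have B2 : omega * (k^-1 * Cb * d) <= eta * h / 4.
  have -> : omega * (k^-1 * Cb * d) = eta * h / 4 * (Cb / (Cb + 1)).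
    by rewrite /d; field; rewrite !gt_eqF.
  rewrite ler_piMr ?divr_ge0 ?mulr_ge0 ?(ltW eta0) ?(ltW h0)//.
  by rewrite ler_pdivrMr// mul1r lerDl.
have B3 : omega * C1 * h <= eta / 2 * h by rewrite ler_wpM2r// ltW.
rewrite -/dw -I0E -(ler_pM2r h0).
have -> : `|I0| * h = `|I0 * h| by rewrite normrM (ger0_norm (ltW h0)).
have -> : I0 * h = W - (W - I0 * h) by rewrite opprB addrC subrK.
apply: le_trans (ler_normB _ _) _.
move: JW Wle B1 B2 B3; lra.
Qed.

End pairing.

Definition D12_pairing (u w : C1c0 R N) : R :=
  \int[leb]_x (\sum_i partial u i x * partial w i x * a x).

Let sterm (u w : C1c0 R N) i : shell_continuous (fun x => partial u i x * partial w i x * a x).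
Proof.
apply: shell_continuousM; last exact: weight_a_cont ab.
apply: shell_continuousM; first exact: partial_shell_continuous.
by move=> x _; case: (partial_shell_continuous w i) => + _; exact.
Qed.

(** Along functions of bounded energy, convergence to zero in the target space
    forces weak convergence to zero of the gradients. *)
Lemma D12_pairing_small (u : C1c0 R N) (M eta : R) : 0 <= M -> 0 < eta ->
  exists2 d, 0 < d & forall w : C1c0 R N, energy w <= M -> mass w <= d ->
    `|D12_pairing u w| <= eta.
Proof.
move=> M0 eta0; pose eta' := eta / (N%:R + 1).
have N10 : 0 < N%:R + 1 :> R by rewrite ltr_wpDl.
have eta'0 : 0 < eta' by rewrite divr_gt0.
have [d d0 Hd] : exists2 d, 0 < d & forall i, i \in enum 'I_N ->
    forall w : C1c0 R N, energy w <= M -> mass w <= d ->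
    `|\int[leb]_x (partial u i x * a x * partial w i x)| <= eta'.
  apply: (@seq_common_radius _ _ (fun i d => forall w : C1c0 R N, energy w <= M ->
    mass w <= d -> `|\int[leb]_x (partial u i x * a x * partial w i x)| <= eta')).
    move=> i; have sv : shell_continuous (fun x => partial u i x * a x).
      by apply: shell_continuousM; [exact: partial_shell_continuous|exact: weight_a_cont ab].
    case: sv => cv [r1 [r2 [r10 vs]]].
    exact: (derive_pairing_small cv r10 vs i M0 eta'0).
  by move=> i e e' e'e H w Ew Bw; apply: H => //; exact: le_trans e'e.
exists d => // w Ew Bw.
rewrite /D12_pairing Rintegral_sum_shell//.
apply: (le_trans (ler_norm_sum _ _ _)).
apply: (@le_trans _ _ (\sum_(i < N) eta')).
  apply: ler_sum => i _; rewrite (_ : Rintegral _ _ _ =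
      \int[leb]_x (partial u i x * a x * partial w i x)).
    by apply: Hd => //; rewrite mem_enum.
  by apply: eq_Rintegral => x _; ring.
rewrite sumr_const card_ord -mulr_natl /eta' mulrCA ler_piMr ?(ltW eta0)//.
by rewrite ler_pdivrMr// mul1r lerDl.
Qed.

Lemma partialB (u w : C1c0 R N) i x : partial (u - w) i x = partial u i x - partial w i x.
Proof.
rewrite !partialE; have [du _] := C1c0_derive u x (e_ i); have [dw _] := C1c0_derive w x (e_ i).
exact: deriveB.
Qed.

(** [|grad u|^2 <= |grad u - grad w|^2 + 2 grad u . grad w], integrated. *)
Lemma energy_le_pairing (u w : C1c0 R N) :
  energy u <= energy (u - w) + 2 * D12_pairing u w.
Proof.
have s1 := shell_continuous_density ab.
have s2 : shell_continuous (fun x => \sum_i partial u i x * partial w i x * a x).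
  exact: shell_continuous_sum.
rewrite /D12_energy /D12_pairing -RintegralZ_shell// -RintegralD_shell//; last first.
  exact: shell_continuousZ.
apply: le_Rintegral_shell => //.
  by apply: shell_continuousD => //; exact: shell_continuousZ.
move=> x; have [->|x0] := eqVneq x 0.
  by rewrite !(shell_continuous_at0 (s1 _)) (shell_continuous_at0 s2) mulr0 addr0.
rewrite /D12_density !sqr_enorm_grad -mulr_suml [2 * _]mulrA -mulrDl.
apply: ler_wpM2r; first by rewrite ltW// (weight_a_gt0 ab).
rewrite mulr_sumr -big_split/=; apply: ler_sum => i _; rewrite partialB -subr_ge0.
have -> : (partial u i x - partial w i x) ^+ 2 + 2 * (partial u i x * partial w i x) - partial u i x ^+ 2 =
  partial w i x ^+ 2 by ring.
exact: sqr_ge0.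
Qed.

End closability.

(** * Completeness of the target space *)

Section fast_cauchy.
Context {R : realType}.

Lemma pow2V_gt0 n : 0 < 2 ^- n :> R. Proof. by rewrite invr_gt0 exprn_gt0. Qed.

Lemma pow2VS n : 2 ^- n = 2 * 2 ^- n.+1 :> R.
Proof. by rewrite exprS invfM mulVKf// pnatr_eq0. Qed.

Lemma pow2V_le1 n : 2 ^- n <= 1 :> R.
Proof. by rewrite invf_le1 ?exprn_gt0// exprn_ege1// ler1n. Qed.

Lemma pow2V_small (e : R) : 0 < e -> exists n, forall m, (n <= m)%N -> 2 ^- m < e.
Proof.
move=> e0.
have [k _ ke] := near_infty_natSinv_lt (PosNum e0).
exists k => m km; apply: le_lt_trans (ke m km).
rewrite lef_pV2 ?posrE ?exprn_gt0// -natrX ler_nat.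
by rewrite ltn_expl.
Qed.

(** The bounds [u n - 2 c 2^-n] increase, the bounds [u n + 2 c 2^-n] decrease,
    and the supremum of the former lies between them. *)
Lemma fast_cauchy_lim (u : nat -> R) (c : R) : 0 <= c ->
  (forall n, `|u n.+1 - u n| <= c * 2 ^- n) ->
  exists l, forall n, `|l - u n| <= 2 * c * 2 ^- n.
Proof.
move=> c0 uc.
pose lo n := u n - 2 * c * 2 ^- n; pose hi n := u n + 2 * c * 2 ^- n.
have loS n : lo n <= lo n.+1.
  rewrite /lo; have := uc n; rewrite ler_norml => /andP[+ _].
  by rewrite [in 2 * c * 2 ^- n](pow2VS n) [in c * 2 ^- n](pow2VS n); lra.
have hiS n : hi n.+1 <= hi n.
  rewrite /hi; have := uc n; rewrite ler_norml => /andP[_].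
  by rewrite [in 2 * c * 2 ^- n](pow2VS n) [in c * 2 ^- n](pow2VS n); lra.
have lohi n : lo n <= hi n.
  have : 0 <= 2 * c * 2 ^- n by rewrite mulr_ge0 ?mulr_ge0// ltW// pow2V_gt0.
  rewrite /lo /hi; lra.
have lo_mono m n : (m <= n)%N -> lo m <= lo n.
  by move=> /subnK <-; elim: (n - m)%N => // k ih; exact: le_trans ih (loS _).
have hi_mono m n : (m <= n)%N -> hi n <= hi m.
  by move=> /subnK <-; elim: (n - m)%N => // k ih; exact: le_trans (hiS _) ih.
have cross m n : lo m <= hi n.
  have [mn|/ltnW nm] := leqP m n.
    exact: le_trans (lo_mono _ _ mn) (lohi _).
  exact: le_trans (lohi _) (hi_mono _ _ nm).
exists (sup (range lo)) => n; rewrite ler_distl; apply/andP; split.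
  apply: ub_le_sup; last by exists n.
  by exists (hi 0) => _ [m _ <-]; exact: cross.
apply: ge_sup; first by exists (lo 0); exists 0.
by move=> _ [m _ <-]; exact: cross.
Qed.

End fast_cauchy.

Section L2_complete.
Context {R : realType} {N : nat} (p beta : R).
Notation rV := 'rV[R]_N.
Notation leb := (@lebesgue_rV R N).
Notation w := (@L2_weight R N p beta).

Lemma L2_integrand_ge0 (f : rV -> R) x : 0 <= w x * f x ^+ 2.
Proof. by apply: mulr_ge0; [exact: L2_weight_ge0|exact: sqr_ge0]. Qed.

Lemma measurable_L2_integrand (f : rV -> R) : measurable_fun setT f ->
  measurable_fun setT (fun x => (w x * f x ^+ 2)%:E).
Proof.
move=> mf; apply/measurable_EFinP; apply: measurable_funM.
  exact: measurable_L2_weight.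
exact: measurable_funX.
Qed.

Lemma L2_predI (f : rV -> R) : measurable_fun setT f ->
  (\int[leb]_x (w x * f x ^+ 2)%:E < +oo)%E -> f \in @L2_pred R N p beta.
Proof.
move=> mf fin; apply: mem_set; split => //.
by rewrite /L2_enorm poweR_lty.
Qed.

Lemma poweR_half_sqr (I : \bar R) (r : R) : (0 <= I)%E -> (I `^ 2^-1 < +oo)%E ->
  r = fine (I `^ 2^-1) -> I = (r ^+ 2)%:E.
Proof.
move=> I0 Ifin ->.
have Iy : (I < +oo)%E by apply: lty_poweRy Ifin; rewrite invr_eq0 pnatr_eq0.
have If : I \is a fin_num by rewrite ge0_fin_numE.
rewrite -(fineK If) poweR_EFin /= powR12_sqrt ?fine_ge0//.
by rewrite sqr_sqrtr ?fine_ge0.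
Qed.

Lemma L2fun_measurable (f : L2fun N p beta) : measurable_fun setT f.
Proof. by case: f => g /= /set_mem[]. Qed.

Lemma L2_seminorm_sqr (f : L2fun N p beta) :
  (\int[leb]_x (w x * f x ^+ 2)%:E = ((L2_seminorm f) ^+ 2)%:E)%E.
Proof.
apply: poweR_half_sqr => //.
- by apply: integral_ge0 => x _; rewrite lee_fin L2_integrand_ge0.
- by case: f => g /= /set_mem[].
Qed.

Lemma L2fun_valB (f g : L2fun N p beta) x : (f - g) x = f x - g x.
Proof. by []. Qed.

Lemma L2fun_valD (f g : L2fun N p beta) x : (f + g) x = f x + g x.
Proof. by []. Qed.

(** Riesz-Fischer without exceptional sets: where the weighted series [S] of
    squared increments is finite and the weight is nonzero the sequence
    converges, and everywhere [w |g - f n|^2 <= 4 * 4^-n * S]. *)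
Lemma L2fun_complete (f : nat -> L2fun N p beta) :
  (forall n, L2_seminorm (f n.+1 - f n) <= 2 ^- n * 2 ^- n) ->
  exists g : L2fun N p beta, forall n, L2_seminorm (g - f n) <= 3 * 2 ^- n.
Proof.
move=> fc.
pose a n (x : rV) : R := (2 ^+ n) ^+ 2 * (w x * (f n.+1 x - f n x) ^+ 2).
have d0 n x : 0 <= w x * (f n.+1 x - f n x) ^+ 2.
  exact: (L2_integrand_ge0 (fun x => f n.+1 x - f n x)).
have a0 n x : 0 <= a n x by apply: mulr_ge0; [exact: sqr_ge0|exact: d0].
have ma n : measurable_fun setT (a n).
  apply: measurable_funM => //; apply/measurable_EFinP.
  apply: (@measurable_L2_integrand (fun x => f n.+1 x - f n x)).
  by apply: measurable_funB; exact: L2fun_measurable.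
pose S (x : rV) : \bar R := (\sum_(n <oo) (a n x)%:E)%E.
have S0 x : (0 <= S x)%E by apply: nneseries_ge0 => n _ _; rewrite lee_fin.
have mS : measurable_fun setT S.
  apply: ge0_emeasurable_sum => [n x _ _|n _]; first by rewrite lee_fin.
  exact/measurable_EFinP.
have intS : (\int[leb]_x S x <= 2%:E)%E.
  rewrite integral_nneseries//; last first.
  - by move=> n x _; rewrite lee_fin.
  - by move=> n; exact/measurable_EFinP.
  apply: (@le_trans _ _ (\sum_(n <oo) (2 / (2 ^ n.+1)%:R)%:E)%E); last first.
    exact: epsilon_trick0.
  apply: lee_nneseries => n _.
    by move=> _; apply: integral_ge0 => x _; rewrite lee_fin.
  under eq_integral do rewrite EFinM.
  have md : measurable_fun setT (fun x => (w x * (f n.+1 x - f n x) ^+ 2)%:E).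
    apply: (@measurable_L2_integrand (fun x => f n.+1 x - f n x)).
    by apply: measurable_funB; exact: L2fun_measurable.
  rewrite ge0_integralZl_EFin ?sqr_ge0//; last by move=> x _; rewrite lee_fin.

  rewrite (L2_seminorm_sqr (f n.+1 - f n)) -EFinM lee_fin -exprMn.
  have P0 := pow2V_gt0 (R := R) n; have P1 := pow2V_le1 (R := R) n.
  have -> : 2 / (2 ^ n.+1)%:R = 2 ^- n :> R by rewrite natrX (pow2VS n).
  have le1 : 2 ^+ n * L2_seminorm (f n.+1 - f n) <= 2 ^- n.
    have two0 : 2 ^+ n != 0 :> R by rewrite expf_neq0// pnatr_eq0.
    have E0 : 2 ^+ n * (2 ^- n * 2 ^- n) = 2 ^- n :> R by rewrite mulrA mulfV// mul1r.
    by rewrite -[leRHS]E0; apply: ler_wpM2l; [exact: exprn_ge0|exact: fc].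
  have ge0 : 0 <= 2 ^+ n * L2_seminorm (f n.+1 - f n).
    by rewrite mulr_ge0 ?exprn_ge0 ?L2_seminorm_ge0.
  apply: (@le_trans _ _ ((2 ^- n) ^+ 2)); first by rewrite ler_sqr ?nnegrE// ltW.
  by rewrite expr2 ler_piMl// ltW.
pose E := [set x | (S x < +oo)%E] `&` [set x | w x != 0].
have mE : measurable E.
  apply: measurableI.
    rewrite -[X in measurable X]setTI; exact: emeasurable_fun_infty_o.
  rewrite (_ : mkset _ = ~` (w @^-1` [set 0])).
    apply: measurableC; rewrite -[X in measurable X]setTI.
    exact: (@measurable_L2_weight R N p beta).
  by apply/seteqP; split => x /= /eqP.
have aS n x : ((a n x)%:E <= S x)%E.
  have := @nneseries_lim_ge R (fun n => (a n x)%:E) xpredT 0 n.+1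
    (fun k _ _ => (a0 k x : (0 <= (a k x)%:E)%E)).
  apply: le_trans; rewrite big_nat_recr//= leeDr// sume_ge0// => k _.
  by rewrite lee_fin.
have limE x : exists l : R, E x -> forall n,
    ((w x * (l - f n x) ^+ 2)%:E <= (4 * (2 ^- n) ^+ 2)%:E * S x)%E.
  have [[/= Sx wx]|nE] := pselect (E x); last by exists 0.
  have Sf : S x \is a fin_num by rewrite ge0_fin_numE.
  have w0 : 0 < w x by rewrite lt_def wx L2_weight_ge0.
  pose s := fine (S x) / w x.
  have s0 : 0 <= s by rewrite divr_ge0 ?fine_ge0// ltW.
  have inc n : `|f n.+1 x - f n x| <= Num.sqrt s * 2 ^- n.
    rewrite -ler_sqr ?nnegrE ?mulr_ge0 ?sqrtr_ge0 ?(ltW (pow2V_gt0 n))//.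
    rewrite real_normK ?num_real// exprMn sqr_sqrtr// /s.
    rewrite mulrAC ler_pdivlMr// exprVn ler_pdivlMr ?exprn_gt0//.
    have := aS n x; rewrite -(fineK Sf) lee_fin /a; apply: le_trans.
    by rewrite le_eqVlt; apply/orP; left; apply/eqP; ring.
  have [l Hl] := fast_cauchy_lim (sqrtr_ge0 s) inc.
  exists l => _ n; rewrite -(fineK Sf) -EFinM lee_fin.
  have H : (l - f n x) ^+ 2 <= 2 ^+ 2 * s * (2 ^- n) ^+ 2.
    have c0 : 0 <= 2 * Num.sqrt s * 2 ^- n.
      apply: mulr_ge0; last exact: ltW (pow2V_gt0 n).
      by apply: mulr_ge0 => //; exact: sqrtr_ge0.
    have : `|l - f n x| ^+ 2 <= (2 * Num.sqrt s * 2 ^- n) ^+ 2.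
      by rewrite ler_sqr ?nnegrE.
    by rewrite real_normK ?num_real// 2!exprMn sqr_sqrtr.
  rewrite (le_trans (ler_wpM2l (ltW w0) H))// /s le_eqVlt; apply/orP; left; apply/eqP.
  by field; rewrite gt_eqF.
have [l Hl] := choice limE.
pose g (x : rV) : R := l x * \1_E x.
have gS n x : ((w x * (g x - f n x * \1_E x) ^+ 2)%:E <= (4 * (2 ^- n) ^+ 2)%:E * S x)%E.
  rewrite /g indicE; case: (boolP (x \in E)) => [|_].
    by rewrite inE !mulr1 => Ex; exact: Hl.
  by rewrite !mulr0 subrr expr0n mulr0 mule_ge0// lee_fin mulr_ge0// sqr_ge0.
have gS' n x : ((w x * (g x - f n x) ^+ 2)%:E <= (4 * (2 ^- n) ^+ 2)%:E * S x)%E.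
  have c0 : 0 < 4 * (2 ^- n) ^+ 2 :> R by rewrite mulr_gt0// exprn_gt0// pow2V_gt0.
  have [Ex|nE] := pselect (E x).
    by have := gS n x; rewrite indicE mem_set// mulr1.
  have [Sx|] := boolP (S x < +oo)%E; last first.
    rewrite -leNgt leye_eq => /eqP ->.
    by rewrite gt0_muley ?lte_fin// leey.
  have -> : w x = 0.
    by apply/eqP; apply/negPn/negP => wx; apply: nE.
  by rewrite mul0r mule_ge0// lee_fin ltW.
have mg : measurable_fun setT g.
  apply: (@measurable_fun_cvg _ _ _ setT (fun n x => f n x * \1_E x)).
    move=> n; apply: measurable_funM; first exact: L2fun_measurable.
    exact: measurable_indic.
  move=> x _; have [Ex|nE] := pselect (E x); last first.
    rewrite /g indicE memNset// mulr0.
    under eq_fun do rewrite mulr0; exact: cvg_cst.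
  have [Sx /= wx] := Ex.
  have w0 : 0 < w x by rewrite lt_def wx L2_weight_ge0.
  have Sf : S x \is a fin_num by rewrite ge0_fin_numE.
  pose c := Num.sqrt (4 * fine (S x) / w x) + 1.
  have q0 : 0 <= 4 * fine (S x) / w x.
    by apply: divr_ge0; [rewrite mulr_ge0// fine_ge0|exact: ltW].
  have c0 : 0 < c by rewrite ltr_wpDl// sqrtr_ge0.
  have dist n : `|g x - f n x * \1_E x| <= c * 2 ^- n.
    apply: (@le_trans _ _ (Num.sqrt (4 * fine (S x) / w x) * 2 ^- n)); last first.
      by rewrite ler_wpM2r ?(ltW (pow2V_gt0 n))// lerDl.
    rewrite -ler_sqr ?nnegrE ?mulr_ge0 ?sqrtr_ge0 ?(ltW (pow2V_gt0 n))//.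
    rewrite real_normK ?num_real// exprMn sqr_sqrtr// mulrAC ler_pdivlMr// mulrC.
    have := gS n x; rewrite -(fineK Sf) -EFinM lee_fin => /le_trans; apply.
    by rewrite le_eqVlt; apply/orP; left; apply/eqP; ring.
  apply/cvgrPdist_le => e e0.
  have [n Hn] := pow2V_small (divr_gt0 e0 c0).
  exists n => // m /= nm; apply: (le_trans (dist m)).
  by rewrite mulrC -ler_pdivlMr// ltW// Hn.
have gf n : (\int[leb]_x (w x * (g x - f n x) ^+ 2)%:E <= (9 * (2 ^- n) ^+ 2)%:E)%E.
  have c0 : 0 <= (2 ^- n) ^+ 2 :> R by exact: sqr_ge0.
  apply: (@le_trans _ _ (\int[leb]_x ((4 * (2 ^- n) ^+ 2)%:E * S x)%E)%E).
    apply: ge0_le_integral => //.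
    - by move=> x _; rewrite lee_fin (L2_integrand_ge0 (fun x => g x - f n x)).
    - apply: (@measurable_L2_integrand (fun x => g x - f n x)).
      by apply: measurable_funB => //; exact: L2fun_measurable.
    - exact: measurable_funeM.
  have c40 : 0 <= 4 * (2 ^- n) ^+ 2 :> R by rewrite mulr_ge0.
  rewrite ge0_integralZl_EFin//.
  apply: (@le_trans _ _ ((4 * (2 ^- n) ^+ 2)%:E * 2%:E)%E).
    by apply: lee_wpmul2l => //; rewrite lee_fin mulr_ge0.
  rewrite -EFinM lee_fin; lra.
have g0 : (fun x => g x - f 0%N x) \in @L2_pred R N p beta.
  apply: L2_predI.
    by apply: measurable_funB => //; exact: L2fun_measurable.
  by apply: le_lt_trans (gf 0%N) _; rewrite ltry.
pose G : L2fun N p beta := MkL2fun g0 + f 0%N.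
exists G => n.
have := L2_seminorm_sqr (G - f n).
under eq_integral => x _ do rewrite L2fun_valB L2fun_valD /= subrK.
move=> E1; have := gf n; rewrite E1 lee_fin => H.
rewrite -ler_sqr ?nnegrE ?L2_seminorm_ge0 ?mulr_ge0 ?(ltW (pow2V_gt0 n))//.
rewrite (le_trans H)// exprMn (_ : 3 ^+ 2 = 9) //; ring.
Qed.

Lemma L2_norm_classE (f : L2fun N p beta) : `|L2_class f| = L2_seminorm f.
Proof. exact: L2_norm_class. Qed.

Lemma L2_fast_complete (f : nat -> L2 N p beta) :
  (forall n, `|f n.+1 - f n| <= 2 ^- n * 2 ^- n) ->
  exists g : L2 N p beta, forall n, `|g - f n| <= 3 * 2 ^- n.
Proof.
move=> fc; pose F n := sval (L2_class_surj (f n)).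
have FE n : L2_class (F n) = f n by rewrite /F; case: L2_class_surj.
have [n|g Hg] := @L2fun_complete F.
  by have := fc n; rewrite -!FE -raddfB L2_norm_classE.
by exists (L2_class g) => n; rewrite -FE -raddfB L2_norm_classE.
Qed.

End L2_complete.

(** * The embedding *)

Section precompactness.
Context {R : realType} (V : normedModType R).
Hypothesis complete : forall f : nat -> V,
  (forall n, `|f n.+1 - f n| <= 2 ^- n * 2 ^- n) ->
  exists g : V, forall n, `|g - f n| <= 3 * 2 ^- n.

(** An ultrafilter on a totally bounded set contains arbitrarily small balls,
    hence converges by completeness. *)
Lemma precompact_small_parts (S : set V) :
  (forall e, 0 < e -> exists (Phi : finType) (P : Phi -> set V),
     S `<=` \bigcup_phi P phi /\ forall phi x y, P phi x -> P phi y -> `|x - y| <= e) ->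
  precompact S.
Proof.
move=> small; rewrite precompactE compact_ultra => F FU FS.
have PF : ProperFilter F := ultra_proper.
have balls e : 0 < e -> exists x, F [set y | `|x - y| <= e].
  move=> e0; have e30 : 0 < e / 3 by rewrite divr_gt0.
  have [Phi [P [SP Psmall]]] := small _ e30.
  pose Q phi := [set y | exists2 z, P phi z & `|z - y| <= e / 3].
  have [phi FQ] : exists phi, F (Q phi).
    apply: contrapT => nQ.
    have FC phi : F (~` Q phi).
      have [FQ|//] := in_ultra_setVsetC (Q phi) FU.
      by exfalso; apply: nQ; exists phi.
    have Fall : F [set y | forall phi, (~` Q phi) y].
      by apply: filter_forall.
    have [y [Sy nQy]] := filter_ex (filterI FS Fall).
    have [z [Sz /= zy]] := Sy _ (nbhsx_ballx y _ e30).
    have [phi _ Pz] := SP _ Sz; apply: (nQy phi); exists z => //.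
    by move: zy; rewrite -ball_normE/= distrC => /ltW.
  have [x [z Pz zx]] := filter_ex FQ.
  exists x; apply: filterS FQ => y [t Pt ty] /=.
  have -> : x - y = (x - z) + (z - t) + (t - y).
    by rewrite !subrKA.
  rewrite (le_trans (ler_normD _ _))// [leRHS](_ : _ = e / 3 + e / 3 + e / 3); last by field.
  rewrite lerD//; rewrite (le_trans (ler_normD _ _))// lerD//; first by rewrite distrC.
  exact: Psmall Pz Pt.
have r0 n : 0 < 2 ^- n * 2 ^- n / 2 :> R by rewrite divr_gt0// mulr_gt0// pow2V_gt0.
have [x Hx] := choice (fun n => balls _ (r0 n)).
have rS n : 2 ^- n.+1 * 2 ^- n.+1 / 2 <= 2 ^- n * 2 ^- n / 2 :> R.
  rewrite ler_wpM2r// ler_pM ?(ltW (pow2V_gt0 _))// [leRHS](pow2VS n).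
    by rewrite ler_peMl ?ler1n// ltW// pow2V_gt0.
  by rewrite ler_peMl ?ler1n// ltW// pow2V_gt0.
have [n|g Hg] := complete (f := x).
  have [y [/= y1 y2]] := filter_ex (filterI (Hx n.+1) (Hx n)).
  rewrite -[x n.+1](subrK y) -addrA (le_trans (ler_normD _ _))//.
  rewrite [leRHS]splitr lerD//; last by rewrite distrC.
  exact: le_trans (rS n).
have Fg : F --> g.
  apply/cvg_ballP => e e0; have e20 : 0 < e / 4 by rewrite divr_gt0.
  have [n Hn] := pow2V_small e20.
  apply: filterS (Hx n) => y /= xy; rewrite -ball_normE/=.
  rewrite -[g](subrK (x n)) -addrA (le_lt_trans (ler_normD _ _))//.
  have h1 := Hn n (leqnn n); have h2 := Hg n.
  have h3 : `|x n - y| <= 2 ^- n / 2.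
    apply: le_trans xy _; rewrite ler_wpM2r// ler_piMl ?pow2V_le1//.
  have h4 := pow2V_gt0 (R := R) n.
  by move: h1 h2 h3 h4; set t := 2 ^- n; lra.
exists g; split => //.
have /closure_id -> : closed (closure S) by exact: closed_closure.
move=> U Ug; have FUg : F U by exact: Fg.
exact: filter_ex (filterI FS FUg).
Qed.

End precompactness.

Section embedding.
Context {R : realType} {N : nat} (p beta : R).
Notation rV := 'rV[R]_N.
Notation leb := (@lebesgue_rV R N).
Variable (a : rV -> R).
Hypothesis ab : admissible_weights a (L2_weight p beta).
Hypothesis integrandE : forall (u : C1c0 R N) (x : rV),
  enorm (grad (U p beta) x) `^ (p - 2) * enorm (grad u x) ^+ 2 =
  enorm (grad u x) ^+ 2 * a x.
Variables (D : completeNormedModType R) (j : {linear C1c0 R N -> D}).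
Hypothesis hD : is_completion (fun u : C1c0 R N => D12_enorm p beta u) j.
Notation energy := (D12_energy a).
Notation mass := (L2_mass (@L2_weight R N p beta)).
Notation L2b := (L2 N p beta).

Lemma sqr_norm_j (u : C1c0 R N) : `|j u| ^+ 2 = energy u.
Proof.
have ju : `|j u|%:E = D12_enorm p beta u by exact: hD.1.
pose I := (\int[leb]_x (enorm (grad (U p beta) x) `^ (p - 2) * enorm (grad u x) ^+ 2)%:E)%E.
have IE : I = (energy u)%:E.
  rewrite /D12_energy -EFin_Rintegral_shell; last exact: (shell_continuous_density ab).
  by apply: eq_integral => x _; rewrite integrandE.
have : I = (`|j u| ^+ 2)%:E.
  apply: poweR_half_sqr.
  - by rewrite IE lee_fin (D12_energy_ge0 ab).
  - by rewrite -[ltLHS]ju ltry.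
  - by rewrite -[X in fine X]ju.
by rewrite IE => -[].
Qed.

Lemma C1c0_L2_pred (u : C1c0 R N) : (u : rV -> R) \in @L2_pred R N p beta.
Proof.
apply: L2_predI.
  by apply: continuous_measurable_rV; exact: C1c0_continuous.
rewrite EFin_Rintegral_shell ?ltry//.
by apply: shell_continuous_weighted; exact: weight_b_cont ab.
Qed.

Definition C1c0_L2fun (u : C1c0 R N) : L2fun N p beta := MkL2fun (C1c0_L2_pred u).

Definition emb (u : C1c0 R N) : L2b := L2_class (C1c0_L2fun u).

Lemma emb_linear : linear emb.
Proof.
move=> c u v; rewrite /emb -linearZ -raddfD; congr L2_class.
exact: val_inj.
Qed.

HB.instance Definition _ := GRing.isLinear.Build R (C1c0 R N) L2b _ emb emb_linear.

Lemma sqr_norm_emb (u : C1c0 R N) : `|emb u| ^+ 2 = mass u.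
Proof.
rewrite /emb L2_norm_classE; apply: EFin_inj.
rewrite -L2_seminorm_sqr EFin_Rintegral_shell//.
by apply: shell_continuous_weighted; exact: weight_b_cont ab.
Qed.

Lemma emb_bounded : exists2 C, 0 < C & forall u, `|emb u| <= C * `|j u|.
Proof.
have [C C0 HC] := L2_mass_le_energy ab.
exists (Num.sqrt C); first by rewrite sqrtr_gt0.
move=> u; rewrite -ler_sqr ?nnegrE ?mulr_ge0 ?sqrtr_ge0//.
by rewrite exprMn sqr_sqrtr ?(ltW C0)// sqr_norm_emb sqr_norm_j.
Qed.

Definition graph_closure (d : D) (y : L2b) :=
  forall e, 0 < e -> exists u, `|j u - d| < e /\ `|emb u - y| < e.

Lemma graph_closure_j u : graph_closure (j u) (emb u).
Proof. by move=> e e0; exists u; rewrite !subrr !normr0. Qed.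

Lemma graph_closure_linear c d y d' y' : graph_closure d y -> graph_closure d' y' ->
  graph_closure (c *: d + d') (c *: y + y').
Proof.
move=> G G' e e0; have c0 : 0 < `|c| + 1 by rewrite ltr_wpDl.
have e'0 : 0 < e / (2 * (`|c| + 1)) by rewrite divr_gt0// mulr_gt0.
have [u [ju iu]] := G _ e'0; have [u' [ju' iu']] := G' _ e'0.
have K (V : normedModType R) (s s' t t' : V) :
    `|s - t| < e / (2 * (`|c| + 1)) -> `|s' - t'| < e / (2 * (`|c| + 1)) ->
    `|c *: s + s' - (c *: t + t')| < e.
  move=> st st'.
  rewrite opprD addrACA -scalerBr (le_lt_trans (ler_normD _ _))// normrZ.
  have -> : e = (`|c| + 1) * (e / (2 * (`|c| + 1))) + (`|c| + 1) * (e / (2 * (`|c| + 1))).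
    by field; rewrite gt_eqF.
  apply: ltr_leD; last first.
    by rewrite (le_trans (ltW st'))// ler_peMl ?(ltW e'0)// lerDr.
  apply: (@le_lt_trans _ _ (`|c| * (e / (2 * (`|c| + 1))))).
    by rewrite ler_wpM2l// ltW.
  by rewrite ltr_pM2r// ltrDl.
exists (c *: u + u'); rewrite (linearP j) (emb_linear c u u'); split; exact: K.
Qed.

Lemma graph_closure_bound C d y : 0 < C -> (forall u, `|emb u| <= C * `|j u|) ->
  graph_closure d y -> `|y| <= C * `|d|.
Proof.
move=> C0 HC G; apply/ler_addgt0Pr => e e0.
have C10 : 0 < C + 1 by rewrite addr_gt0.
have e'0 : 0 < e / (C + 1) by rewrite divr_gt0.
have [u [ju iu]] := G _ e'0.
have -> : y = emb u - (emb u - y) by rewrite opprB addrC subrK.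
rewrite (le_trans (ler_normB _ _))//.
have -> : C * `|d| + e = C * (`|d| + e / (C + 1)) + e / (C + 1).
  by field; rewrite gt_eqF.
rewrite lerD// ?(ltW iu)// (le_trans (HC u))// ler_wpM2l ?(ltW C0)//.
rewrite -[j u](subrK d) addrC (le_trans (ler_normD _ _))// lerD2l//.
exact: ltW.
Qed.

Lemma graph_closure_ex d : exists y, graph_closure d y.
Proof.
have [C C0 HC] := emb_bounded.
have C20 : 0 < 2 * C + 1 by rewrite addr_gt0// mulr_gt0.
pose r n : R := 2 ^- n * 2 ^- n / (2 * C + 1).
have r0 n : 0 < r n by rewrite divr_gt0// mulr_gt0// pow2V_gt0.
have rS n : r n.+1 <= r n.
  rewrite ler_wpM2r ?invr_ge0 ?(ltW C20)//.
  rewrite ler_pM ?(ltW (pow2V_gt0 _))// [leRHS](pow2VS n).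
    by rewrite ler_peMl ?ler1n// ltW// pow2V_gt0.
  by rewrite ler_peMl ?ler1n// ltW// pow2V_gt0.
have H n : exists u, `|j u - d| < r n.
  have := hD.2 (ball d (r n)); case.
  - by exists d; exact: ballxx.
  - exact: ball_open.
  - move=> x [dx [u _ jux]]; exists u; rewrite jux.
    by move: dx; rewrite -ball_normE/= distrC.
have [u Hu] := choice H.
have [n|y Hy] := @L2_fast_complete R N p beta (fun n => emb (u n)).
  rewrite -linearB (le_trans (HC _))//= linearB.
  rewrite -[j (u n.+1)](subrK d) -addrA.
  have := Hu n; rewrite distrC => h1; have h2 := Hu n.+1; have h3 := rS n.
  apply: (@le_trans _ _ (C * (r n + r n))).
    rewrite ler_wpM2l ?(ltW C0)// (le_trans (ler_normD _ _))// lerD//.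
      by rewrite (le_trans (ltW h2)).
    exact: ltW.
  have -> : C * (r n + r n) = 2 ^- n * 2 ^- n * (2 * C / (2 * C + 1)).
    by rewrite /r; move: (2 ^- n * 2 ^- n) => t; field; rewrite gt_eqF.
  rewrite ler_piMr ?mulr_ge0 ?(ltW (pow2V_gt0 _))//.
  by rewrite ler_pdivrMr// mul1r lerDl.
exists y => e e0; have e40 : 0 < e / 4 by rewrite divr_gt0.
have [n Hn] := pow2V_small e40.
have h1 := Hn n (leqnn n); have h4 := pow2V_gt0 (R := R) n.
exists (u n); split.
  apply: (lt_trans (Hu n)); apply: (@le_lt_trans _ _ (2 ^- n)); last first.
    by move: h1 h4; set t := 2 ^- n; lra.
  rewrite /r -mulrA ler_piMr ?(ltW h4)// ler_pdivrMr// mul1r.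
  by rewrite (le_trans (pow2V_le1 n))// lerDr mulr_ge0// ltW.
rewrite distrC (le_lt_trans (Hy n))//.
by move: h1 h4; set t := 2 ^- n; lra.
Qed.

(** Let [u], then [w], be approximations of [d] with [emb w] much smaller than
    the precision of [u]: in [|j u|^2 <= |j (u - w)|^2 + 2 <u, w>] both terms are
    small, the second one by closability. *)
Lemma graph_closure_injective d : graph_closure d 0 -> d = 0.
Proof.
move=> G; apply/eqP; rewrite -normr_le0; apply/ler_addgt0Pr => e e0; rewrite add0r.
have fin (t' : R) : t' <= e / 4 -> t' + 3 * t' <= e by lra.
pose s := Num.min (e / 4) 1.
have s0 : 0 < s by rewrite lt_min ltr01 divr_gt0.
have se : s <= e / 4 by rewrite ge_min lexx.
have s1 : s <= 1 by rewrite ge_min lexx orbT.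
have [u [ju _]] := G _ s0.
pose M := (`|d| + 1) ^+ 2.
(* [w] is chosen after [u]: its precision [r] depends on [u] through [t]. *)
have [t t0 Ht] := D12_pairing_small ab u (sqr_ge0 _ : 0 <= M) (exprn_gt0 2 s0).
pose r := Num.min s (Num.min t 1).
have r0 : 0 < r by rewrite lt_min s0 lt_min t0 ltr01.
have rs : r <= s by rewrite ge_min lexx.
have rt : r <= t by rewrite !ge_min lexx orbT.
have r1 : r <= 1 by rewrite !ge_min lexx !orbT.
have [w [jw]] := G _ r0; rewrite subr0 => iw.
have Ew : energy w <= M.
  rewrite -sqr_norm_j /M ler_sqr ?nnegrE ?addr_ge0//.
  rewrite -[j w](subrK d) addrC (le_trans (ler_normD _ _))// lerD2l.
  by rewrite (le_trans (ltW jw)).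
have mw : mass w <= t.
  rewrite -sqr_norm_emb (le_trans _ rt)// (@le_trans _ _ (r ^+ 2))//.
    by rewrite ler_sqr ?nnegrE ?(ltW r0)// ltW.
  by rewrite expr2 ler_piMl// ltW.
have P := Ht w Ew mw.
have juw : `|j (u - w)| <= 2 * s.
  rewrite linearB/= (_ : j u - j w = (j u - d) - (j w - d)); last first.
    by rewrite opprB addrA subrK.
  rewrite (le_trans (ler_normB _ _))// mulr2n mulrDl mul1r lerD//; first exact: ltW.
  by rewrite (le_trans (ltW jw)).
have Eu : energy u <= (3 * s) ^+ 2.
  apply: (le_trans (energy_le_pairing ab u w)).
  rewrite -sqr_norm_j.
  have : `|j (u - w)| ^+ 2 <= (2 * s) ^+ 2.
    by rewrite ler_sqr ?nnegrE// mulr_ge0// ltW.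
  move: P; rewrite ler_norml => /andP[_].
  rewrite !exprMn; have := sqr_ge0 s; move: (s ^+ 2) (D12_pairing _ _ _) (`|_| ^+ 2) => s2 P E.
  rewrite (_ : 2 ^+ 2 = 4); last by ring.
  rewrite (_ : 3 ^+ 2 = 9); last by ring.
  lra.
have ju3 : `|j u| <= 3 * s.
  by rewrite -ler_sqr ?nnegrE ?mulr_ge0 ?(ltW s0)// sqr_norm_j.
rewrite -[d](subrK (j u)) (le_trans (ler_normD _ _))//.
by rewrite (le_trans _ (fin _ se))// lerD// distrC ltW.
Qed.

(** Rellich's estimate controls the mass by finitely many bounded linear
    functionals; rounding their values splits a ball of [D] into finitely many
    parts that are small in the target space. *)
Lemma emb_small_parts (M e : R) : 0 <= M -> 0 < e ->
  exists (Phi : finType) (code : C1c0 R N -> Phi), forall u v,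
    `|j u| <= M -> `|j v| <= M -> code u = code v -> `|emb u - emb v| <= e.
Proof.
move=> M0 e0; pose eps := e ^+ 2 / 2 / (4 * (M ^+ 2 + 1)).
have M20 : 0 <= M ^+ 2 by exact: sqr_ge0.
have M210 : 0 < M ^+ 2 + 1 by rewrite ltr_wpDl.
have e20 : 0 < e ^+ 2 by rewrite exprn_gt0.
have eps0 : 0 < eps by rewrite !divr_gt0// mulr_gt0.
have [h [cs [K [h0 K0 HK [C HC]]]]] := rellich ab eps0.
pose m := size cs.
pose eta := Num.min 1 (e ^+ 2 / 2 / (K * m%:R + 1)).
have Km0 : 0 <= K * m%:R by rewrite mulr_ge0.
have Km1 : 0 < K * m%:R + 1 by rewrite ltr_wpDl.
have eta0 : 0 < eta by rewrite lt_min ltr01 !divr_gt0.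
have eta1 : eta <= 1 by rewrite ge_min lexx.
have etaK : eta <= e ^+ 2 / 2 / (K * m%:R + 1) by rewrite ge_min lexx orbT.
pose B := `|C| * (1 + M ^+ 2).
have B0 : 0 <= B by rewrite mulr_ge0// addr_ge0.
pose k (u : C1c0 R N) (i : 'I_m) : nat :=
  Num.truncn ((cube_int (nth 0 cs i) h u + B) / eta).
pose K1 := Num.truncn (2 * B / eta).
pose code u : {ffun 'I_m -> 'I_K1.+1} := [ffun i => inord (k u i)].
have kB (u : C1c0 R N) (i : 'I_m) : `|j u| <= M -> 0 <= (cube_int (nth 0 cs i) h u + B) / eta /\ (k u i <= K1)%N.
  move=> uM; have Eu : energy u <= M ^+ 2 by rewrite -sqr_norm_j ler_sqr ?nnegrE.
  have E0 := D12_energy_ge0 ab u.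
  have : `|cube_int (nth 0 cs i) h u| <= B.
    apply: (le_trans (HC u _ (mem_nth 0 (ltn_ord i)))).
    apply: (le_trans (ler_norm _)); rewrite normrM /B ler_wpM2l//.
    by rewrite ger0_norm ?addr_ge0// lerD2l.
  rewrite ler_norml => /andP[lo hi].
  have q0 : 0 <= (cube_int (nth 0 cs i) h u + B) / eta.
    by rewrite divr_ge0 ?(ltW eta0)// -lerBlDr sub0r.
  split => //; rewrite /k /K1 -ltnS -(ltr_nat R).
  apply: (@le_lt_trans _ _ (2 * B / eta)); last first.
    have B20 : 0 <= 2 * B / eta by rewrite divr_ge0 ?(ltW eta0)// mulr_ge0.
    by have /andP[] := truncn_itv B20.
  have /andP[+ _] := truncn_itv q0; move/le_trans; apply.
  by rewrite ler_wpM2r ?invr_ge0 ?(ltW eta0)// mulr2n mulrDl mul1r lerD2r.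
exists {ffun 'I_m -> 'I_K1.+1}, code => u v uM vM cuv.
rewrite -linearB/= -ler_sqr ?nnegrE ?(ltW e0)// sqr_norm_emb.
apply: (le_trans (HK (u - v))).
have Euv : energy (u - v) <= 4 * M ^+ 2.
  rewrite -sqr_norm_j (_ : 4 * M ^+ 2 = (2 * M) ^+ 2); last by ring.
  rewrite ler_sqr ?nnegrE ?mulr_ge0// linearB (le_trans (ler_normB _ _))//.
  by rewrite mulr2n mulrDl mul1r lerD.
have cubeB c : cube_int c h (u - v : C1c0 R N) = cube_int c h u - cube_int c h v.
  have ic (w : C1c0 R N) : leb.-integrable (cube c h) (EFin \o (w : rV -> R)).
    apply: integrable_cube; first exact: C1c0_continuous.
    have [Mw _ HMw] := shell_continuous_bounded (C1c0_shell_continuous w).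
    by exists Mw.
  exact: (RintegralB (measurable_cube c h) (ic u) (ic v)).
have lin i : (i < m)%N -> cube_int (nth 0 cs i) h (u - v : C1c0 R N) ^+ 2 <= eta.
  move=> im; pose i' := Ordinal im.
  have [qu ku] := kB u i' uM; have [qv kv] := kB v i' vM.
  have kk : k u i' = k v i'.
    have := congr1 (fun f : {ffun _ -> _} => val (f i')) cuv.
    by rewrite !ffunE /= !inordK.
  have /andP[u1 u2] := truncn_itv qu; have /andP[v1 v2] := truncn_itv qv.
  rewrite -/(k u i') in u1 u2; rewrite -/(k v i') -kk in v1 v2.
  rewrite cubeB; set x := cube_int _ h u in qu u1 u2 *; set y := cube_int _ h v in qv v1 v2 *.
  rewrite -natr1 in u2 v2.
  have xy : `|(x - y) / eta| <= 1.
    have -> : (x - y) / eta = (x + B) / eta - (y + B) / eta by rewrite -mulrBl; congr (_ / _); ring.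
    rewrite ler_norml; apply/andP; split; lra.
  rewrite normrM normfV (ger0_norm (ltW eta0)) ler_pdivrMr// mul1r in xy.
  rewrite -real_normK ?num_real// expr2 (le_trans (ler_pM _ _ xy xy))//.
  by rewrite ler_piMl// ltW.
have S1 : \sum_(c <- cs) cube_int c h (u - v : C1c0 R N) ^+ 2 <= m%:R * eta.
  rewrite (big_nth 0) big_mkord mulr_natl -[X in _ *+ X]card_ord -sumr_const.
  by apply: ler_sum => i _; exact: lin.
have P1 : eps * energy (u - v) <= e ^+ 2 / 2.
  apply: (@le_trans _ _ (eps * (4 * M ^+ 2))); first by rewrite ler_wpM2l// ltW.
  have -> : eps * (4 * M ^+ 2) = e ^+ 2 / 2 * (M ^+ 2 / (M ^+ 2 + 1)).
    by rewrite /eps; field; rewrite gt_eqF.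
  by rewrite ler_piMr ?divr_ge0 ?(ltW e20)// ler_pdivrMr// mul1r lerDl.
have P2 : K * \sum_(c <- cs) cube_int c h (u - v : C1c0 R N) ^+ 2 <= e ^+ 2 / 2.
  apply: (le_trans (ler_wpM2l K0 S1)); rewrite mulrA.
  apply: (le_trans (ler_wpM2l Km0 etaK)).
  by rewrite mulrCA ler_piMr ?divr_ge0 ?(ltW e20)// ler_pdivrMr// mul1r lerDl.
by rewrite [leRHS]splitr lerD.
Qed.

(** The closure of the graph of [emb] is the graph of a function, by
    completeness for existence and Hardy's inequality for uniqueness. *)
Lemma compact_extension : exists T : {linear D -> L2b},
  (forall u, T (j u) = emb u) /\ compact_embedding T.
Proof.
have [C C0 HC] := emb_bounded.
have gc_uniq d y y' : graph_closure d y -> graph_closure d y' -> y = y'.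
  move=> G G'; have := graph_closure_bound C0 HC (graph_closure_linear (-1) G G').
  rewrite !scaleN1r addNr normr0 mulr0 normr_le0 addrC subr_eq0 => /eqP.
  exact: esym.
have [T0 HT] := choice graph_closure_ex.
have T0_linear : linear T0.
  by move=> c x y; apply: gc_uniq (HT _) _; exact: graph_closure_linear.
pose T : {linear D -> L2b} := HB.pack T0 (GRing.isLinear.Build R D L2b _ T0 T0_linear).
have Tj u : T (j u) = emb u by exact: gc_uniq (HT _) (graph_closure_j u).
exists T; split => //; split.
- move=> x y Txy; apply/eqP; rewrite -subr_eq0; apply/eqP.
  apply: graph_closure_injective.
  have Txy0 : T (x - y) = 0 by rewrite linearB Txy subrr.
  by have := HT (x - y); rewrite [T0 _]Txy0.
- apply: bounded_linear_continuous; apply/linear_boundedP.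
  exists C; split; first exact: num_real.
  move=> r Cr d; apply: (le_trans (graph_closure_bound C0 HC (HT d))).
  by rewrite ler_wpM2r// ltW.
move=> A bA; apply: precompact_small_parts.
  exact: L2_fast_complete.
move=> e e0; have e50 : 0 < e / 5 by rewrite divr_gt0.
have [M0 [_ AM0]] := bA; pose M := `|M0| + 1.
have AM d : A d -> `|d| <= M.
  by move=> Ad; apply: (AM0 M) => //; rewrite /M (le_lt_trans (ler_norm _))// ltrDl.
have M10 : 0 <= M + 1 by rewrite /M !addr_ge0.
have [Phi [code Hcode]] := emb_small_parts M10 e50.
exists Phi, (fun phi => [set y | exists u, [/\ `|j u| <= M + 1, code u = phi &
  `|emb u - y| <= e / 5]]); split.
  move=> _ [d Ad <-]; have r0 : 0 < Num.min 1 (e / 5) by rewrite lt_min ltr01.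
  have [u []] := HT d _ r0; rewrite !lt_min => /andP[ju1 _] /andP[_ iu].
  exists (code u) => //; exists u; split => //; last exact: ltW.
  rewrite -[j u](subrK d) addrC (le_trans (ler_normD _ _))// lerD//; last exact: ltW.
  exact: AM.
move=> phi x y [u [uM cu ux]] [v [vM cv vy]].
have uv : `|emb u - emb v| <= e / 5 by apply: Hcode => //; rewrite cu cv.
have -> : x - y = (x - emb u) + (emb u - emb v) + (emb v - y) by rewrite !subrKA.
rewrite (le_trans (ler_normD _ _))//.
apply: (@le_trans _ _ (e / 5 + e / 5 + e / 5)); last by lra.
by rewrite lerD// (le_trans (ler_normD _ _))// lerD// distrC.
Qed.

End embedding.

Theorem proposition1p2 (R : realType) (N : nat) (p beta : R)
    (hN : (2 <= N)%N) (hp : 1 < p) (hpN : p < N%:R)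
    (hbeta : 0 < beta) (hbetap : beta < p)
    (D : completeNormedModType R) (j : {linear C1c0 R N -> D})
    (hD : is_completion (fun u : C1c0 R N => D12_enorm p beta u) j) :
  exists T : {linear D -> L2 N p beta},
    (forall u : C1c0 R N,
       exists2 f : L2fun N p beta, f = u :> ('rV[R]_N -> R) & T (j u) = L2_class f)
    /\ compact_embedding T.
Proof.
have [a ab aE] := @weights_admissible R N p beta hp hpN hbetap.
have [T [Tj cT]] := compact_extension ab aE hD.
by exists T; split => // u; exists (C1c0_L2fun ab u); rewrite ?Tj.
Qed.
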